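(* Let $V$ be a shift invariant subspace of $L^2(\mathbb{R})^n$, $J_{per}$ its periodic range function and $\Phi$ a countable subset of $L^2(\mathbb{R})^n$. Then the following are equivalent: (i) $\Phi\subset V$ and $\Phi$ is an NTF generator for $V$; (ii) for every $f\in\ell^2(\mathbb{Z})^n$, $$\sum_{\varphi\in\Phi}|\langle f\,|\,\mathcal{T}_{per}\varphi(\xi)\rangle|^2=\|J_{per}(\xi)(f)\|^2\quad\text{for a.e. }\xi\in\mathbb{R};$$ (iii) for every $0\neq k\in\mathbb{Z}$, $l,j\in\{1,\dots,n\}$ and $\alpha\in\{0,1,i=\sqrt{-1}\}$, $$\sum_{\varphi\in\Phi}|\hat\varphi_l(\xi-\theta_l)+\overline{\alpha}\,\hat\varphi_j(\xi-\theta_j+2k\pi)|^2=\|J_{per}(\xi)(\delta_{0l}+\alpha\delta_{kj})\|^2\quad\text{for a.e. }\xi\in\mathbb{R}.$$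
   Context: Setting: fix integers $N\ge 2$, $n\ge 1$, a permutation $\sigma$ of $\{1,\dots,n\}$ and points $z_k=e^{-i\theta_k}$ with $\theta_k\in[-\pi,\pi)$ and $z_k^N=z_{\sigma(k)}$ for all $k\in\{1,\dots,n\}$. On $L^2(\mathbb{R})$ let $T_0f(x)=f(x-1)$. On $L^2(\mathbb{R})^n$ let the translation be $T(f_1,\dots,f_n)=(z_1T_0f_1,\dots,z_nT_0f_n)$. Fourier transform: $\hat f(\xi)=\frac{1}{\sqrt{2\pi}}\int_{\mathbb{R}}f(x)e^{-i\xi x}\,dx$, taken componentwise on $L^2(\mathbb{R})^n$. Inner products are linear in the first variable. Fibers: for $\varphi=(\varphi_1,\dots,\varphi_n)\in L^2(\mathbb{R})^n$, $\mathcal{T}_{per}\varphi(\xi)\in\ell^2(\mathbb{Z})^n$ is given by $\mathcal{T}_{per}\varphi(\xi)(k,i)=\hat\varphi_i(\xi-\theta_i+2k\pi)$, $k\in\mathbb{Z}$, $i\in\{1,\dots,n\}$. For $k\in\mathbb{Z}$, $j\in\{1,\dots,n\}$, $\delta_{kj}$ denotes the canonical basis vector of $\ell^2(\mathbb{Z})^n$ that is $1$ at position $(k,j)$ and $0$ elsewhere. A closed subspace $V$ of $L^2(\mathbb{R})^n$ is shift invariant if $T^kV\subset V$ for all $k\in\mathbb{Z}$. Its periodic range function $J_{per}$ is the (a.e. unique) weakly measurable map from $\mathbb{R}$ to closed subspaces of $\ell^2(\mathbb{Z})^n$ with $J_{per}(\xi+2k\pi)=\lambda(k)^*(J_{per}(\xi))$,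 where $(\lambda(s)\alpha)(k,i)=\alpha(k-s,i)$, such that $V=\{f\in L^2(\mathbb{R})^n: \mathcal{T}_{per}f(\xi)\in J_{per}(\xi)\text{ for a.e. }\xi\}$. The same symbol $J_{per}(\xi)$ denotes the orthogonal projection onto that subspace. A family $(e_i)_{i\in I}$ in a Hilbert space $H$ is a normalized tight frame (NTF) for $H$ if $\sum_i|\langle f\,|\,e_i\rangle|^2=\|f\|^2$ for all $f\in H$. A set $\Phi\subset V$ is an NTF generator for $V$ if $\{T^k\varphi: k\in\mathbb{Z},\varphi\in\Phi\}$ is an NTF for $V$.
   Formalization: Two corrections to false claims: the Fourier transform is taken without the factor 1/√(2π) (otherwise (ii), (iii) are off by 2π), and (iii) ranges over all k, l, j with (k,j) ≠ (0,l), adding k = 0 with l ≠ j, instead of k ≠ 0 only (too weak for n ≥ 2). *)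

(* Defs.v *)
From HB Require Import structures.
From mathcomp Require Import all_boot all_order all_algebra.
From mathcomp Require Import all_classical all_reals all_analysis.
From mathcomp.real_closed Require Import complex.
From mathcomp Require Import measurable_realfun.
From mathcomp Require Import ring lra.

Set Implicit Arguments.
Unset Strict Implicit.
Unset Printing Implicit Defensive.

Import Order.TTheory GRing.Theory Num.Theory.
Import numFieldNormedType.Exports.

Local Open Scope classical_set_scope.
Local Open Scope ring_scope.
Local Open Scope complex_scope.
Local Open Scope quotient_scope.

Notation normc := ComplexField.Normc.normc.

Section ComplexPrelim.
Context {R : realType}.

Definition cis (t : R) : R[i] := cos t +i* sin t.

Lemma sqr_normcE (z : R[i]) : normc z ^+ 2 = complex.Re z ^+ 2 + complex.Im z ^+ 2.
Proof. by case: z => a b /=; rewrite sqr_sqrtr // addr_ge0 // sqr_ge0. Qed.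

Lemma sqr_normc_lin (a x y : R[i]) :
  normc (a * x + y) ^+ 2 <= 2 * normc a ^+ 2 * normc x ^+ 2 + 2 * normc y ^+ 2.
Proof.
rewrite !sqr_normcE; case: a x y => [a b] [x x'] [y y'] /=.
have := sqr_ge0 (a * x - b * x' - y).
have := sqr_ge0 (a * x' + b * x - y').
nra.
Qed.

Lemma Re_lin (a x y : R[i]) : complex.Re (a * x + y) =
  complex.Re a * complex.Re x - complex.Im a * complex.Im x + complex.Re y.
Proof. by case: a x y => ? ? [? ?] []. Qed.

Lemma Im_lin (a x y : R[i]) : complex.Im (a * x + y) =
  complex.Re a * complex.Im x + complex.Im a * complex.Re x + complex.Im y.
Proof. by case: a x y => ? ? [? ?] []. Qed.

End ComplexPrelim.

(* Hilbert space notions, relative to a given inner product, linear in its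
   first variable *)
Section InnerProduct.
Context {R : realType} {H : lmodType R[i]} (ip : H -> H -> R[i]).

Definition hnorm (x : H) : R := Num.sqrt (complex.Re (ip x x)).

Definition closed_subspace (V : set H) : Prop :=
  [/\ V 0,
      forall (a : R[i]) x y, V x -> V y -> V (a *: x + y) &
      forall (u : nat -> H) x, (forall m, V (u m)) ->
        hnorm (u m - x) @[m --> \oo] --> (0 : R) -> V x].

Definition oproj (V : set H) (x : H) : H :=
  xget 0 [set p | V p /\ forall v, V v -> ip (x - p) v = 0].

Definition adjoint (A : H -> H) (x : H) : H :=
  xget 0 [set y | forall w, ip (A w) x = ip w y].

(* NTF: normalized tight frame (Parseval frame). *)
Definition NTF {I : choiceType} (D : set I) (e : I -> H) (V : set H) : Prop :=
  (forall i, D i -> V (e i)) /\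
  (forall f, V f ->
    \esum_(i in D) (normc (ip f (e i)) ^+ 2)%:E = (hnorm f ^+ 2)%:E).

End InnerProduct.

Section SquareIntegrable.
Context {R : realType}.

Definition sqintegrable (f : R -> R[i]) : Prop :=
  [/\ measurable_fun [set: R] (fun x => complex.Re (f x)),
      measurable_fun [set: R] (fun x => complex.Im (f x)) &
      (\int[lebesgue_measure]_x (normc (f x) ^+ 2)%:E < +oo)%E].

Definition sqint : {pred R -> R[i]} := fun f => `[< sqintegrable f >].

Record sqfun := SqFun { sqfun_val :> R -> R[i]; _ : sqfun_val \in sqint }.
HB.instance Definition _ := [isSub for sqfun_val].
HB.instance Definition _ := [Choice of sqfun by <:].

Lemma measurable_sqr_normc (f : R -> R[i]) :
  measurable_fun [set: R] (fun x => complex.Re (f x)) ->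
  measurable_fun [set: R] (fun x => complex.Im (f x)) ->
  measurable_fun [set: R] (fun x => (normc (f x) ^+ 2)%:E).
Proof.
move=> mr mi; apply/measurable_EFinP.
have -> : (fun x => normc (f x) ^+ 2) =
    (fun x => complex.Re (f x) ^+ 2 + complex.Im (f x) ^+ 2).
  by apply/funext => x; rewrite sqr_normcE.
by apply: measurable_funD; apply: measurable_funX.
Qed.

Lemma sqint_submod_closed : submod_closed sqint.
Proof.
split.
  apply/asboolP; split; [exact: measurable_cst|exact: measurable_cst|].
  rewrite (eq_integral (fun=> 0%E)) ?integral0 // => x _.
  by rewrite /= expr0n /= addr0 sqrtr0 expr0n.
move=> a f g /asboolP[fr fi f2] /asboolP[gr gi g2]; apply/asboolP.
have mr : measurable_fun [set: R] (fun x => complex.Re ((a *: f + g) x)).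
  have -> : (fun x => complex.Re ((a *: f + g) x)) =
      (fun x => complex.Re a * complex.Re (f x) - complex.Im a * complex.Im (f x)
                + complex.Re (g x)).
    by apply/funext => x; exact: Re_lin.
  apply: measurable_funD => //.
  by apply: measurable_funB; apply: measurable_funM => //; exact: measurable_cst.
have mi : measurable_fun [set: R] (fun x => complex.Im ((a *: f + g) x)).
  have -> : (fun x => complex.Im ((a *: f + g) x)) =
      (fun x => complex.Re a * complex.Im (f x) + complex.Im a * complex.Re (f x)
                + complex.Im (g x)).
    by apply/funext => x; exact: Im_lin.
  apply: measurable_funD => //.
  by apply: measurable_funD; apply: measurable_funM => //; exact: measurable_cst.
split=> //.
apply: (@le_lt_trans _ _ (\int[lebesgue_measure]_x
  ((2 * normc a ^+ 2)%:E * (normc (f x) ^+ 2)%:E + 2%:E * (normc (g x) ^+ 2)%:E)))%E.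
  apply: ge0_le_integral => //.
  - by move=> x _; rewrite lee_fin sqr_ge0.
  - exact: measurable_sqr_normc.
  - apply: emeasurable_funD; apply: emeasurable_funM;
      by [exact: measurable_cst|exact: measurable_sqr_normc].
  - by move=> x _; rewrite -!EFinM -EFinD lee_fin; exact: sqr_normc_lin.
rewrite ge0_integralD //; first last.
- by apply: emeasurable_funM; [exact: measurable_cst|exact: measurable_sqr_normc].
- by move=> x _; rewrite -EFinM lee_fin mulr_ge0 // sqr_ge0.
- by apply: emeasurable_funM; [exact: measurable_cst|exact: measurable_sqr_normc].
- by move=> x _; rewrite -EFinM lee_fin mulr_ge0 ?sqr_ge0 // mulr_ge0 // sqr_ge0.
rewrite !ge0_integralZl //; first last.
- by rewrite lee_fin mulr_ge0 // sqr_ge0.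
- by move=> x _; rewrite lee_fin sqr_ge0.
- exact: measurable_sqr_normc.
- by move=> x _; rewrite lee_fin sqr_ge0.
- exact: measurable_sqr_normc.
apply: lte_add_pinfty.
- by apply: lte_mul_pinfty => //; rewrite lee_fin mulr_ge0 // sqr_ge0.
- by apply: lte_mul_pinfty.
Qed.

HB.instance Definition _ := GRing.isSubmodClosed.Build _ _ sqint sqint_submod_closed.
HB.instance Definition _ := [SubChoice_isSubLmodule of sqfun by <:].

#[local] Instance ae_lebesgue_filter :
  Filter (nbhs (almost_everywhere (@lebesgue_measure R))).
Proof. exact: ae_filter_ringOfSetsType. Qed.

Definition ae_eq_sqfun (f g : sqfun) : bool :=
  `[< {ae lebesgue_measure, forall x : R, f x = g x} >].

Lemma ae_eq_sqfun_refl : reflexive ae_eq_sqfun.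
Proof. by move=> f; apply/asboolP; apply: aeW. Qed.

Lemma ae_eq_sqfun_sym : symmetric ae_eq_sqfun.
Proof.
by move=> f g; apply/idP/idP => /asboolP fg; apply/asboolP;
  apply: filterS fg => x ->.
Qed.

Lemma ae_eq_sqfun_trans : transitive ae_eq_sqfun.
Proof.
move=> g f h /asboolP fg /asboolP gh; apply/asboolP.
by apply: filterS2 fg gh => x -> ->.
Qed.

Canonical ae_eq_sqfun_equiv :=
  EquivRel ae_eq_sqfun ae_eq_sqfun_refl ae_eq_sqfun_sym ae_eq_sqfun_trans.

(* The elements of L^2(R) are almost everywhere classes; an element f coerces
   to one of its (Borel) representatives. *)
Definition L2 : Type := {eq_quot ae_eq_sqfun}.
HB.instance Definition _ := Choice.on L2.
HB.instance Definition _ := EqQuotient.on L2.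

Definition classL2 (f : sqfun) : L2 := \pi_L2%qT f.
Definition reprL2 (f : L2) : sqfun := repr f.
Definition L2_fun (f : L2) : R -> R[i] := reprL2 f.
Coercion L2_fun : L2 >-> Funclass.

Lemma classL2P (f g : sqfun) :
  classL2 f = classL2 g <-> {ae lebesgue_measure, forall x : R, f x = g x}.
Proof.
split=> [/eqmodP /asboolP //|fg].
by apply/eqmodP/asboolP.
Qed.

Lemma reprL2K : cancel reprL2 classL2.
Proof. exact: reprK. Qed.

Lemma classL2K (f : sqfun) :
  {ae lebesgue_measure, forall x : R, reprL2 (classL2 f) x = f x}.
Proof. by apply/classL2P; rewrite reprL2K. Qed.

Definition L2_zero : L2 := classL2 0.
Definition L2_opp (f : L2) : L2 := classL2 (- reprL2 f).
Definition L2_add (f g : L2) : L2 := classL2 (reprL2 f + reprL2 g).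
Definition L2_scale (a : R[i]) (f : L2) : L2 := classL2 (a *: reprL2 f).

Lemma classL2_opp f : L2_opp (classL2 f) = classL2 (- f).
Proof.
apply/classL2P; apply: filterS (classL2K f) => x /= e.
by rewrite /GRing.opp /= e.
Qed.

Lemma classL2_add f g : L2_add (classL2 f) (classL2 g) = classL2 (f + g).
Proof.
apply/classL2P; apply: filterS2 (classL2K f) (classL2K g) => x /= e1 e2.
by rewrite /GRing.add /= e1 e2.
Qed.

Lemma classL2_scale a f : L2_scale a (classL2 f) = classL2 (a *: f).
Proof.
apply/classL2P; apply: filterS (classL2K f) => x /= e.
by rewrite /GRing.scale /= e.
Qed.

Lemma L2_ind (P : L2 -> Prop) : (forall f, P (classL2 f)) -> forall f, P f.
Proof. by move=> h f; rewrite -(reprL2K f). Qed.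

Lemma L2_addA : associative L2_add.
Proof.
by elim/L2_ind=> f; elim/L2_ind=> g; elim/L2_ind=> h; rewrite !classL2_add addrA.
Qed.
Lemma L2_addC : commutative L2_add.
Proof. by elim/L2_ind=> f; elim/L2_ind=> g; rewrite !classL2_add addrC. Qed.
Lemma L2_add0 : left_id L2_zero L2_add.
Proof. by elim/L2_ind=> f; rewrite classL2_add add0r. Qed.
Lemma L2_addN : left_inverse L2_zero L2_opp L2_add.
Proof. by elim/L2_ind=> f; rewrite classL2_opp classL2_add addNr. Qed.

HB.instance Definition _ :=
  GRing.isZmodule.Build L2 L2_addA L2_addC L2_add0 L2_addN.

Lemma L2_scaleA a b f : L2_scale a (L2_scale b f) = L2_scale (a * b) f.
Proof. by elim/L2_ind: f => f; rewrite !classL2_scale scalerA. Qed.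
Lemma L2_scale1 : left_id 1 L2_scale.
Proof. by elim/L2_ind=> f; rewrite classL2_scale scale1r. Qed.
Lemma L2_scaleDr : right_distributive L2_scale +%R.
Proof.
move=> a; elim/L2_ind=> f; elim/L2_ind=> g.
by rewrite /GRing.add /= classL2_add !classL2_scale classL2_add scalerDr.
Qed.
Lemma L2_scaleDl f : {morph L2_scale^~ f : a b / a + b}.
Proof.
move=> a b; elim/L2_ind: f => f.
by rewrite [RHS]/GRing.add /= !classL2_scale classL2_add scalerDl.
Qed.

HB.instance Definition _ :=
  GRing.Zmodule_isLmodule.Build R[i] L2 L2_scaleA L2_scale1 L2_scaleDr L2_scaleDl.

(* The class of f if f is square integrable (0 otherwise). *)
Definition toL2 (f : R -> R[i]) : L2 := classL2 (insubd 0 f).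

Definition cintegral (f : R -> R[i]) : R[i] :=
  Rintegral lebesgue_measure setT (fun x => complex.Re (f x)) +i*
  Rintegral lebesgue_measure setT (fun x => complex.Im (f x)).

Definition ipL2 (f g : L2) : R[i] := cintegral (fun x => f x * (g x)^*).

Definition shiftL2 (s : R) (f : L2) : L2 := toL2 (fun x => f (x - s)).

Definition cintegrable (f : R -> R[i]) : Prop :=
  lebesgue_measure.-integrable setT (fun x => (complex.Re (f x))%:E) /\
  lebesgue_measure.-integrable setT (fun x => (complex.Im (f x))%:E).

(* Normalization: no factor (2 pi)^(-1/2). It is for this normalization that
   the fiber identities characterize normalized tight frames: the integer
   translates of the phi with fourier phi = 1 on [-pi, pi[ and 0 elsewhere are
   an orthonormal family, and sum_k |fourier phi (xi + 2 k pi)|^2 = 1. *)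
Definition fourier_integral (f : R -> R[i]) (xi : R) : R[i] :=
  cintegral (fun x => f x * cis (- (xi * x))).

(* The continuous extension to L^2 of the integral transform on L^1 `&` L^2. *)
Definition is_fourier (f g : L2) : Prop :=
  forall h : nat -> L2, (forall m, cintegrable (h m)) ->
    hnorm ipL2 (h m - f) @[m --> \oo] --> (0 : R) ->
    (\int[lebesgue_measure]_xi
      (normc (fourier_integral (h m) xi - g xi) ^+ 2)%:E)%E @[m --> \oo]
      --> (0 : \bar R).

Definition fourier (f : L2) : L2 := xget 0 [set g | is_fourier f g].

End SquareIntegrable.
Arguments L2 : clear implicits.

Section SquareSummable.
Context {R : realType}.

Definition sqsum : {pred int -> R[i]} :=
  fun a => `[< (\esum_(k in [set: int]) (normc (a k) ^+ 2)%:E < +oo)%E >].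

Record ell2 := Ell2 { ell2_val :> int -> R[i]; _ : ell2_val \in sqsum }.
HB.instance Definition _ := [isSub for ell2_val].
HB.instance Definition _ := [Choice of ell2 by <:].

Lemma sqsum_submod_closed : submod_closed sqsum.
Proof.
split.
  apply/asboolP; rewrite esum1 // => k _.
  by rewrite /= expr0n /= addr0 sqrtr0 expr0n.
move=> c a b /asboolP a2 /asboolP b2; apply/asboolP.
have n0 (x : R[i]) : (0 <= (normc x ^+ 2)%:E)%E by rewrite lee_fin sqr_ge0.
have le (u v : int -> R[i]) (t : R) : (0 < t) ->
    (\esum_(k in [set: int]) (normc (u k) ^+ 2)%:E < +oo)%E ->
    (\esum_(k in [set: int]) (t * normc (u k) ^+ 2)%:E < +oo)%E.
  move=> t0 u2; apply: (@le_lt_trans _ _ (t%:E *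
      \esum_(k in [set: int]) (normc (u k) ^+ 2)%:E)%E); last first.
    by apply: lte_mul_pinfty => //; rewrite ?lee_fin ?ltW.
  apply: ge_ereal_sup => _ [F [finF _] <-].
  under eq_fsbigr do rewrite EFinM.
  rewrite -ge0_mule_fsumr; last by move=> ?; exact: n0.
  apply: lee_wpmul2l; first by rewrite lee_fin ltW.
  by apply: ereal_sup_ubound; exists F.
have a2' := le a 0 (2 * normc c ^+ 2 + 1) _ a2.
have b2' := le b 0 2 _ b2.
apply: (@le_lt_trans _ _ (\esum_(k in [set: int])
   (((2 * normc c ^+ 2 + 1) * normc (a k) ^+ 2)%:E + (2 * normc (b k) ^+ 2)%:E))%E).
  apply: le_esum => k _; rewrite -EFinD lee_fin.
  apply: le_trans (sqr_normc_lin c (a k) (b k)) _.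
  by rewrite lerD2r; apply: ler_wpM2r; rewrite ?sqr_ge0 ?lerDl.
have c0 : 0 < 2 * normc c ^+ 2 + 1 by rewrite ltr_wpDl // mulr_ge0 // sqr_ge0.
rewrite esumD; first last.
- by move=> k _; rewrite lee_fin mulr_ge0 // sqr_ge0.
- by move=> k _; rewrite lee_fin mulr_ge0 ?sqr_ge0 // ltW.
by apply: lte_add_pinfty; [exact: a2'|exact: b2'].
Qed.

HB.instance Definition _ := GRing.isSubmodClosed.Build _ _ sqsum sqsum_submod_closed.
HB.instance Definition _ := [SubChoice_isSubLmodule of ell2 by <:].

Lemma sqsum_fsupp (a : int -> R[i]) : finite_set [set k | a k != 0] -> a \in sqsum.
Proof.
move=> fin; apply/asboolP.
rewrite (_ : esum _ _ = \esum_(k in [set k | a k != 0]) (normc (a k) ^+ 2)%:E).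
  rewrite esum_fset //; last by move=> k _; rewrite lee_fin sqr_ge0.
  by rewrite fsumEFin // ltry.
rewrite [RHS]esum_mkcond; apply: eq_esum => k _.
case: ifPn => // /negP; rewrite inE /= => /negP; rewrite negbK => /eqP ->.
by rewrite /= expr0n /= addr0 sqrtr0 expr0n.
Qed.

(* The element of l^2(Z) with coordinates a if a is square summable
   (0 otherwise). *)
Definition toell2 (a : int -> R[i]) : ell2 := insubd 0 a.

Definition rsum (a : int -> R) : R :=
  fine (\esum_(k in [set: int]) ((a^\+ k)%:E)) -
  fine (\esum_(k in [set: int]) ((a^\- k)%:E)).

Definition ipell2 (a b : ell2) : R[i] :=
  rsum (fun k => complex.Re (a k * (b k)^*)) +i*
  rsum (fun k => complex.Im (a k * (b k)^*)).

End SquareSummable.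
Arguments ell2 : clear implicits.

Definition L2n (R : realType) (n : nat) : Type := {ffun 'I_n -> L2 R}.
HB.instance Definition _ R n := GRing.Lmodule.on (L2n R n).

Definition ell2n (R : realType) (n : nat) : Type := {ffun 'I_n -> ell2 R}.
HB.instance Definition _ R n := GRing.Lmodule.on (ell2n R n).

Section VectorValued.
Context {R : realType} {n : nat}.

Definition ipL2n (f g : L2n R n) : R[i] := \sum_(i < n) ipL2 (f i) (g i).

Definition ipell2n (a b : ell2n R n) : R[i] := \sum_(i < n) ipell2 (a i) (b i).

Definition transl (z : 'I_n -> R[i]) (f : L2n R n) : L2n R n :=
  [ffun i => z i *: shiftL2 1 (f i)].

Definition transl_inv (z : 'I_n -> R[i]) (f : L2n R n) : L2n R n :=
  [ffun i => (z i)^-1 *: shiftL2 (-1) (f i)].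

Definition transl_pow (z : 'I_n -> R[i]) (k : int) (f : L2n R n) : L2n R n :=
  match k with
  | Posz m => iter m (transl z) f
  | Negz m => iter m.+1 (transl_inv z) f
  end.

Definition shift_invariant (z : 'I_n -> R[i]) (V : set (L2n R n)) : Prop :=
  closed_subspace ipL2n V /\
  forall (k : int) f, V f -> V (transl_pow z k f).

(* The family is indexed by int * Phi, hence counted with multiplicity. *)
Definition NTF_generator (z : 'I_n -> R[i]) (Phi V : set (L2n R n)) : Prop :=
  NTF ipL2n ([set: int] `*` Phi) (fun p => transl_pow z p.1 p.2) V.

Definition delta (k : int) (j : 'I_n) : ell2n R n :=
  [ffun i => if i == j then toell2 (fun m => (m == k)%:R) else 0].

Lemma deltaE (k : int) (j i : 'I_n) (m : int) :
  delta k j i m = ((i == j) && (m == k))%:R.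
Proof.
rewrite ffunE; case: eqP => //= _.
have h : (fun m : int => (m == k)%:R : R[i]) \in sqsum.
  apply: sqsum_fsupp; apply: (@sub_finite_set _ _ [set k]) => // x /=.
  by case: (x =P k) => //; rewrite eqxx.
by rewrite /toell2 -[ell2_val _]/(val _) insubdK.
Qed.

Definition lam (s : int) (a : ell2n R n) : ell2n R n :=
  [ffun i => toell2 (fun k => a i (k - s))].

(* toell2 takes its default value only on a null set of xi. *)
Definition Tper (theta : 'I_n -> R) (phi : L2n R n) (xi : R) : ell2n R n :=
  [ffun i => toell2 (fun k : int => fourier (phi i) (xi - theta i + 2 * k%:~R * pi))].

Definition lebesgue_measurable (g : R -> R) : Prop :=
  forall A : set R, measurable A ->
    completed_algebra_gen (@lebesgue_measure R) (g @^-1` A).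

Definition weakly_measurable (J : R -> set (ell2n R n)) : Prop :=
  forall a b : ell2n R n,
    lebesgue_measurable (fun xi => complex.Re (ipell2n (oproj ipell2n (J xi) a) b)) /\
    lebesgue_measurable (fun xi => complex.Im (ipell2n (oproj ipell2n (J xi) a) b)).

Definition periodic_range_function (theta : 'I_n -> R) (V : set (L2n R n))
    (J : R -> set (ell2n R n)) : Prop :=
  [/\ forall xi, closed_subspace ipell2n (J xi),
      weakly_measurable J,
      forall (xi : R) (k : int),
        J (xi + 2 * k%:~R * pi) = adjoint ipell2n (lam k) @` J xi &
      V = [set f | {ae lebesgue_measure, forall xi : R, J xi (Tper theta f xi)}]].

End VectorValued.

(* Main.v *)
(** Write tau for T_per, J for J_per, and let F be in L^2(R)^n. Then
    |F|^2 = 1/(2 pi) int_[-pi,pi[ |tau F(xi)|^2 dxi by Plancherel, and tau turns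
    T^k into multiplication by e^(-i k xi), so Parseval's identity on [-pi,pi[
    gives
      sum_k |<F, T^k phi>|^2 = 1/(2 pi) int_[-pi,pi[ |<tau F(xi), tau phi(xi)>|^2 dxi.
    Hence (i) equates the integrals of sum_phi |<tau F, tau phi>|^2 and |tau F|^2
    for all F in V. Testing this on the F with fibers 1_E(xi) J(xi) f, where E is
    an arbitrary Borel set, yields (ii); such F exist since the Fourier transform
    is onto. Statement (iii) is (ii) for f = delta_0l + alpha delta_kj.
    Conversely, the periodicity of J transports (iii) to the vectors
    delta_kl + alpha delta_k'j; by polarization and then by continuity the
    identity in (ii) holds for all f at once outside one null set. There, taking
    f orthogonal to J(xi) forces tau phi(xi) to be in J(xi), so that Phi is
    contained in V, and integrating the identity at f = tau F(xi) gives (i).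
    Plancherel's theorem for functions supported in [-l,l] follows from
    Parseval's identity on [-l,l], applied to all modulations of the function. *)
Require Import Defs.
From mathcomp Require Import all_boot all_order all_algebra all_fingroup.
From mathcomp Require Import all_classical all_reals all_analysis.
From mathcomp.real_closed Require Import complex.
From mathcomp Require Import measurable_realfun.
From mathcomp Require Import ring lra.

Set Implicit Arguments.
Unset Strict Implicit.
Unset Printing Implicit Defensive.

Import Order.TTheory GRing.Theory Num.Theory.
Import numFieldNormedType.Exports.

Local Open Scope classical_set_scope.
Local Open Scope ring_scope.
Local Open Scope complex_scope.

(** * Complex numbers and abstract inner product spaces *)

Section Complex.
Context {R : realType}.
Implicit Types x y z : R[i].

(** The product of two fibers is only an integrable function of [xi], so Parseval's identity has to
    hold on L^1, with both sides possibly infinite. For this reason it rests on the uniqueness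
    theorem for Fourier coefficients of integrable functions. That theorem is proved by
    approximating indicators of intervals by trigonometric polynomials with values in [0,1], which
    dominated convergence can handle. In (ii) the exceptional null set depends on [f], which ranges
    over an uncountable set, while (iii) involves countably many vectors. Hence the way back to (i)
    starts from (iii), where the null sets can be united. The values 0, 1 and i of alpha are what
    polarization needs: 0 gives the diagonal entries of a Hermitian form, 1 and i the real and
    imaginary parts of the others. Weak measurability of [J] refers to the completed sigma-algebra,
    whereas the integrals are taken of Borel functions; projected vectors are therefore replaced by
    Borel fields that agree with them almost everywhere. *)

Lemma CReD x y : complex.Re (x + y) = complex.Re x + complex.Re y.
Proof. by case: x y => ? ? []. Qed.
Lemma CImD x y : complex.Im (x + y) = complex.Im x + complex.Im y.
Proof. by case: x y => ? ? []. Qed.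
Lemma CReN x : complex.Re (- x) = - complex.Re x. Proof. by case: x. Qed.
Lemma CImN x : complex.Im (- x) = - complex.Im x. Proof. by case: x. Qed.
Lemma CReM x y : complex.Re (x * y) =
  complex.Re x * complex.Re y - complex.Im x * complex.Im y.
Proof. by case: x y => ? ? []. Qed.
Lemma CImM x y : complex.Im (x * y) =
  complex.Re x * complex.Im y + complex.Im x * complex.Re y.
Proof. by case: x y => ? ? []. Qed.
Lemma CReJ x : complex.Re x^* = complex.Re x. Proof. by case: x. Qed.
Lemma CImJ x : complex.Im x^* = - complex.Im x. Proof. by case: x. Qed.

Lemma complexP x y : complex.Re x = complex.Re y -> complex.Im x = complex.Im y ->
  x = y.
Proof. by case: x y => a b [c d] /= -> ->. Qed.

Lemma CReC (a : R) : complex.Re a%:C = a. Proof. by []. Qed.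
Lemma CImC (a : R) : complex.Im a%:C = 0. Proof. by []. Qed.

Definition CReImE := (CReD, CImD, CReN, CImN, CReM, CImM, CReJ, CImJ).

Lemma sqr_normcJ x : normc x^* ^+ 2 = normc x ^+ 2.
Proof. by rewrite !sqr_normcE !CReImE sqrrN. Qed.

Lemma sqr_normcM x y : normc (x * y) ^+ 2 = normc x ^+ 2 * normc y ^+ 2.
Proof. by rewrite !sqr_normcE !CReImE; ring. Qed.

Lemma sqr_normc_cis (t : R) : normc (cis t) ^+ 2 = 1.
Proof. by rewrite sqr_normcE /= cos2Dsin2. Qed.

Lemma cisD (s t : R) : cis (s + t) = cis s * cis t.
Proof. by apply: complexP; rewrite !CReImE /= ?cosD ?sinD; ring. Qed.

Lemma cis0 : cis 0 = 1 :> R[i].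
Proof. by rewrite /cis cos0 sin0. Qed.

Lemma conj_cis (t : R) : (cis t)^* = cis (- t).
Proof. by rewrite /cis /= cosN sinN. Qed.

Lemma cis_neq0 (t : R) : cis t != 0.
Proof.
apply/eqP => c0; have := sqr_normc_cis t.
by rewrite c0 sqr_normcE /= expr0n /= addr0 => /esym/eqP; rewrite oner_eq0.
Qed.

Lemma cisV (t : R) : (cis t)^-1 = cis (- t).
Proof.
apply: (mulfI (cis_neq0 t)); rewrite divff ?cis_neq0 //.
by rewrite -cisD subrr cis0.
Qed.

Lemma sqr_normc_eq0 x : normc x ^+ 2 = 0 -> x = 0.
Proof.
rewrite sqr_normcE => h; apply: complexP => /=; nra.
Qed.

Lemma sqr_normcN x : normc (- x) ^+ 2 = normc x ^+ 2.
Proof. by rewrite !sqr_normcE !CReImE !sqrrN. Qed.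

End Complex.

Lemma small_invS {R : realType} (e : R) : 0 < e ->
  exists N, forall m, (N <= m)%N -> m.+1%:R^-1 <= e.
Proof.
move=> e0; exists (Num.truncn e^-1) => m Nm.
rewrite invf_ple ?posrE ?ltr0n //; apply: le_trans (ltW (truncnS_gt _)) _.
by rewrite ler_nat ltnS.
Qed.

Section InnerProductTheory.
Context {R : realType} {H : lmodType R[i]} (ip : H -> H -> R[i]).
Implicit Types (x y : H) (V : set H).

(** A predicate on a given form, so that one theory applies to [ipell2], [ipL2], [ipell2n] and
    [ipL2n] as they stand. *)
Definition inner_product : Prop :=
  [/\ forall (a : R[i]) x y z, ip (a *: x + y) z = a * ip x z + ip y z,
      forall x y, ip y x = (ip x y)^*,
      forall x, 0 <= complex.Re (ip x x) &
      forall x, complex.Re (ip x x) = 0 -> x = 0].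

Definition sqnorm x : R := complex.Re (ip x x).

Definition hcomplete : Prop := forall u : nat -> H,
  (forall e : R, 0 < e -> exists N, forall m k, (N <= m)%N -> (N <= k)%N ->
     sqnorm (u m - u k) <= e) ->
  exists x, sqnorm (u m - x) @[m --> \oo] --> (0 : R).

Hypothesis ipP : inner_product.

Lemma ip_linl (a : R[i]) x y z : ip (a *: x + y) z = a * ip x z + ip y z.
Proof. by case: ipP. Qed.
Lemma ipC x y : ip y x = (ip x y)^*. Proof. by case: ipP. Qed.
Lemma sqnorm_ge0 x : 0 <= sqnorm x. Proof. by case: ipP => _ _ h _; exact: h. Qed.
Lemma sqnorm_eq0 x : sqnorm x = 0 -> x = 0. Proof. by case: ipP => _ _ _; exact. Qed.
Lemma ipDl x y z : ip (x + y) z = ip x z + ip y z.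
Proof. by have := ip_linl 1 x y z; rewrite scale1r mul1r. Qed.
Lemma ip0l z : ip 0 z = 0.
Proof. by apply: (addrI (ip 0 z)); rewrite -ipDl !addr0. Qed.
Lemma ipZl (a : R[i]) x z : ip (a *: x) z = a * ip x z.
Proof. by rewrite -[a *: x]addr0 ip_linl ip0l addr0. Qed.
Lemma ipNl x z : ip (- x) z = - ip x z.
Proof. by rewrite -scaleN1r ipZl mulN1r. Qed.
Lemma ipDr x y z : ip z (x + y) = ip z x + ip z y.
Proof. by rewrite ipC ipDl rmorphD /= -!(ipC _ z). Qed.
Lemma ipZr (a : R[i]) x z : ip z (a *: x) = a^* * ip z x.
Proof. by rewrite ipC ipZl rmorphM /= -!(ipC _ z). Qed.
Lemma ip0r z : ip z 0 = 0.
Proof. by rewrite ipC ip0l conjc0. Qed.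
Lemma ipNr x z : ip z (- x) = - ip z x.
Proof. by rewrite ipC ipNl rmorphN /= -(ipC _ z). Qed.
Lemma ip_suml (I : Type) (s : seq I) (P : pred I) (F : I -> H) z :
  ip (\sum_(i <- s | P i) F i) z = \sum_(i <- s | P i) ip (F i) z.
Proof. by rewrite (big_morph (ip^~ z) (fun x y => ipDl x y z) (ip0l z)). Qed.

Lemma sqr_hnorm x : hnorm ip x ^+ 2 = sqnorm x.
Proof. by rewrite sqr_sqrtr // sqnorm_ge0. Qed.

Lemma ip_selfE x : ip x x = (sqnorm x)%:C.
Proof.
apply: complexP => //=; have := ipC x x => /(congr1 (@complex.Im R)).
rewrite CImJ; lra.
Qed.

Lemma sqnormD x y : sqnorm (x + y) = sqnorm x + sqnorm y + 2 * complex.Re (ip x y).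
Proof. by rewrite /sqnorm ipDl !ipDr (ipC x y) !CReImE; ring. Qed.
Lemma sqnormN x : sqnorm (- x) = sqnorm x.
Proof. by rewrite /sqnorm ipNl ipNr opprK. Qed.
Lemma sqnormB x y : sqnorm (x - y) = sqnorm x + sqnorm y - 2 * complex.Re (ip x y).
Proof. by rewrite sqnormD sqnormN ipNr CReN mulrN. Qed.
Lemma sqnormBC x y : sqnorm (x - y) = sqnorm (y - x).
Proof. by rewrite -opprB sqnormN. Qed.
Lemma sqnormZ (a : R[i]) x : sqnorm (a *: x) = normc a ^+ 2 * sqnorm x.
Proof.
by rewrite {1}/sqnorm ipZl ipZr ip_selfE sqr_normcE !CReImE /=; ring.
Qed.
Lemma sqnorm0 : sqnorm 0 = 0. Proof. by rewrite /sqnorm ip0l. Qed.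
Lemma parallelogram x y :
  sqnorm (x + y) + sqnorm (x - y) = 2 * sqnorm x + 2 * sqnorm y.
Proof. by rewrite sqnormD sqnormB; ring. Qed.
Lemma sqnormD2 x y : sqnorm (x + y) <= 2 * sqnorm x + 2 * sqnorm y.
Proof. by rewrite -parallelogram lerDl sqnorm_ge0. Qed.
Lemma sqnormB3 x y z : sqnorm (x - z) <= 2 * sqnorm (x - y) + 2 * sqnorm (y - z).
Proof. by rewrite (le_trans _ (sqnormD2 _ _)) // addrA subrK. Qed.

Lemma polarization x y : ip x y =
  ((sqnorm (x + y) - sqnorm (x - y)) / 4) +i*
  ((sqnorm (x + 'i *: y) - sqnorm (x - 'i *: y)) / 4).
Proof.
have e (a b c : R) : ((a + b + 2 * c) - (a + b - 2 * c)) / 4 = c by field.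
apply: complexP; rewrite /= sqnormB sqnormD e // ipZr !CReImE /=; ring.
Qed.

(** The squared distance from [x] to its projection on the line spanned by [y] is nonnegative. *)
Lemma cauchy_schwarz x y : normc (ip x y) ^+ 2 <= sqnorm x * sqnorm y.
Proof.
have [y0|yn0] := eqVneq (sqnorm y) 0.
  by rewrite (sqnorm_eq0 y0) ip0r sqnorm0 sqr_normcE /= expr0n addr0 mulr0.
have y0 : 0 < sqnorm y by rewrite lt_def yn0 sqnorm_ge0.
have := sqnorm_ge0 (x - (ip x y / (sqnorm y)%:C) *: y).
set c := ip x y / _.
have cE : c * (sqnorm y)%:C = ip x y.
  by rewrite mulfVK //; apply: contra_neq yn0 => /(congr1 (@complex.Re R)).
clearbody c.
have Rec : complex.Re c * sqnorm y = complex.Re (ip x y).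
  by rewrite -cE !CReImE /=; ring.
have Imc : complex.Im c * sqnorm y = complex.Im (ip x y).
  by rewrite -cE !CReImE /=; ring.
rewrite sqnormB sqnormZ ipZr !sqr_normcE !CReImE.
rewrite -Rec -Imc => h.
rewrite -(ler_pM2r y0) -subr_ge0.
apply: le_trans (mulr_ge0 (ltW y0) (mulr_ge0 (ltW y0) h)) _.
rewrite le_eqVlt; apply/orP; left; apply/eqP; ring.
Qed.

(** Pythagoras for the projection onto the span of finitely many orthogonal vectors. The common
    squared norm [c] is kept because the exponentials on [-l,l] will not be normalized. *)
Lemma sqnorm_orthogonal_residual (I : eqType) (s : seq I) (e : I -> H) (c : R) f :
  uniq s -> 0 < c ->
  {in s &, forall i j, ip (e i) (e j) = (if i == j then c else 0)%:C} ->
  sqnorm (f - \sum_(i <- s) (ip f (e i) / c%:C) *: e i) =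
  sqnorm f - \sum_(i <- s) normc (ip f (e i)) ^+ 2 / c.
Proof.
move=> us c0 eo; set p := \sum_(i <- s) _.
have cn0 : c%:C != 0 :> R[i] by apply/eqP => /(congr1 (@complex.Re R)) /=; lra.
have pe i : i \in s -> ip p (e i) = ip f (e i).
  move=> si; rewrite /p ip_suml (big_rem i) //= ipZl eo // eqxx mulfVK // big_seq.
  rewrite big1 ?addr0 // => j; rewrite mem_rem_uniq // inE => /andP[ji sj].
  by rewrite ipZl eo // (negbTE ji) mulr0.
(* The residual [f - p] is orthogonal to every [e i], hence to [p]. *)
have fp : ip p p = ip f p.
  apply/eqP; rewrite -subr_eq0 -ipNl -ipDl ipC {1}/p ip_suml.
  rewrite big_seq big1 ?conjc0 // => i si.
  by rewrite ipZl (ipC (p - f)) ipDl ipNl pe // subrr conjc0 mulr0.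
rewrite sqnormB -fp.
rewrite -/(sqnorm p) (_ : sqnorm p = \sum_(i <- s) normc (ip f (e i)) ^+ 2 / c); first ring.
rewrite /sqnorm {1}/p ip_suml.
rewrite (big_morph (@complex.Re R) (@CReD R) (erefl _)) big_seq [RHS]big_seq.
apply: eq_bigr => i si.
rewrite ipZl (ipC p (e i)) pe // sqr_normcE.
have -> : c%:C^-1 = (c^-1)%:C by rewrite fmorphV.
by rewrite !CReImE /=; ring.
Qed.

Lemma cvg_sqnorm (u : nat -> H) x :
  sqnorm (u m - x) @[m --> \oo] --> (0 : R) -> sqnorm (u m) @[m --> \oo] --> sqnorm x.
Proof.
move=> ux; apply/cvgrPdist_le => e e0.
have s0 := sqnorm_ge0 x.
(* This bound is at most e/4, and its product with [sqnorm x] is at most (e/4)^2, so by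
   Cauchy-Schwarz the cross term is at most e/4 as well. *)
have d0 : 0 < e ^+ 2 / (16 * (sqnorm x + e + 1)) by rewrite divr_gt0 ?exprn_gt0 //; lra.
near=> m.
have h : sqnorm (u m - x) <= e ^+ 2 / (16 * (sqnorm x + e + 1)).
  near: m; move/cvgrPdist_le: ux => /(_ _ d0); apply: filterS => m.
  by rewrite sub0r normrN ger0_norm // sqnorm_ge0.
have h2 : sqnorm (u m - x) <= e / 4.
  apply: le_trans h _; rewrite ler_pdivrMr; last lra.
  nra.
have := cauchy_schwarz (u m - x) x; rewrite sqr_normcE.
have := sqnormD (u m - x) x; rewrite subrK.
set a := complex.Re _; set b := complex.Im _ => E cs.
have a2 : a ^+ 2 <= (e / 4) ^+ 2.
  have : a ^+ 2 <= sqnorm (u m - x) * sqnorm x by have := sqr_ge0 b; lra.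
  move=> /le_trans; apply.
  apply: (@le_trans _ _ (e ^+ 2 / (16 * (sqnorm x + e + 1)) * sqnorm x)).
    exact: ler_wpM2r.
  rewrite -mulrA [in leLHS]mulrC mulrAC -mulrA ler_pdivrMl; last lra.
  by rewrite ?mul1r; nra.
have [h3 h4] : a <= e / 4 /\ - (e / 4) <= a by split; nra.
have := sqnorm_ge0 (u m - x).
rewrite E ler_norml; lra.
Unshelve. all: by end_near. Qed.

Lemma cvg_sqnorm_shift (u : nat -> H) x y :
  sqnorm (u m - x) @[m --> \oo] --> (0 : R) ->
  sqnorm (u m + y) @[m --> \oo] --> sqnorm (x + y).
Proof.
move=> ux; apply: cvg_sqnorm; apply: cvg_trans ux.
by apply: near_eq_cvg; near=> m; rewrite opprD addrACA subrr addr0.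
Unshelve. all: by end_near. Qed.

(** By polarization both parts are combinations of squared norms of translates of [u m], and these
    converge. *)
Lemma cvg_ipl (u : nat -> H) x y : sqnorm (u m - x) @[m --> \oo] --> (0 : R) ->
  complex.Re (ip (u m) y) @[m --> \oo] --> complex.Re (ip x y) /\
  complex.Im (ip (u m) y) @[m --> \oo] --> complex.Im (ip x y).
Proof.
move=> ux; split.
- rewrite (polarization x y) /=.
  under eq_cvg do rewrite (polarization _ y) /=.
  by apply: cvgMl; apply: cvgB; exact: cvg_sqnorm_shift.
- rewrite (polarization x y) /=.
  under eq_cvg do rewrite (polarization _ y) /=.
  by apply: cvgMl; apply: cvgB; exact: cvg_sqnorm_shift.
Qed.

Lemma hlim_unique (u : nat -> H) x y :
  sqnorm (u m - x) @[m --> \oo] --> (0 : R) ->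
  sqnorm (u m - y) @[m --> \oo] --> (0 : R) -> x = y.
Proof.
move=> ux uy; apply/eqP; rewrite -subr_eq0; apply/eqP; apply: sqnorm_eq0.
have := cvg_sqnorm_shift (y := - y) ux.
by move/(cvg_unique _ uy) => /(_ (@Rhausdorff R)) /esym.
Qed.

Lemma cvg_hnorm (u : nat -> H) x :
  sqnorm (u m - x) @[m --> \oo] --> (0 : R) <->
  hnorm ip (u m - x) @[m --> \oo] --> (0 : R).
Proof.
split=> h.
  rewrite -[X in _ --> X](@sqrtr0 R).
  by apply: (@continuous_cvg _ _ _ _ _ _ Num.sqrt); [exact: sqrt_continuous|].
have -> : (fun m => sqnorm (u m - x)) = (fun m => hnorm ip (u m - x) * hnorm ip (u m - x)).
  by apply/funext => m; rewrite -expr2 sqr_hnorm.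
suff : hnorm ip (u m - x) * hnorm ip (u m - x) @[m --> \oo] --> (0 * 0 : R) by rewrite mulr0.
exact: cvgM.
Qed.

Lemma closed_subspace_lim V (u : nat -> H) x : closed_subspace ip V ->
  (forall m, V (u m)) -> sqnorm (u m - x) @[m --> \oo] --> (0 : R) -> V x.
Proof. by move=> [_ _ cl] Vu /cvg_hnorm; exact: cl. Qed.

Lemma closed_subspaceZ V (a : R[i]) x : closed_subspace ip V -> V x -> V (a *: x).
Proof. by case=> V0 Vl _ Vx; rewrite -[_ *: _]addr0; exact: Vl. Qed.

Lemma closed_subspaceD V x y : closed_subspace ip V -> V x -> V y -> V (x + y).
Proof. by case=> V0 Vl _ Vx Vy; rewrite -[x]scale1r; exact: Vl. Qed.

End InnerProductTheory.

(** * Orthogonal projections onto closed subspaces *)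

Section Projection.
Context {R : realType} {H : lmodType R[i]} (ip : H -> H -> R[i]).
Hypotheses (ipP : inner_product ip) (Hcomplete : hcomplete ip).
Implicit Types (x y : H) (V : set H).
Local Notation sqnorm := (sqnorm ip).

(* A minimizing sequence for the distance to V is Cauchy by the parallelogram
   law. *)
Lemma closest_point V x : closed_subspace ip V ->
  exists2 p, V p & forall v, V v -> sqnorm (x - p) <= sqnorm (x - v).
Proof.
move=> cV; case: (cV) => V0 Vl _.
pose D := [set sqnorm (x - v) | v in V].
have Dlb : has_lbound D by exists 0 => _ [v _ <-]; exact: sqnorm_ge0.
have D0 : D !=set0 by exists (sqnorm (x - 0)), 0.
have Dinf : has_inf D by split.
pose d := inf D.
have dle v : V v -> d <= sqnorm (x - v) by move=> Vv; apply: ge_inf => //; exists v.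
have /choice[u uP] (m : nat) : exists v, V v /\ sqnorm (x - v) < d + m.+1%:R^-1.
  have m0 : 0 < (m.+1%:R^-1 : R) by rewrite invr_gt0 ltr0n.
  by have [_ [v Vv <-] h] := inf_adherent m0 Dinf; exists v.
have uC (m k : nat) : sqnorm (u m - u k) <= 2 * m.+1%:R^-1 + 2 * k.+1%:R^-1.
  have [Vm hm] := uP m; have [Vk hk] := uP k.
  have := parallelogram ipP (x - u m) (x - u k).
  have -> : x - u m - (x - u k) = - (u m - u k).
    by rewrite opprD addrACA subrr add0r opprD.
  rewrite sqnormN //.
  (* The midpoint of [u m] and [u k] lies in [V], so its squared distance to [x] is at least [d]. *)
  have -> : x - u m + (x - u k) = (2%:R : R)%:C *: (x - (2^-1 : R)%:C *: (u m + u k)).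
    rewrite scalerBr scalerA -rmorphM /= mulfV ?pnatr_eq0 // scale1r.
    by rewrite rmorph_nat scaler_nat addrACA -opprD.
  rewrite sqnormZ // sqr_normcE.
  have hV : V ((2^-1 : R)%:C *: (u m + u k)).
    by apply: (closed_subspaceZ _ cV); exact: (closed_subspaceD cV).
  have := dle _ hV.
  rewrite CReC CImC expr0n /= addr0 => h1 h2; move: hm hk.
  move: (m.+1%:R^-1) (k.+1%:R^-1) => em ek hm hk; lra.
have [p up] : exists p, sqnorm (u m - p) @[m --> \oo] --> (0 : R).
  apply: Hcomplete => e e0.
  have [N hN] := small_invS (divr_gt0 e0 (ltr0Sn R 3)).
  exists N => m k Nm Nk; apply: le_trans (uC m k) _.
  move: (hN _ Nm) (hN _ Nk); move: (m.+1%:R^-1) (k.+1%:R^-1) => a b; lra.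
have Vp : V p by apply: closed_subspace_lim up => // m; case: (uP m).
exists p => // v Vv; apply: le_trans (dle _ Vv).
have h1 : sqnorm (u m - x) @[m --> \oo] --> sqnorm (p - x) by exact: cvg_sqnorm_shift.
have h2 : d + (m.+1%:R^-1 : R) @[m --> \oo] --> d.
  by rewrite -[X in _ --> X]addr0; apply: cvgD; [exact: cvg_cst|exact: cvg_harmonic].
rewrite sqnormBC // -(cvg_lim (@Rhausdorff R) h1) -(cvg_lim (@Rhausdorff R) h2).
apply: ler_lim; [by apply/cvg_ex; eexists; exact: h1|by apply/cvg_ex; eexists; exact: h2|].
near=> m; rewrite sqnormBC //; apply/ltW; exact: (uP m).2.
Unshelve. all: by end_near. Qed.

Lemma oproj_exists V x : closed_subspace ip V ->
  exists p, V p /\ forall v, V v -> ip (x - p) v = 0.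
Proof.
move=> cV; have [p Vp hp] := closest_point x cV.
exists p; split=> // v Vv.
have [v0|vn0] := eqVneq (sqnorm v) 0; first by rewrite (sqnorm_eq0 ipP v0) ip0r.
have v0 : 0 < sqnorm v by rewrite lt_def vn0 sqnorm_ge0.
set w := ip (x - p) v.
(* Moving [p] by [(t * w) *: v] lowers the squared distance to [x] by [t] times the squared modulus
   of [w]; minimality of [p] forces [w = 0]. *)
pose t : R := (sqnorm v)^-1.
have := hp (p + (t%:C * w) *: v) _.
rewrite opprD addrA (sqnormB ipP (x - p)) ipZr // -/w sqnormZ // sqr_normcE.
set a := sqnorm (x - p).
have hV : V (p + (t%:C * w) *: v).
  by apply: (closed_subspaceD cV) => //; exact: (closed_subspaceZ (t%:C * w) cV).
move=> /(_ hV).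
have tv : t * sqnorm v = 1 by rewrite mulVf.
rewrite !CReImE /= => h.
have h2 : t * (complex.Re w ^+ 2 + complex.Im w ^+ 2) <= 0.
  have : (t * (t * sqnorm v)) * (complex.Re w ^+ 2 + complex.Im w ^+ 2) -
    2 * (t * (complex.Re w ^+ 2 + complex.Im w ^+ 2)) >= 0.
    lra.
  rewrite tv mulr1; lra.
have t0 : 0 < t by rewrite invr_gt0.
have h3 : complex.Re w ^+ 2 + complex.Im w ^+ 2 <= 0 by rewrite -(pmulr_rle0 _ t0).
by apply: complexP => /=; nra.
Qed.

Lemma oprojP V x : closed_subspace ip V ->
  V (oproj ip V x) /\ forall v, V v -> ip (x - oproj ip V x) v = 0.
Proof. by move=> cV; rewrite /oproj; case: xgetP => [p -> //|h]; have [p /(h p)] := oproj_exists x cV. Qed.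

Lemma oproj_in V x : closed_subspace ip V -> V (oproj ip V x).
Proof. by move=> /(@oprojP _ x)[]. Qed.

Lemma ip_oproj V x v : closed_subspace ip V -> V v -> ip (oproj ip V x) v = ip x v.
Proof.
move=> cV Vv; have [_ /(_ _ Vv) h] := oprojP x cV.
by apply/eqP; rewrite eq_sym -subr_eq0 -ipNl // -ipDl // h.
Qed.

Lemma oproj_unique V x p : closed_subspace ip V -> V p ->
  (forall v, V v -> ip p v = ip x v) -> oproj ip V x = p.
Proof.
move=> cV Vp h.
apply/eqP; rewrite -subr_eq0; apply/eqP; apply: (sqnorm_eq0 ipP).
have Vd : V (oproj ip V x - p).
  apply: (closed_subspaceD cV); first exact: oproj_in.
  by rewrite -scaleN1r; exact: (closed_subspaceZ (-1) cV).
by rewrite /sqnorm ipDl // ipNl // ip_oproj // h // subrr.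
Qed.

Lemma oproj_id V x : closed_subspace ip V -> V x -> oproj ip V x = x.
Proof. by move=> cV Vx; exact: oproj_unique. Qed.

Lemma oproj_linear V (a : R[i]) x y : closed_subspace ip V ->
  oproj ip V (a *: x + y) = a *: oproj ip V x + oproj ip V y.
Proof.
move=> cV; apply: oproj_unique => //.
  case: (cV) => _ Vl _; apply: Vl; exact: oproj_in.
by move=> v Vv; rewrite !ip_linl // !ip_oproj.
Qed.

Lemma sqnorm_oproj_le V x : closed_subspace ip V ->
  sqnorm (oproj ip V x) <= sqnorm x.
Proof.
move=> cV; rewrite -{2}(subrK (oproj ip V x) x) addrC sqnormD //.
have [Vo /(_ _ Vo) h] := oprojP x cV.
by rewrite (ipC ipP (x - _)) h conjc0 mulr0 addr0 lerDl sqnorm_ge0.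
Qed.

End Projection.

(** * Countable sums, translations and tilings of the line *)

#[export] Instance ae_lebesgue_measure_filter {R : realType} :
  Filter (nbhs (almost_everywhere (@lebesgue_measure R))).
Proof. exact: ae_filter_ringOfSetsType. Qed.

Section CountableSums.
Context {R : realType}.
Local Open Scope ereal_scope.

Lemma esum_enum (T : choiceType) (A : set T) : countable A ->
  exists e : nat -> option T, (forall j x, e j = Some x -> A x) /\
   forall a : T -> \bar R, (forall x, A x -> 0 <= a x) ->
     \esum_(x in A) a x = \sum_(0 <= j <oo) oapp a 0 (e j).
Proof.
move=> /countable_injP[f fi].
pose P j x := A x /\ f x = j.
pose e j := if pselect (exists x, P j x) is left h then Some (projT1 (cid h)) else None.
have eA j x : e j = Some x -> A x /\ f x = j.
  by rewrite /e; case: pselect => // h [<-]; case: (projT2 (cid h)).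
have ef x : A x -> e (f x) = Some x.
  move=> Ax; rewrite /e; case: pselect => [h|[]]; last by exists x.
  case: (projT2 (cid h)) => Ay yx; congr Some.
  by apply: fi; rewrite ?inE.
exists e; split; first by move=> j x /eA[].
move=> a a0.
have b0 j : 0 <= oapp a 0 (e j) by case E : (e j) => [x|] //=; have [/a0] := eA _ _ E.
rewrite nneseries_esumT // (eq_esum (b := fun x => oapp a 0 (e (f x)))); last first.
  by move=> x Ax; rewrite ef.
rewrite -(@reindex_esum R _ _ A (f @` A) f (fun j => oapp a 0 (e j))); last first.
  by split => // x Ax; exists x.
rewrite esum_mkcond; apply: eq_esum => j _.
case: ifPn => // /negP; rewrite inE => h.
case E : (e j) => [x|] //=; case: h; have [Ax <-] := eA _ _ E; by exists x.
Qed.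

Lemma countable_int : countable [set: int].
Proof. exact: countableP. Qed.

Context d (T : measurableType d) (mu : {measure set T -> \bar R}).

Lemma emeasurable_fun_esum (I : choiceType) (A : set I) (D : set T)
    (f : I -> T -> \bar R) : countable A -> measurable D ->
  (forall i, A i -> measurable_fun D (f i)) -> (forall i x, A i -> D x -> 0 <= f i x) ->
  measurable_fun D (fun x => \esum_(i in A) f i x).
Proof.
move=> cA mD mf f0; have [e [eA eE]] := esum_enum cA.
apply: (@eq_measurable_fun _ _ _ _ D (fun x => \sum_(0 <= j <oo) oapp (f^~ x) 0 (e j))).
  by move=> x; rewrite inE => Dx; rewrite eE // => i Ai; exact: f0.
apply: ge0_emeasurable_sum => [j x Dx _|j _].
  by case E : (e j) => [i|] //=; apply: f0 => //; exact: eA E.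
case E : (e j) => [i|] /=; last exact: measurable_cst.
by apply: mf; exact: eA E.
Qed.

Lemma ge0_integral_esum (I : choiceType) (A : set I) (D : set T)
    (f : I -> T -> \bar R) : countable A -> measurable D ->
  (forall i, A i -> measurable_fun D (f i)) -> (forall i x, A i -> D x -> 0 <= f i x) ->
  \int[mu]_(x in D) (\esum_(i in A) f i x) = \esum_(i in A) \int[mu]_(x in D) f i x.
Proof.
move=> cA mD mf f0; have [e [eA eE]] := esum_enum cA.
rewrite eE; last by move=> i Ai; apply: integral_ge0 => x Dx; exact: f0.
under eq_integral => x xD.
  rewrite eE; last by move=> i Ai; apply: f0 => //; rewrite inE in xD.
  over.
rewrite integral_nneseries //.
- apply: eq_eseriesr => j _; case E : (e j) => [i|] //=; exact: integral0.
- move=> j; case E : (e j) => [i|] /=; last exact: measurable_cst.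
  by apply: mf; exact: eA E.
- move=> j x Dx; case E : (e j) => [i|] //=; apply: f0 => //; exact: eA E.
Qed.

Lemma ae_countable (I : choiceType) (A : set I) (P : I -> T -> Prop) : countable A ->
  (forall i, A i -> {ae mu, forall x, P i x}) -> {ae mu, forall x, forall i, A i -> P i x}.
Proof.
move=> /countable_injP[f fi] h.
pose Q j x := forall i, A i -> f i = j -> P i x.
have hQ j : {ae mu, forall x, Q j x}.
  have [[i [Ai fij]]|no] := pselect (exists i, A i /\ f i = j).
    have [N [mN N0 hN]] := h i Ai; exists N; split => // x /= nQ; apply: hN => /= Px.
    apply: nQ => i' Ai' fi'j; suff -> : i' = i by [].
    by apply: fi; rewrite ?inE // fij fi'j.
  by exists set0; split => // x /= nQ; case: nQ => i Ai fij; case: no; exists i.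
have : mu.-negligible (\bigcup_j (~` [set x | Q j x])).
  by apply: negligible_bigcup => j; exact: hQ.
move=> [N [mN N0 hN]]; exists N; split => // x /= nP; apply: hN.
move/existsNP : nP => [i /not_implyP[Ai nPi]].
by exists (f i) => //= Qx; apply: nPi; exact: Qx.
Qed.

Lemma ae_all_int (P : int -> T -> Prop) :
  (forall k, {ae mu, forall x, P k x}) -> {ae mu, forall x, forall k, P k x}.
Proof.
move=> h; have [] := @ae_countable _ setT P countable_int (fun i _ => h i).
by move=> N [mN N0 hN]; exists N; split => // x /= nP; apply: hN => /= P'; apply: nP => k; exact: P'.
Qed.

Lemma ae_all_fin (I : finType) (P : I -> T -> Prop) :
  (forall k, {ae mu, forall x, P k x}) -> {ae mu, forall x, forall k, P k x}.
Proof.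
move=> h; have [] := @ae_countable _ setT P (countableP _) (fun i _ => h i).
by move=> N [mN N0 hN]; exists N; split => // x /= nP; apply: hN => /= P'; apply: nP => k; exact: P'.
Qed.

End CountableSums.

Section Translation.
Context {R : realType}.
Local Notation mu := (@lebesgue_measure R).
Local Open Scope ereal_scope.

(** Lebesgue measure is determined by its values on half-open intervals, and a translation preserves
    their length. *)
Lemma lebesgue_measure_shift (a : R) (A : set R) : measurable A ->
  mu [set x | A (x + a)%R] = mu A.
Proof.
move=> mA; have ms : measurable_fun [set: measurableTypeR R] (fun x : measurableTypeR R => (x + a)%R : measurableTypeR R).
  by apply: measurable_funD.
apply/esym/(@lebesgue_measure_unique _ (pushforward mu (fun x : measurableTypeR R => (x + a)%R : measurableTypeR R))) => //.
move=> _ [[b c] _ <-]; rewrite /pushforward.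
rewrite [RHS](_ : _ = mu `](b - a)%R, (c - a)%R]%classic); last first.
  by congr (mu _); apply/seteqP; split => x /=; rewrite !in_itv /= ltrBlDr lerBrDr.
rewrite /= !lebesgue_measure_itv /= !lte_fin ltrD2r.
by case: ifPn => // _; rewrite -!EFinB opprD opprK addrACA addNr addr0.
Qed.

Lemma lebesgue_measure_opp (A : set R) : measurable A ->
  mu [set x | A (- x)%R] = mu A.
Proof.
move=> mA; have ms : measurable_fun [set: measurableTypeR R] (fun x : measurableTypeR R => (- x)%R : measurableTypeR R).
  exact: oppr_measurable.
apply/esym/(@lebesgue_measure_unique _ (pushforward mu (fun x : measurableTypeR R => (- x)%R : measurableTypeR R))) => //.
move=> _ [[b c] _ <-]; rewrite /pushforward.
rewrite [RHS](_ : _ = mu `[(- c)%R, (- b)%R[%classic); last first.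
  by congr (mu _); apply/seteqP; split => x /=; rewrite !in_itv /= ltrNr lerNl andbC.
rewrite /= !lebesgue_measure_itv /= !lte_fin ltrN2.
by case: ifPn => // _; rewrite -!EFinB opprK addrC.
Qed.

Lemma ge0_integral_shift (a : R) (f : R -> \bar R) : measurable_fun [set: R] f ->
  (forall x, 0 <= f x) -> \int[mu]_x f (x + a)%R = \int[mu]_x f x.
Proof.
move=> mf f0.
have ms : measurable_fun [set: measurableTypeR R] (fun x : measurableTypeR R => (x + a)%R : measurableTypeR R).
  by apply: measurable_funD.
have := @ge0_integral_pushforward _ _ (measurableTypeR R) (measurableTypeR R) R _ ms mu setT f measurableT mf.
rewrite preimage_setT => <-; last by move=> y _.
by apply: eq_measure_integral => A mA _; exact: lebesgue_measure_shift.
Qed.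

Lemma ge0_integral_opp (f : R -> \bar R) : measurable_fun [set: R] f ->
  (forall x, 0 <= f x) -> \int[mu]_x f (- x)%R = \int[mu]_x f x.
Proof.
move=> mf f0.
have ms : measurable_fun [set: measurableTypeR R] (fun x : measurableTypeR R => (- x)%R : measurableTypeR R).
  exact: oppr_measurable.
have := @ge0_integral_pushforward _ _ (measurableTypeR R) (measurableTypeR R) R _ ms mu setT f measurableT mf.
rewrite preimage_setT => <-; last by move=> y _.
by apply: eq_measure_integral => A mA _; exact: lebesgue_measure_opp.
Qed.

Lemma ae_shift (a : R) (P : R -> Prop) :
  {ae mu, forall x, P x} -> {ae mu, forall x, P (x + a)%R}.
Proof.
move=> [N [mN N0 hN]]; exists [set x | N (x + a)%R]; split.
- rewrite -[X in measurable X]setTI.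
  have ms : measurable_fun [set: measurableTypeR R] (fun x : measurableTypeR R => (x + a)%R : measurableTypeR R).
    by apply: measurable_funD.
  exact: ms.
- by rewrite lebesgue_measure_shift.
- by move=> x /= nP; apply: hN.
Qed.

Lemma ae_opp (P : R -> Prop) :
  {ae mu, forall x, P x} -> {ae mu, forall x, P (- x)%R}.
Proof.
move=> [N [mN N0 hN]]; exists [set x | N (- x)%R]; split.
- rewrite -[X in measurable X]setTI.
  exact: oppr_measurable.
- by rewrite lebesgue_measure_opp.
- by move=> x /= nP; apply: hN.
Qed.

Section Tiling.
Variables (a p : R).
Hypothesis p0 : (0 < p)%R.
Local Notation cell := [set` `[a, a + p[%R].

Definition cell_index (x : R) : int := Num.floor ((x - a) / p).

Lemma cell_indexP (x : R) : cell (x - p * (cell_index x)%:~R)%R.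
Proof.
have := floor_le ((x - a) / p); have := floorD1_gt ((x - a) / p).
rewrite -/(cell_index x) ler_pdivlMr // ltr_pdivrMr // intrD /= in_itv /=.
move: (_%:~R) => k; lra.
Qed.

Lemma cell_indexE (x : R) (k : int) : cell x -> cell_index (x + p * k%:~R)%R = k.
Proof.
rewrite /= in_itv /= => /andP[ax xp]; apply: floor_def.
rewrite ler_pdivlMr // ltr_pdivrMr // intrD.
move: (k%:~R) => k'; apply/andP; split; lra.
Qed.

Lemma ae_tile (P : R -> Prop) :
  (forall k : int, {ae mu, forall x, cell x -> P (x + p * k%:~R)%R}) ->
  {ae mu, forall x, P x}.
Proof.
move=> h.
have : {ae mu, forall x, forall k : int, cell (x - p * k%:~R)%R -> P x}.
  apply: ae_all_int => k; have := ae_shift (- (p * k%:~R))%R (h k).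
  by apply: filterS => x hx /hx; rewrite subrK.
by apply: filterS => x hx; exact: hx (cell_indexP x).
Qed.

Lemma ge0_integral_tile (f : R -> \bar R) : measurable_fun [set: R] f ->
  (forall x, 0 <= f x) ->
  \int[mu]_x f x = \int[mu]_(x in cell) \esum_(k in [set: int]) f (x + p * k%:~R)%R.
Proof.
move=> mf f0.
have mfs (k : int) : measurable_fun [set: R] (fun x => f (x + p * k%:~R)%R).
  by apply: measurableT_comp => //; exact: measurable_funD.
rewrite (ge0_integral_esum _ countable_int) //; last first.
- by move=> k _; apply: measurable_funS (mfs k).
(* [g k] is [f] cut down to the [k]-th translate of the cell. Each point lies in exactly one
   translate, the one numbered [cell_index x], so the [g k] add up to [f]. *)
pose g k (x : R) := f x * (\1_cell (x - p * k%:~R)%R)%:E.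
have mg k : measurable_fun [set: R] (g k).
  apply: emeasurable_funM => //; apply/measurable_EFinP.
  by apply: measurableT_comp => //; exact: measurable_funB.
have g0 k x : 0 <= g k x by rewrite mule_ge0 // lee_fin.
transitivity (\int[mu]_x \esum_(k in [set: int]) g k x).
  apply: eq_integral => x _.
  rewrite (esumID [set cell_index x]); last by move=> k _; exact: g0.
  rewrite setTI esum_set1 // esum1 ?adde0.
    by rewrite /g indicE mem_set ?mule1 //; exact: cell_indexP.
  move=> k [_ /= kx]; rewrite /g indicE memNset ?mule0 // => /(cell_indexE k).
  by rewrite subrK => E; apply: kx.
transitivity (\esum_(k in [set: int]) \int[mu]_x g k x).
  by apply: (ge0_integral_esum _ countable_int) => // k _; exact: mg.
apply: eq_esum => k _.
rewrite -(ge0_integral_shift (p * k%:~R)) // [RHS]integral_mkcond.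
apply: eq_integral => x _; rewrite /g addrK patchE indicE.
by case: ifPn => _; rewrite ?mule1 ?mule0.
Qed.

End Tiling.

End Translation.

(** * Square summable sequences *)

Section FiniteProducts.
Context {R : realType} {H : lmodType R[i]} (ip : H -> H -> R[i]).
Hypothesis ipP : inner_product ip.
Variable n : nat.

(** Both [ipL2n] and [ipell2n] are instances, for [ipL2] and [ipell2]. *)
Definition ip_fin (f g : {ffun 'I_n -> H}) : R[i] := \sum_(i < n) ip (f i) (g i).

Lemma CRe_sum (I : Type) (s : seq I) (P : pred I) (F : I -> R[i]) :
  complex.Re (\sum_(i <- s | P i) F i) = \sum_(i <- s | P i) complex.Re (F i).
Proof. by elim/big_rec2: _ => // i x y _ <-; rewrite CReD. Qed.

Lemma sqnorm_ip_fin f : sqnorm ip_fin f = \sum_(i < n) sqnorm ip (f i).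
Proof. exact: CRe_sum. Qed.

Lemma ip_fin_inner : inner_product ip_fin.
Proof.
split.
- move=> a x y w; rewrite /ip_fin mulr_sumr -big_split; apply: eq_bigr => i _.
  by rewrite !ffunE (ip_linl ipP).
- move=> x y; rewrite /ip_fin.
  transitivity (\sum_(i < n) (ip (x i) (y i))^*); first by apply: eq_bigr => i _; rewrite (ipC ipP).
  by rewrite -rmorph_sum.
- move=> x; rewrite -[complex.Re _]/(sqnorm ip_fin x) sqnorm_ip_fin; apply: sumr_ge0 => i _.
  exact: sqnorm_ge0.
- move=> x; rewrite -[complex.Re _]/(sqnorm ip_fin x) sqnorm_ip_fin => /eqP.
  rewrite psumr_eq0; last by move=> i _; exact: sqnorm_ge0.
  move=> /allP h; apply/ffunP => i; rewrite ffunE; apply: (sqnorm_eq0 ipP).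
  by apply/eqP; apply: h; rewrite mem_index_enum.
Qed.

Lemma sqnorm_coord_le (f : {ffun 'I_n -> H}) i : sqnorm ip (f i) <= sqnorm ip_fin f.
Proof.
rewrite sqnorm_ip_fin (bigD1 i) //= lerDl; apply: sumr_ge0 => k _.
exact: sqnorm_ge0.
Qed.

Lemma ip_fin_complete : hcomplete ip -> hcomplete ip_fin.
Proof.
move=> hc u uC.
have /choice[x xP] (i : 'I_n) : exists x, sqnorm ip (u m i - x) @[m --> \oo] --> (0 : R).
  apply: hc => e e0; have [N hN] := uC e e0; exists N => m k Nm Nk.
  by apply: le_trans (hN m k Nm Nk); have := sqnorm_coord_le (u m - u k) i; rewrite !ffunE.
exists [ffun i => x i].
have -> : (fun m => sqnorm ip_fin (u m - [ffun i => x i])) =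
    (fun m => \sum_(i < n) sqnorm ip (u m i - x i)).
  by apply/funext => m; rewrite sqnorm_ip_fin; apply: eq_bigr => i _; rewrite !ffunE.
rewrite [X in _ --> X](_ : _ = \sum_(i < n) 0); last by rewrite big1.
by apply: cvg_big => [|i _]; [exact: add_continuous|exact: xP].
Qed.

End FiniteProducts.

(** * Unordered sums of absolutely summable families *)

Section AbsoluteSums.
Context {R : realType} {I : choiceType} (A : set I).
Implicit Types (p q f g : I -> R).

(** One inequality suffices: for positive [c], applied to [c^-1] it yields the other. *)
Lemma esum_mulE (c : R) (a : I -> \bar R) : 0 <= c -> (forall i, 0 <= a i)%E ->
  (\esum_(i in A) (c%:E * a i) = c%:E * \esum_(i in A) a i)%E.
Proof.
have le (d : R) (b : I -> \bar R) : 0 <= d -> (forall i, 0 <= b i)%E ->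
    (\esum_(i in A) (d%:E * b i) <= d%:E * \esum_(i in A) b i)%E.
  move=> d0 b0; apply: ge_ereal_sup => _ [F [finF FA] <-].
  rewrite -ge0_mule_fsumr //; apply: lee_wpmul2l; first by rewrite lee_fin.
  by apply: esum_ge; exists F.
move=> c0 a0; apply/eqP; rewrite eq_le le //=.
have [->|cn0] := eqVneq c 0.
  by rewrite mul0e; apply: esum_ge0 => i _; rewrite mul0e.
have cp : 0 < c by rewrite lt_neqAle eq_sym cn0.
have ci : 0 <= c^-1 by rewrite invr_ge0.
have h : (\esum_(i in A) (c^-1%:E * (c%:E * a i)) <= c^-1%:E * \esum_(i in A) (c%:E * a i))%E.
  by apply: le => // i; rewrite mule_ge0.
apply: (@le_trans _ _ (c%:E * (c^-1%:E * \esum_(i in A) (c%:E * a i)))%E).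
  apply: lee_wpmul2l => //; apply: le_trans h.
  by apply: le_esum => i _; rewrite muleA -EFinM mulVf // mul1e.
by rewrite muleA -EFinM mulfV // mul1e.
Qed.

Definition abs_summable f : Prop := (\esum_(i in A) `|f i|%:E < +oo)%E.

(* rsum is the case A = setT. *)
Definition abs_sum f : R :=
  fine (\esum_(i in A) (f^\+ i)%:E) - fine (\esum_(i in A) (f^\- i)%:E).

Lemma le_esum_lty (a b : I -> \bar R) : (forall i, a i <= b i)%E ->
  (\esum_(i in A) b i < +oo -> \esum_(i in A) a i < +oo)%E.
Proof. by move=> ab; apply: le_lt_trans; apply: le_esum => i _; exact: ab. Qed.

Lemma esum_fin_numE p : (forall i, 0 <= p i) -> (\esum_(i in A) (p i)%:E < +oo)%E ->
  (\esum_(i in A) (p i)%:E \is a fin_num)%E.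
Proof. by move=> p0 pf; rewrite ge0_fin_numE // esum_ge0 // => i _; rewrite lee_fin. Qed.

Lemma esum_EFinD p q : (forall i, 0 <= p i) -> (forall i, 0 <= q i) ->
  (\esum_(i in A) (p i + q i)%:E = \esum_(i in A) (p i)%:E + \esum_(i in A) (q i)%:E)%E.
Proof.
move=> p0 q0; rewrite -esumD; first exact: eq_esum.
- by move=> i _; rewrite lee_fin.
- by move=> i _; rewrite lee_fin.
Qed.

Lemma fine_esumD p q : (forall i, 0 <= p i) -> (forall i, 0 <= q i) ->
  (\esum_(i in A) (p i)%:E < +oo)%E -> (\esum_(i in A) (q i)%:E < +oo)%E ->
  fine (\esum_(i in A) (p i + q i)%:E) =
  fine (\esum_(i in A) (p i)%:E) + fine (\esum_(i in A) (q i)%:E).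
Proof. by move=> p0 q0 pf qf; rewrite esum_EFinD // fineD // esum_fin_numE. Qed.

Lemma esumD_lty p q : (forall i, 0 <= p i) -> (forall i, 0 <= q i) ->
  (\esum_(i in A) (p i)%:E < +oo)%E -> (\esum_(i in A) (q i)%:E < +oo)%E ->
  (\esum_(i in A) (p i + q i)%:E < +oo)%E.
Proof. by move=> p0 q0 pf qf; rewrite esum_EFinD //; exact: lte_add_pinfty. Qed.

Lemma esum_EFinZ (c : R) p : 0 <= c -> (forall i, 0 <= p i) ->
  (\esum_(i in A) (c * p i)%:E = c%:E * \esum_(i in A) (p i)%:E)%E.
Proof.
by move=> c0 p0; rewrite -esum_mulE // => i; rewrite lee_fin.
Qed.

Lemma esumZ_lty (c : R) p : 0 <= c -> (forall i, 0 <= p i) ->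
  (\esum_(i in A) (p i)%:E < +oo)%E -> (\esum_(i in A) (c * p i)%:E < +oo)%E.
Proof. by move=> c0 p0 pf; rewrite esum_EFinZ //; apply: lte_mul_pinfty; rewrite ?lee_fin. Qed.

Lemma fine_esumZ (c : R) p : 0 <= c -> (forall i, 0 <= p i) ->
  (\esum_(i in A) (p i)%:E < +oo)%E ->
  fine (\esum_(i in A) (c * p i)%:E) = c * fine (\esum_(i in A) (p i)%:E).
Proof. by move=> c0 p0 pf; rewrite esum_EFinZ // fineM // esum_fin_numE. Qed.

Local Opaque esum.

(** Any splitting of [f] into a difference of nonnegative summable families computes the sum,
    because [f^\+ + q = f^\- + p]. This freedom is what makes [abs_sum] linear. *)
Lemma abs_sum_split f p q : (forall i, 0 <= p i) -> (forall i, 0 <= q i) ->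
  (forall i, f i = p i - q i) ->
  (\esum_(i in A) (p i)%:E < +oo)%E -> (\esum_(i in A) (q i)%:E < +oo)%E ->
  abs_sum f = fine (\esum_(i in A) (p i)%:E) - fine (\esum_(i in A) (q i)%:E).
Proof.
move=> p0 q0 fE pf qf.
have uf : (\esum_(i in A) (f^\+ i)%:E < +oo)%E.
  apply: le_esum_lty pf => i; rewrite lee_fin /funrpos fE ge_max.
  by rewrite gerBl q0 p0.
have vf : (\esum_(i in A) (f^\- i)%:E < +oo)%E.
  apply: le_esum_lty qf => i; rewrite lee_fin /funrneg fE ge_max opprB.
  by rewrite gerBl p0 q0.
have e : fine (\esum_(i in A) (f^\+ i + q i)%:E) = fine (\esum_(i in A) (f^\- i + p i)%:E).
  congr fine; apply: eq_esum => i Ai; congr (_%:E).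
  have : f^\+ i - f^\- i = p i - q i by rewrite -fE -[in RHS](funrposBneg f).
  by move: (f^\+ i) (f^\- i) (p i) (q i) => x y u v; lra.
move: e; rewrite (fine_esumD (funrpos_ge0 f) q0 uf qf) (fine_esumD (funrneg_ge0 f) p0 vf pf).
rewrite /abs_sum; move: (fine _) (fine _) (fine _) (fine _) => x y u v; lra.
Qed.

Lemma abs_summable_pos f : abs_summable f -> (\esum_(i in A) (f^\+ i)%:E < +oo)%E.
Proof.
apply: le_esum_lty => i; rewrite lee_fin /funrpos ge_max normr_ge0 andbT.
exact: ler_norm.
Qed.

Lemma abs_summable_neg f : abs_summable f -> (\esum_(i in A) (f^\- i)%:E < +oo)%E.
Proof.
apply: le_esum_lty => i; rewrite lee_fin /funrneg ge_max normr_ge0 andbT.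
by rewrite -normrN; exact: ler_norm.
Qed.

Lemma abs_summable_le f p : (forall i, `|f i| <= p i) ->
  (\esum_(i in A) (p i)%:E < +oo)%E -> abs_summable f.
Proof. by move=> fp; apply: le_esum_lty => i; rewrite lee_fin fp. Qed.

Lemma abs_summable_lin (c : R) f g : abs_summable f -> abs_summable g ->
  abs_summable (fun i => c * f i + g i).
Proof.
move=> sf sg; apply: (@abs_summable_le _ (fun i => `|c| * `|f i| + `|g i|)).
  by move=> i; rewrite -normrM; exact: ler_normD.
apply: esumD_lty; [by move=> i; rewrite mulr_ge0|by move=> i| |].
- exact: (esumZ_lty (normr_ge0 c) (fun i => normr_ge0 (f i)) sf).
- exact: sg.
Qed.

Lemma abs_summable0 : abs_summable (fun=> 0).
Proof. by rewrite /abs_summable esum1 ?ltry // => i _; rewrite normr0. Qed.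

Lemma eq_abs_sum f g : (forall i, A i -> f i = g i) -> abs_sum f = abs_sum g.
Proof.
move=> fg; rewrite /abs_sum; congr (fine _ - fine _); apply: eq_esum => i Ai.
- by rewrite /funrpos fg.
- by rewrite /funrneg fg.
Qed.

Lemma abs_sumZ (c : R) f : abs_summable f -> abs_sum (fun i => c * f i) = c * abs_sum f.
Proof.
move=> sf; have [fp fn] := (abs_summable_pos sf, abs_summable_neg sf).
have [pp pn] := (funrpos_ge0 f, funrneg_ge0 f).
have fE i : f i = f^\+ i - f^\- i by rewrite -[in LHS](funrposBneg f).
have [c0|c0] := leP 0 c.
- rewrite (@abs_sum_split _ (fun i => c * f^\+ i) (fun i => c * f^\- i)).
  + by rewrite (fine_esumZ c0 pp fp) (fine_esumZ c0 pn fn) /abs_sum mulrBr.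
  + by move=> i; rewrite mulr_ge0.
  + by move=> i; rewrite mulr_ge0.
  + by move=> i; rewrite fE mulrBr.
  + exact: esumZ_lty.
  + exact: esumZ_lty.
- have c1 : 0 <= - c by rewrite oppr_ge0 ltW.
  rewrite (@abs_sum_split _ (fun i => - c * f^\- i) (fun i => - c * f^\+ i)).
  + rewrite (fine_esumZ c1 pp fp) (fine_esumZ c1 pn fn) /abs_sum; move: (fine _) (fine _) => x y; ring.
  + by move=> i; rewrite mulr_ge0.
  + by move=> i; rewrite mulr_ge0.
  + by move=> i; rewrite fE; ring.
  + exact: esumZ_lty.
  + exact: esumZ_lty.
Qed.

Lemma abs_sumD f g : abs_summable f -> abs_summable g ->
  abs_sum (fun i => f i + g i) = abs_sum f + abs_sum g.
Proof.
move=> sf sg; have [fp fn] := (abs_summable_pos sf, abs_summable_neg sf).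
have [gp gn] := (abs_summable_pos sg, abs_summable_neg sg).
have [pp pn] := (funrpos_ge0 f, funrneg_ge0 f).
have [qp qn] := (funrpos_ge0 g, funrneg_ge0 g).
have E (h : I -> R) i : h i = h^\+ i - h^\- i by rewrite -[in LHS](funrposBneg h).
rewrite (@abs_sum_split _ (fun i => f^\+ i + g^\+ i) (fun i => f^\- i + g^\- i)).
- rewrite (fine_esumD pp qp fp gp) (fine_esumD pn qn fn gn) /abs_sum; move: (fine _) (fine _) (fine _) (fine _) => x y u v; ring.
- by move=> i; rewrite addr_ge0.
- by move=> i; rewrite addr_ge0.
- by move=> i; rewrite (E f) (E g); ring.
- exact: esumD_lty.
- exact: esumD_lty.
Qed.

Lemma abs_sum_lin (c : R) f g : abs_summable f -> abs_summable g ->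
  abs_sum (fun i => c * f i + g i) = c * abs_sum f + abs_sum g.
Proof.
move=> sf sg; rewrite abs_sumD // ?abs_sumZ //.
have := abs_summable_lin c sf abs_summable0.
by apply: le_esum_lty => i; rewrite addr0.
Qed.

Lemma ge0_abs_sum p : (forall i, 0 <= p i) -> (\esum_(i in A) (p i)%:E < +oo)%E ->
  ((abs_sum p)%:E = \esum_(i in A) (p i)%:E)%E.
Proof.
move=> p0 pf; have z0 : (\esum_(i in A) ((0 : R)%:E) = 0)%E by rewrite esum1.
rewrite (@abs_sum_split _ p (fun=> 0)) //.
- by rewrite z0 subr0 fineK // esum_fin_numE.
- by move=> i; rewrite subr0.
- by rewrite z0 ltry.
Qed.

End AbsoluteSums.

Section ComplexSums.
Context {R : realType} {I : choiceType} (A : set I).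
Implicit Types (f g h : I -> R[i]).

Definition csummable f : Prop :=
  abs_summable A (fun i => complex.Re (f i)) /\ abs_summable A (fun i => complex.Im (f i)).

Definition csum f : R[i] := abs_sum A (fun i => complex.Re (f i)) +i*
  abs_sum A (fun i => complex.Im (f i)).

Definition sqsummable f : Prop := (\esum_(i in A) (normc (f i) ^+ 2)%:E < +oo)%E.

Lemma eq_csum f g : (forall i, A i -> f i = g i) -> csum f = csum g.
Proof. by move=> fg; rewrite /csum; congr (_ +i* _); apply: eq_abs_sum => i Ai; rewrite fg. Qed.

Lemma csum_lin (c : R[i]) f g : csummable f -> csummable g ->
  csum (fun i => c * f i + g i) = c * csum f + csum g.
Proof.
move=> [fr fi] [gr gi]; apply: complexP => /=.
- rewrite CReD CReM /= -addrA.
  rewrite -(mulNr (complex.Im c)) -!abs_sum_lin //; last exact: abs_summable_lin.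
  by apply: eq_abs_sum => i _; rewrite CReD CReM; ring.
- rewrite CImD CImM /= -addrA -!abs_sum_lin //; last exact: abs_summable_lin.
  by apply: eq_abs_sum => i _; rewrite CImD CImM; ring.
Qed.

Lemma csumJ f : csummable f -> csum (fun i => (f i)^*) = (csum f)^*.
Proof.
move=> [fr fi]; apply: complexP => /=.
- by apply: eq_abs_sum => i _; rewrite CReJ.
- rewrite -(mulN1r (abs_sum _ _)) -abs_sumZ //.
  by apply: eq_abs_sum => i _; rewrite CImJ mulN1r.
Qed.

Lemma csummable_mul_conj f g : sqsummable f -> sqsummable g ->
  csummable (fun i => f i * (g i)^*).
Proof.
move=> sf sg.
have le i : `|complex.Re (f i * (g i)^*)| <= normc (f i) ^+ 2 + normc (g i) ^+ 2 /\
    `|complex.Im (f i * (g i)^*)| <= normc (f i) ^+ 2 + normc (g i) ^+ 2.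
  rewrite !sqr_normcE !CReImE.
  move: (complex.Re (f i)) (complex.Im (f i)) (complex.Re (g i)) (complex.Im (g i)).
  move=> a b c d; rewrite !ler_norml; split; apply/andP; split.
  - have := sqr_ge0 (a + c); have := sqr_ge0 (b + d); nra.
  - have := sqr_ge0 (a - c); have := sqr_ge0 (b - d); nra.
  - have := sqr_ge0 (a - d); have := sqr_ge0 (b + c); nra.
  - have := sqr_ge0 (a + d); have := sqr_ge0 (b - c); nra.
have fin : (\esum_(i in A) (normc (f i) ^+ 2 + normc (g i) ^+ 2)%:E < +oo)%E.
  by apply: esumD_lty => // i; exact: sqr_ge0.
by split; apply: abs_summable_le fin => i; have [] := le i.
Qed.

Lemma csum_mul_conj f : sqsummable f ->
  ((complex.Re (csum (fun i => f i * (f i)^*)))%:E = \esum_(i in A) (normc (f i) ^+ 2)%:E)%E.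
Proof.
move=> sf; have e i : complex.Re (f i * (f i)^*) = normc (f i) ^+ 2.
  by rewrite sqr_normcE !CReImE; ring.
rewrite /= (@eq_abs_sum _ _ _ _ (fun i => normc (f i) ^+ 2)) => [|i _]; last exact: e.
by rewrite ge0_abs_sum // => i; exact: sqr_ge0.
Qed.

Lemma sqsummable_lin (c : R[i]) f g : sqsummable f -> sqsummable g ->
  sqsummable (fun i => c * f i + g i).
Proof.
move=> sf sg; apply: (@le_esum_lty _ _ _ _
  (fun i => (2 * normc c ^+ 2 * normc (f i) ^+ 2 + 2 * normc (g i) ^+ 2)%:E)).
  by move=> i; rewrite lee_fin; exact: sqr_normc_lin.
have s0 (h : I -> R[i]) i : 0 <= normc (h i) ^+ 2 by exact: sqr_ge0.
have c2 : 0 <= 2 * normc c ^+ 2 by rewrite mulr_ge0 // sqr_ge0.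
apply: esumD_lty; [by move=> i; rewrite mulr_ge0|by move=> i; rewrite mulr_ge0 ?s0| |].
- exact: (esumZ_lty c2 (s0 f) sf).
- exact: (esumZ_lty _ (s0 g) sg).
Qed.

End ComplexSums.

(** * The Hilbert space l^2(Z) *)

Section SquareSummableSequences.
Context {R : realType}.
Implicit Types a b c : ell2 R.

Lemma ell2P a : sqsummable setT a.
Proof. by case: a => a /= /asboolP. Qed.

Lemma ipell2E a b : ipell2 a b = csum setT (fun k => a k * (b k)^*).
Proof. by []. Qed.

Lemma ipell2_csummable a b : csummable setT (fun k => a k * (b k)^*).
Proof. by apply: csummable_mul_conj; exact: ell2P. Qed.

Lemma ell2_linE (s : R[i]) a b k : (s *: a + b) k = s * a k + b k.
Proof. by []. Qed.

Lemma ell2_BE a b k : (a - b) k = a k - b k.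
Proof. by []. Qed.

Lemma ell2_ext a b : (forall k, a k = b k) -> a = b.
Proof. by move=> ab; apply: val_inj; apply/funext. Qed.

Lemma toell2E (x : int -> R[i]) k : sqsummable setT x -> toell2 x k = x k.
Proof. by move=> sx; rewrite /toell2 -[ell2_val _]/(val _) insubdK //; apply/asboolP. Qed.

Lemma toell2_default (x : int -> R[i]) k : ~ sqsummable setT x -> toell2 x k = 0.
Proof.
by move=> nx; rewrite /toell2 /insubd insubN //; apply/negP => /asboolP.
Qed.

Lemma sqnorm_ell2E a : ((sqnorm ipell2 a)%:E = \esum_(k in [set: int]) (normc (a k) ^+ 2)%:E)%E.
Proof. by rewrite -csum_mul_conj //; exact: ell2P. Qed.

Lemma ipell2_inner : inner_product (@ipell2 R).
Proof.
split.
- move=> s x y z; rewrite !ipell2E -csum_lin; [|exact: ipell2_csummable|exact: ipell2_csummable].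
  by apply: eq_csum => k _; rewrite ell2_linE mulrDl mulrA.
- move=> x y; rewrite !ipell2E -csumJ; last exact: ipell2_csummable.
  by apply: eq_csum => k _; apply: complexP; rewrite !CReImE; ring.
- by move=> x; rewrite -lee_fin (sqnorm_ell2E x) esum_ge0 // => k _; rewrite lee_fin sqr_ge0.
- move=> x x0; apply: ell2_ext => k; apply: sqr_normc_eq0.
  apply/eqP; rewrite eq_le sqr_ge0 andbT -lee_fin.
  apply: (@le_trans _ _ (sqnorm ipell2 x)%:E); last by rewrite [sqnorm _ _]x0.
  rewrite sqnorm_ell2E; apply: esum_ge; exists [set k] => //.
  by rewrite fsbig_set1.
Qed.

Lemma sqr_normc_coord_le a k : normc (a k) ^+ 2 <= sqnorm ipell2 a.
Proof.
rewrite -lee_fin sqnorm_ell2E; apply: esum_ge; exists [set k] => //.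
by rewrite fsbig_set1.
Qed.

(** Each coordinate is Cauchy. Over a finite set of coordinates the Cauchy estimate survives the
    passage to the coordinatewise limit, and the supremum over finite sets turns it into convergence
    in norm. *)
Lemma ell2_complete : hcomplete (@ipell2 R).
Proof.
move=> u uC.
have coord (p : R[i] -> R) : (forall x, p x ^+ 2 <= normc x ^+ 2) ->
    (forall x y, p (x - y) = p x - p y) -> forall k, cvgn (fun m => p (u m k)).
  move=> hp pB k; apply/cauchy_cvgP/cauchyP => e e0.
  have e2 : 0 < (e / 2) ^+ 2 by rewrite exprn_gt0 // divr_gt0.
  have [N hN] := uC _ e2; exists (p (u N k)); exists N => // m /= Nm.
  rewrite /ball /= -pB; apply: (@le_lt_trans _ _ (e / 2)); last by rewrite ltr_pdivrMr //; lra.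
  rewrite -[leRHS]ger0_norm; last by rewrite divr_ge0 // ltW.
  rewrite -ler_sqr ?nnegrE // !real_normK ?num_real //.
  apply: le_trans (hp _) _; apply: le_trans (sqr_normc_coord_le (u N - u m) k) _.
  by apply: hN.
have cr := @coord (@complex.Re R).
have ci := @coord (@complex.Im R).
have {}cr : forall k, cvgn (fun m => complex.Re (u m k)).
  by apply: cr => [x|x y]; rewrite ?sqr_normcE ?lerDl ?sqr_ge0 // !CReImE.
have {}ci : forall k, cvgn (fun m => complex.Im (u m k)).
  by apply: ci => [x|x y]; rewrite ?sqr_normcE ?lerDr ?sqr_ge0 // !CReImE.
pose a k : R[i] := limn (fun m => complex.Re (u m k)) +i* limn (fun m => complex.Im (u m k)).
have cvga v k : normc (v - u m k) ^+ 2 @[m --> \oo] --> normc (v - a k) ^+ 2.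
  pose q (x y : R) := (complex.Re v - x) * (complex.Re v - x) + (complex.Im v - y) * (complex.Im v - y).
  have E w : normc (v - w) ^+ 2 = q (complex.Re w) (complex.Im w).
    by rewrite sqr_normcE !CReImE /q !expr2.
  rewrite (_ : (fun m => normc (v - u m k) ^+ 2) =
      fun m => q (complex.Re (u m k)) (complex.Im (u m k))); last by apply/funext => m; rewrite E.
  have cD (s l : R) (w : nat -> R) : w m @[m --> \oo] --> l ->
      (s - w m) * (s - w m) @[m --> \oo] --> (s - l) * (s - l).
    by move=> wl; apply: cvgM; (apply: cvgB; [exact: cvg_cst|exact: wl]).
  by rewrite E; exact: (cvgD (cD _ _ _ (cr k)) (cD _ _ _ (ci k))).
have bound (e : R) : 0 < e -> exists N, forall m, (N <= m)%N ->
    (\esum_(k in [set: int]) (normc (u m k - a k) ^+ 2)%:E <= e%:E)%E.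
  move=> e0; have [N hN] := uC e e0; exists N => m Nm.
  apply: ge_ereal_sup => _ [F [finF _] <-].
  rewrite (fsbig_finite _ _ finF) sumEFin lee_fin.
  have cF : \sum_(k <- finmap.enum_fset (fset_set F)) normc (u m k - u m' k) ^+ 2 @[m' --> \oo] -->
      \sum_(k <- finmap.enum_fset (fset_set F)) normc (u m k - a k) ^+ 2.
    by apply: cvg_big => [|k _]; [exact: add_continuous|exact: cvga].
  apply: (cvgr_to_le cF); exists N => // m' Nm' /=.
  apply: le_trans (hN m m' Nm Nm'); rewrite -lee_fin sqnorm_ell2E.
  by apply: esum_ge; exists F => //; rewrite (fsbig_finite _ _ finF) sumEFin.
have sd m N : (forall m, (N <= m)%N -> (\esum_(k in [set: int]) (normc (u m k - a k) ^+ 2)%:E <= 1%:E)%E) ->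
    (N <= m)%N -> sqsummable setT (fun k => u m k - a k).
  by move=> h Nm; apply: le_lt_trans (h _ Nm) (ltry _).
have [N1 hN1] := bound 1 ltr01.
have sa : sqsummable setT a.
  have := sqsummable_lin (-1) (sd N1 N1 hN1 (leqnn _)) (ell2P (u N1)).
  by apply: le_esum_lty => k; rewrite mulN1r opprB subrK.
exists (toell2 a); apply/cvgrPdist_le => e e0.
have [N hN] := bound e e0; exists N => // m /= Nm.
rewrite sub0r normrN ger0_norm; last exact: (sqnorm_ge0 ipell2_inner).
rewrite -lee_fin sqnorm_ell2E; apply: le_trans (hN m Nm).
by apply: le_esum => k _; rewrite ell2_BE toell2E.
Qed.

End SquareSummableSequences.

(** * The Hilbert space L^2(R) *)

Section RealL2Complete.
Context d (T : measurableType d) (R : realType) (mu : {measure set T -> \bar R}).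
Local Open Scope ereal_scope.

(** The sum of the series is integrable, hence finite almost everywhere, and it bounds every
    term. *)
Lemma ae_bounded_terms (a : nat -> T -> R) : (forall j, measurable_fun setT (a j)) ->
  (forall j x, (0 <= a j x)%R) -> \sum_(0 <= j <oo) \int[mu]_x (a j x)%:E < +oo ->
  {ae mu, forall x, exists S : R, forall j, (a j x <= S)%R}.
Proof.
move=> ma a0 foo.
have a0E j x : 0 <= (a j x)%:E by rewrite lee_fin.
have mE j : measurable_fun setT (fun x => (a j x)%:E) by exact/measurable_EFinP.
have i : mu.-integrable setT (fun x => \sum_(0 <= j <oo) (a j x)%:E).
  apply/integrableP; split; first exact: ge0_emeasurable_sum.
  under eq_integral => x _ do rewrite gee0_abs ?nneseries_ge0 //.
  by rewrite integral_nneseries.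
have [N [mN N0 hN]] := integrable_ae measurableT i.
exists N; split => // x /= nS; apply: hN => /= /(_ I) fx; apply: nS.
exists (fine (\sum_(0 <= j <oo) (a j x)%:E)) => j.
rewrite -lee_fin fineK //.
apply: (@le_trans _ _ (\sum_(0 <= i < j.+1) (a i x)%:E)).
  by rewrite big_nat_recr //= leeDr // sume_ge0.
by apply: nneseries_lim_ge => k _ _; exact: a0E.
Qed.

(** The increments are at most [(S + 1) / 2 ^ j], so the telescoping series converges. Using [S + 1]
    avoids a square root, as S is at most (S + 1)^2. *)
Lemma sqr_le_cvg (v : nat -> R) (S : R) :
  (forall j, (4 ^+ j * (v j.+1 - v j) ^+ 2 <= S)%R) -> cvgn v.
Proof.
move=> h.
have S0 : (0 <= S)%R by have := h 0%N; apply: le_trans; rewrite expr0 mul1r sqr_ge0.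
have dle j : (`|v j.+1 - v j| <= (S + 1) * 2^-1 ^+ j)%R.
  have p0 : (0 < 2 ^+ j :> R)%R by rewrite exprn_gt0.
  rewrite exprVn ler_pdivlMr // -(@ler_pXn2r _ 2) ?nnegrE ?mulr_ge0 ?addr_ge0 ?(ltW p0) //.
  rewrite exprMn -exprM mulnC exprM real_normK ?num_real // mulrC.
  rewrite (_ : (2 ^+ 2 = 4 :> R)%R); last by rewrite expr2 -natrM.
  by apply: le_trans (h j) _; nra.
have -> : v = (fun n => v 0%N + series (telescope v) n)%R.
  by apply/funext => n; rewrite -eq_sum_telescope.
apply: is_cvgD; first exact: is_cvg_cst.
apply: normed_cvg; apply: (@series_le_cvg _ _ (geometric (S + 1)%R (2^-1)%R)).
- by move=> n; exact: normr_ge0.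
- by move=> n; rewrite /geometric /= mulr_ge0 ?addr_ge0 ?exprn_ge0.
- by move=> n; exact: dle.
- by apply: is_cvg_geometric_series; rewrite ger0_norm // invf_lt1 // ltr1n.
Qed.

Lemma limn_einf_le (u : (\bar R)^nat) e : (forall n, u n <= e) -> limn_einf u <= e.
Proof.
move=> ue; rewrite limn_einf_lim; apply: lime_le; first exact: is_cvg_einfs.
apply: nearW => n; apply: le_trans (ue n); apply: ereal_inf_lbound.
by exists n => /=.
Qed.

Lemma real_L2_complete (u : nat -> T -> R) : (forall m, measurable_fun setT (u m)) ->
  (forall e : R, (0 < e)%R -> exists N, forall m k, (N <= m)%N -> (N <= k)%N ->
    \int[mu]_x ((u m x - u k x) ^+ 2)%:E <= e%:E) ->
  exists2 g : T -> R, measurable_fun setT g &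
    forall e : R, (0 < e)%R -> exists N, forall m, (N <= m)%N ->
      \int[mu]_x ((u m x - g x) ^+ 2)%:E <= e%:E.
Proof.
move=> um uC.
(* The rate 1/8^j leaves a summable 1/2^j after multiplication by the weight 4^j of [sqr_le_cvg]. *)
have /choice[N NP] (j : nat) : exists N, forall m k, (N <= m)%N -> (N <= k)%N ->
    \int[mu]_x ((u m x - u k x) ^+ 2)%:E <= ((8 ^+ j)^-1)%:E.
  by apply: uC; rewrite invr_gt0 exprn_gt0.
(* Cumulative sums put both [n j] and [n j.+1] beyond [N j], and the successors make [n j] exceed
   [j]. *)
pose n j := (\sum_(i < j.+1) (N i).+1)%N.
have nN j : (N j <= n j)%N by rewrite /n big_ord_recr /= (leq_trans (leqnSn _)) // leq_addl.
have nj j : (j < n j)%N.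
  rewrite /n; elim: j => [|j ih]; first by rewrite big_ord_recr big_ord0.
  by rewrite big_ord_recr /= -addn1 leq_add.
have nS j : (N j <= n j.+1)%N.
  by rewrite /n 2!big_ord_recr /= -addnA; apply: leq_trans (leq_addl _ _); rewrite (leq_trans (leqnSn _)) // leq_addr.
pose v j := u (n j).
have mv j : measurable_fun setT (v j) by exact: um.
pose a j x := (4 ^+ j * (v j.+1 x - v j x) ^+ 2)%R.
have ma j : measurable_fun setT (a j).
  by apply: measurable_funM => //; apply: measurable_funX; exact: measurable_funB.
have a0 j x : (0 <= a j x)%R by rewrite mulr_ge0 ?sqr_ge0 ?exprn_ge0.
have [M [mM M0 hM]] : {ae mu, forall x, cvgn (v^~ x)}.
  have h : {ae mu, forall x, exists S : R, forall j, (a j x <= S)%R}.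
    apply: ae_bounded_terms => //; apply: (@le_lt_trans _ _ 2%:E); last exact: ltry.
    apply: lime_le; first by apply: is_cvg_nneseries => j _ _; apply: integral_ge0 => x _; rewrite lee_fin.
    apply: nearW => k; apply: (@le_trans _ _ (\sum_(0 <= j < k) ((2^-1) ^+ j)%:E)).
      apply: lee_sum => j _; rewrite /a.
      under eq_integral do rewrite EFinM.
      rewrite ge0_integralZl //; last 2 first.
      - apply/measurable_EFinP; apply: measurable_funX; exact: measurable_funB.
      - by move=> x _; rewrite lee_fin sqr_ge0.
      apply: (@le_trans _ _ ((4 ^+ j)%:E * ((8 ^+ j)^-1)%:E)).
        by apply: lee_wpmul2l; [rewrite lee_fin exprn_ge0|exact: NP].
      rewrite -EFinM lee_fin -exprVn -exprMn.
      by rewrite (_ : (4 / 8 = 2^-1 :> R)%R) //; lra.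
    rewrite sumEFin lee_fin.
    have -> : (\sum_(0 <= j < k) 2^-1 ^+ j = 2 - 2 * 2^-1 ^+ k :> R)%R.
      elim: k => [|k ih]; first by rewrite big_nil expr0; lra.
      by rewrite big_nat_recr //= ih exprS; lra.
    by rewrite lerBlDr lerDl mulr_ge0 // exprn_ge0.
  by apply: filterS h => x [S hS]; exact: sqr_le_cvg hS.
(* Setting the subsequence to 0 on the null set [M] makes it converge everywhere, so that its limit
   is measurable. *)
pose w j x := (v j x * \1_(~` M) x)%R.
have mw j : measurable_fun setT (w j).
  by apply: measurable_funM => //; apply: measurable_indic; exact: measurableC.
have wE j x : ~ M x -> w j x = v j x.
  by move=> nMx; rewrite /w indicE mem_set // mulr1.
have cw x : cvgn (w^~ x).
  have [Mx|nMx] := pselect (M x).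
    rewrite (_ : w^~ x = cst 0%R); first exact: is_cvg_cst.
    by apply/funext => j; rewrite /w indicE memNset ?mulr0 //=; apply.
  rewrite (_ : w^~ x = v^~ x); last by apply/funext => j; exact: wE.
  by apply: contrapT => nc; apply: nMx; exact: hM.
exists (fun x => limn (w^~ x)).
  by apply: (@measurable_fun_cvg _ _ _ setT w) => // x _; exact: cw.
move=> e e0; have [N0 hN0] := uC e e0; exists N0 => m N0m.
pose f j x := ((u m x - w (j + N0)%N x) ^+ 2)%:E.
have mf j : measurable_fun setT (f j).
  by apply/measurable_EFinP; apply: measurable_funX; exact: measurable_funB.
have f0 j x : setT x -> 0 <= f j x by move=> _; rewrite lee_fin sqr_ge0.
have -> : \int[mu]_x ((u m x - limn (w^~ x)) ^+ 2)%:E = \int[mu]_x limn_einf (f^~ x).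
  apply: eq_integral => x _.
  suff /cvg_limn_einf_sup[-> _] : f^~ x @ \oo --> ((u m x - limn (w^~ x)) ^+ 2)%:E by [].
  apply: cvg_EFin; first by apply: nearW.
  have h : w (j + N0)%N x @[j --> \oo] --> limn (w^~ x).
    by rewrite (cvg_shiftn N0 (w^~ x)); exact: cw.
  have h2 : (u m x - w (j + N0)%N x)%R @[j --> \oo] --> (u m x - limn (w^~ x))%R.
    by apply: cvgB => //; exact: cvg_cst.
  by apply: (cvgM h2 h2).
(* Fatou's lemma lets the second index of the Cauchy estimate tend to infinity along the
   subsequence; the offset [N0] keeps all its indices in the range of that estimate. *)
apply: le_trans (fatou _ measurableT mf f0) _.
apply: limn_einf_le => j.
rewrite (_ : \int[mu]_x f j x = \int[mu]_x ((u m x - v (j + N0)%N x) ^+ 2)%:E).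
  by apply: hN0 => //; apply: leq_trans (leq_addl j _) (ltnW (nj _)).
apply: ae_eq_integral => //.
  by apply/measurable_EFinP; apply: measurable_funX; exact: measurable_funB.
exists M; split => // x /= nE; apply: contrapT => nMx; apply: nE => _.
by rewrite /f wE.
Qed.

End RealL2Complete.

(** * Complex-valued Borel functions and their integrals *)

Section ComplexIntegral.
Context {R : realType}.
Local Notation mu := (@lebesgue_measure R).
Implicit Types (D : set R) (f g : R -> R[i]).

Definition cmeasurable f := measurable_fun [set: R] (fun x => complex.Re (f x)) /\
  measurable_fun [set: R] (fun x => complex.Im (f x)).

(** For [D = setT] this is [cintegral] up to conversion, and [cintble setT] is [cintegrable]. *)
Definition cint D f : R[i] :=
  Rintegral mu D (fun x => complex.Re (f x)) +i*
  Rintegral mu D (fun x => complex.Im (f x)).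

Definition cintble D f :=
  mu.-integrable D (fun x => (complex.Re (f x))%:E) /\
  mu.-integrable D (fun x => (complex.Im (f x))%:E).

Lemma cmeasurableD f g : cmeasurable f -> cmeasurable g -> cmeasurable (fun x => f x + g x).
Proof.
move=> [fr fi] [gr gi]; split.
- by under eq_fun do rewrite CReD; exact: measurable_funD.
- by under eq_fun do rewrite CImD; exact: measurable_funD.
Qed.

Lemma cmeasurableM f g : cmeasurable f -> cmeasurable g -> cmeasurable (fun x => f x * g x).
Proof.
move=> [fr fi] [gr gi]; split.
- by under eq_fun do rewrite CReM; apply: measurable_funB; exact: measurable_funM.
- by under eq_fun do rewrite CImM; apply: measurable_funD; exact: measurable_funM.
Qed.

Lemma cmeasurable_cst (a : R[i]) : cmeasurable (fun=> a).
Proof. by split; exact: measurable_cst. Qed.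

Lemma cmeasurableN f : cmeasurable f -> cmeasurable (fun x => - f x).
Proof.
move=> mf; under eq_fun do rewrite -mulN1r.
by apply: cmeasurableM => //; exact: cmeasurable_cst.
Qed.

Lemma cmeasurableJ f : cmeasurable f -> cmeasurable (fun x => (f x)^*).
Proof.
move=> [fr fi]; split; first by under eq_fun do rewrite CReJ.
by under eq_fun do rewrite CImJ; exact: measurableT_comp.
Qed.

Lemma cmeasurable_indic D f : measurable D -> cmeasurable f ->
  cmeasurable (fun x => (\1_D x)%:C * f x).
Proof.
move=> mD mf; apply: cmeasurableM => //; split; last exact: measurable_cst.
exact: measurable_indic.
Qed.

Lemma cmeasurable_comp f (h : R -> R) : cmeasurable f -> measurable_fun setT h ->
  cmeasurable (f \o h).
Proof. by move=> [fr fi] mh; split; [apply: (measurableT_comp fr mh)|apply: (measurableT_comp fi mh)]. Qed.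

Lemma cmeasurable_cis (h : R -> R) : measurable_fun setT h ->
  cmeasurable (fun x => cis (h x)).
Proof.
move=> mh; split.
- by apply: measurableT_comp mh; exact: (continuous_measurable_fun (@continuous_cos R)).
- by apply: measurableT_comp mh; exact: (continuous_measurable_fun (@continuous_sin R)).
Qed.

Lemma cmeasurable_sqr_normc f : cmeasurable f ->
  measurable_fun [set: R] (fun x => (normc (f x) ^+ 2)%:E).
Proof. by move=> [fr fi]; exact: measurable_sqr_normc. Qed.

Lemma cintble_dominated D f (h : R -> R) : measurable D -> cmeasurable f ->
  mu.-integrable D (EFin \o h) ->
  (forall x, `|complex.Re (f x)| <= h x /\ `|complex.Im (f x)| <= h x) ->
  cintble D f.
Proof.
move=> mD [fr fi] ih fh; split.
- apply: le_integrable ih => //.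
    by apply/measurable_EFinP; exact: measurable_funS fr.
  by move=> x _; rewrite /= lee_fin; apply: le_trans (fh x).1 (ler_norm _).
- apply: le_integrable ih => //.
    by apply/measurable_EFinP; exact: measurable_funS fi.
  by move=> x _; rewrite /= lee_fin; apply: le_trans (fh x).2 (ler_norm _).
Qed.

Lemma cintble_lin D (a : R[i]) f g : measurable D -> cintble D f -> cintble D g ->
  cintble D (fun x => a * f x + g x).
Proof.
move=> mD [fr fi] [gr gi]; split.
- under eq_fun do rewrite Re_lin EFinD EFinB !EFinM.
  by apply: integrableD => //; apply: integrableB => //; exact: integrableZl.
- under eq_fun do rewrite Im_lin 2!EFinD !EFinM.
  by apply: integrableD => //; apply: integrableD => //; exact: integrableZl.
Qed.

Lemma integrable_Zl D r (h : R -> R) : measurable D ->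
  mu.-integrable D (fun x => (h x)%:E) -> mu.-integrable D (EFin \o (fun x => r * h x)).
Proof.
move=> mD ih; have := @integrableZl _ _ _ mu D mD r _ ih.
by apply: eq_integrable => // x _; rewrite /= EFinM.
Qed.

Lemma integrable_D D (h k : R -> R) : measurable D ->
  mu.-integrable D (fun x => (h x)%:E) -> mu.-integrable D (fun x => (k x)%:E) ->
  mu.-integrable D (EFin \o (fun x => h x + k x)).
Proof.
move=> mD ih ik; have := @integrableD _ _ _ mu D mD _ _ ih ik.
by apply: eq_integrable => // x _; rewrite /= EFinD.
Qed.

Lemma integrable_B D (h k : R -> R) : measurable D ->
  mu.-integrable D (fun x => (h x)%:E) -> mu.-integrable D (fun x => (k x)%:E) ->
  mu.-integrable D (EFin \o (fun x => h x - k x)).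
Proof.
move=> mD ih ik; have := @integrableB _ _ _ mu D mD _ _ ih ik.
by apply: eq_integrable => // x _; rewrite /= EFinB.
Qed.

Lemma cint_lin D (a : R[i]) f g : measurable D -> cintble D f -> cintble D g ->
  cint D (fun x => a * f x + g x) = a * cint D f + cint D g.
Proof.
move=> mD [fr fi] [gr gi]; apply: complexP; rewrite !CReImE /=.
- under eq_Rintegral do rewrite Re_lin.
  rewrite RintegralD //; last by apply: integrable_B => //; exact: integrable_Zl.
  by rewrite RintegralB //; [rewrite !RintegralZl|exact: integrable_Zl|exact: integrable_Zl].
- under eq_Rintegral do rewrite Im_lin.
  rewrite RintegralD //; last by apply: integrable_D => //; exact: integrable_Zl.
  by rewrite RintegralD //; [rewrite !RintegralZl|exact: integrable_Zl|exact: integrable_Zl].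
Qed.

Lemma cint0 D : cint D (fun=> 0) = 0.
Proof. by apply: complexP; rewrite /= /Rintegral integral0. Qed.

Lemma cintble0 D : cintble D (fun=> 0).
Proof. by split; exact: integrable0. Qed.

Lemma cintZ D (a : R[i]) f : measurable D -> cintble D f ->
  cint D (fun x => a * f x) = a * cint D f.
Proof.
move=> mD fi; have := cint_lin a mD fi (cintble0 D).
by rewrite cint0 addr0 => <-; congr cint; apply/funext => x; rewrite addr0.
Qed.

Lemma cintJ D f : measurable D -> cintble D f ->
  cint D (fun x => (f x)^*) = (cint D f)^*.
Proof.
move=> mD [fr fi]; apply: complexP; rewrite !CReImE /=.
- by apply: eq_Rintegral => x _; rewrite CReJ.
- rewrite -mulN1r -RintegralZl //.
  by apply: eq_Rintegral => x _; rewrite CImJ mulN1r.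
Qed.

Lemma eq_cint_ae D f g : measurable D -> cmeasurable f -> cmeasurable g ->
  {ae mu, forall x, D x -> f x = g x} -> cint D f = cint D g.
Proof.
move=> mD [fr fi] [gr gi] fg; apply: complexP => /=; rewrite /Rintegral.
- congr fine; apply: ae_eq_integral => //.
  + by apply/measurable_EFinP; exact: measurable_funS fr.
  + by apply/measurable_EFinP; exact: measurable_funS gr.
  + by apply: filterS fg => x h Dx; rewrite h.
- congr fine; apply: ae_eq_integral => //.
  + by apply/measurable_EFinP; exact: measurable_funS fi.
  + by apply/measurable_EFinP; exact: measurable_funS gi.
  + by apply: filterS fg => x h Dx; rewrite h.
Qed.

Lemma ge0_integral_ae_eq D (f g : R -> \bar R) : measurable D ->
  measurable_fun setT f -> measurable_fun setT g ->
  {ae mu, forall x, D x -> f x = g x} ->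
  (\int[mu]_(x in D) f x = \int[mu]_(x in D) g x)%E.
Proof.
by move=> mD mf mg fg; apply: ae_eq_integral => //; exact: measurable_funS (mf) || exact: measurable_funS (mg).
Qed.

End ComplexIntegral.

(** * Inner product and completeness of L^2(R) *)

Section L2Hilbert.
Context {R : realType}.
Local Notation mu := (@lebesgue_measure R).
Implicit Types f g : L2 R.

Lemma L2P f : sqintegrable f.
Proof. by rewrite /L2_fun; case: (reprL2 f) => h /= /asboolP. Qed.

Lemma L2_cmeasurable f : cmeasurable f.
Proof. by case: (L2P f). Qed.

Lemma L2_ext f g : {ae mu, forall x, f x = g x} -> f = g.
Proof. by move=> fg; rewrite -(reprL2K f) -(reprL2K g); apply/classL2P. Qed.

Lemma toL2E (h : R -> R[i]) : sqintegrable h -> {ae mu, forall x, toL2 h x = h x}.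
Proof.
move=> hh; rewrite /toL2; have := classL2K (insubd 0 h : sqfun).
apply: filterS => x; rewrite /L2_fun => ->.
by rewrite -[sqfun_val _]/(val _) insubdK //; exact/asboolP.
Qed.

Lemma L2DE f g : {ae mu, forall x, (f + g : L2 R) x = f x + g x}.
Proof. by apply: filterS (classL2K (reprL2 f + reprL2 g)) => x; rewrite /L2_fun. Qed.

Lemma L2ZE (a : R[i]) f : {ae mu, forall x, (a *: f : L2 R) x = a * f x}.
Proof. by apply: filterS (classL2K (a *: reprL2 f)) => x; rewrite /L2_fun. Qed.

Lemma L2NE f : {ae mu, forall x, (- f : L2 R) x = - f x}.
Proof. by apply: filterS (classL2K (- reprL2 f)) => x; rewrite /L2_fun. Qed.

Lemma L20E : {ae mu, forall x, (0 : L2 R) x = 0}.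
Proof. by apply: filterS (classL2K 0) => x; rewrite /L2_fun. Qed.

Lemma L2linE (a : R[i]) f g : {ae mu, forall x, (a *: f + g : L2 R) x = a * f x + g x}.
Proof. by apply: filterS2 (L2DE (a *: f) g) (L2ZE a f) => x -> ->. Qed.

Lemma L2BE f g : {ae mu, forall x, (f - g : L2 R) x = f x - g x}.
Proof. by apply: filterS2 (L2DE f (- g)) (L2NE g) => x -> ->. Qed.

Lemma sqintegrable_norm (h : R -> R[i]) : sqintegrable h ->
  mu.-integrable setT (EFin \o (fun x => normc (h x) ^+ 2)).
Proof.
move=> [hr hi h2]; apply/integrableP; split; first exact: measurable_sqr_normc.
by under eq_integral => x _ do rewrite gee0_abs ?lee_fin ?sqr_ge0 //.
Qed.

Lemma cintble_mul_conj (h k : R -> R[i]) : sqintegrable h -> sqintegrable k ->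
  cintble setT (fun x => h x * (k x)^*).
Proof.
move=> hh hk; have [hr hi _] := hh; have [kr ki _] := hk.
apply: (@cintble_dominated _ setT _ (fun x => normc (h x) ^+ 2 + normc (k x) ^+ 2)) => //.
- by apply: cmeasurableM => //; exact: cmeasurableJ.
- by apply: integrable_D => //; exact: sqintegrable_norm.
- move=> x; rewrite !sqr_normcE !CReImE.
  move: (complex.Re (h x)) (complex.Im (h x)) (complex.Re (k x)) (complex.Im (k x)) => a b c d.
  have := (sqr_ge0 (a - c), sqr_ge0 (a + c), sqr_ge0 (b - d), sqr_ge0 (b + d)).
  have := (sqr_ge0 (a - d), sqr_ge0 (a + d), sqr_ge0 (b - c), sqr_ge0 (b + c)).
  move=> [[[? ?] ?] ?] [[[? ?] ?] ?]; rewrite !ler_norml; split; apply/andP; split; nra.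
Qed.

Lemma ipL2_cintble f g : cintble setT (fun x => f x * (g x)^*).
Proof. by apply: cintble_mul_conj; exact: L2P. Qed.

Lemma ipL2E f g : ipL2 f g = cint setT (fun x => f x * (g x)^*).
Proof. by []. Qed.

Lemma sqnorm_L2E f : (sqnorm ipL2 f)%:E = (\int[mu]_x (normc (f x) ^+ 2)%:E)%E.
Proof.
have [fr fi f2] := L2P f.
rewrite /sqnorm /= /Rintegral.
have E x : complex.Re (f x * (f x)^*) = normc (f x) ^+ 2.
  by rewrite sqr_normcE !CReImE; ring.
under eq_integral do rewrite E.
rewrite fineK // ge0_fin_numE //.
by apply: integral_ge0 => x _; rewrite lee_fin sqr_ge0.
Qed.

Lemma ae_eq0_sqr_norm (h : R -> R[i]) : cmeasurable h ->
  (\int[mu]_x (normc (h x) ^+ 2)%:E = 0)%E -> {ae mu, forall x, h x = 0}.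
Proof.
move=> mh h0; have mn := cmeasurable_sqr_normc mh.
have /(ae_eq_integral_abs mu measurableT mn) : (\int[mu]_x `|(normc (h x) ^+ 2)%:E| = 0)%E.
  by rewrite -[RHS]h0; apply: eq_integral => x _; rewrite gee0_abs ?lee_fin ?sqr_ge0.
by apply: filterS => x /(_ I) [] /sqr_normc_eq0.
Qed.

Lemma ipL2_inner : inner_product (@ipL2 R).
Proof.
split.
- move=> a f g h; rewrite -(cint_lin a measurableT (ipL2_cintble f h) (ipL2_cintble g h)).
  apply: eq_cint_ae => //.
  + by apply: cmeasurableM; [exact: L2_cmeasurable|apply: cmeasurableJ; exact: L2_cmeasurable].
  + apply: cmeasurableD; last by apply: cmeasurableM; [exact: L2_cmeasurable|apply: cmeasurableJ; exact: L2_cmeasurable].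
    apply: cmeasurableM; first exact: cmeasurable_cst.
    by apply: cmeasurableM; [exact: L2_cmeasurable|apply: cmeasurableJ; exact: L2_cmeasurable].
  + by apply: filterS (L2linE a f g) => x -> _; rewrite mulrDl mulrA.
- move=> f g; rewrite /ipL2 -[cintegral]/(cint setT) -cintJ //; last exact: ipL2_cintble.
  by congr cint; apply/funext => x; rewrite rmorphM /= conjcK mulrC.
- by move=> f; rewrite -lee_fin sqnorm_L2E; apply: integral_ge0 => x _; rewrite lee_fin sqr_ge0.
- move=> f f0; apply: L2_ext.
  have : {ae mu, forall x, (f : L2 R) x = 0}.
    apply: ae_eq0_sqr_norm; first exact: L2_cmeasurable.
    by rewrite -sqnorm_L2E /sqnorm f0.
  by apply: filterS2 L20E => x -> ->.
Qed.

Lemma sqintegrableB (h k : R -> R[i]) : sqintegrable h -> sqintegrable k ->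
  sqintegrable (fun x => h x - k x).
Proof.
move=> /asboolP hh /asboolP hk; apply/asboolP.
exact: (@rpredB _ (@sqint R)).
Qed.

Lemma le_Re_sqr (h : R -> R[i]) : (forall x, complex.Re (h x) ^+ 2 <= normc (h x) ^+ 2).
Proof. by move=> x; rewrite sqr_normcE lerDl sqr_ge0. Qed.

Lemma le_Im_sqr (h : R -> R[i]) : (forall x, complex.Im (h x) ^+ 2 <= normc (h x) ^+ 2).
Proof. by move=> x; rewrite sqr_normcE lerDr sqr_ge0. Qed.

Lemma L2_complete : hcomplete (@ipL2 R).
Proof.
(* The sequence is retyped with values in [L2 R], whose elements coerce to functions. *)
move=> u0; pose u : nat -> L2 R := u0; rewrite -[u0]/u; move: u => {u0}.
move=> u uC.
have mu_ m : cmeasurable (u m) by exact: L2_cmeasurable.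
have nB m k : (\int[mu]_x (normc (u m x - u k x) ^+ 2)%:E = (sqnorm ipL2 (u m - u k))%:E)%E.
  rewrite sqnorm_L2E; apply: ge0_integral_ae_eq => //.
  - by apply: cmeasurable_sqr_normc; apply: cmeasurableD => //; exact: cmeasurableN.
  - by apply: cmeasurable_sqr_normc; exact: L2_cmeasurable.
  - by apply: filterS (L2BE (u m) (u k)) => x ->.
have mN m k : measurable_fun setT (fun x => (normc (u m x - u k x) ^+ 2)%:E).
  by apply: cmeasurable_sqr_normc; apply: cmeasurableD => //; exact: cmeasurableN.
have [gr mgr hgr] : exists2 g : R -> R, measurable_fun setT g &
    forall e : R, 0 < e -> exists N, forall m, (N <= m)%N ->
      (\int[mu]_x ((complex.Re (u m x) - g x) ^+ 2)%:E <= e%:E)%E.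
  apply: (@real_L2_complete _ _ R mu (fun m x => complex.Re (u m x))) => [m|e e0]; first exact: (mu_ m).1.
  have [N hN] := uC e e0; exists N => m k Nm Nk.
  apply: (@le_trans _ _ (\int[mu]_x (normc (u m x - u k x) ^+ 2)%:E)%E).
    apply: ge0_le_integral => //.
    - by move=> x _; rewrite lee_fin sqr_ge0.
    - apply/measurable_EFinP; apply: measurable_funX; apply: measurable_funB; exact: (mu_ _).1.
    - exact: mN.
    - by move=> x _; rewrite lee_fin; have := le_Re_sqr (fun x => u m x - u k x) x; rewrite CReD CReN.
  by rewrite nB lee_fin; exact: hN.
have [gi mgi hgi] : exists2 g : R -> R, measurable_fun setT g &
    forall e : R, 0 < e -> exists N, forall m, (N <= m)%N ->
      (\int[mu]_x ((complex.Im (u m x) - g x) ^+ 2)%:E <= e%:E)%E.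
  apply: (@real_L2_complete _ _ R mu (fun m x => complex.Im (u m x))) => [m|e e0]; first exact: (mu_ m).2.
  have [N hN] := uC e e0; exists N => m k Nm Nk.
  apply: (@le_trans _ _ (\int[mu]_x (normc (u m x - u k x) ^+ 2)%:E)%E).
    apply: ge0_le_integral => //.
    - by move=> x _; rewrite lee_fin sqr_ge0.
    - apply/measurable_EFinP; apply: measurable_funX; apply: measurable_funB; exact: (mu_ _).2.
    - exact: mN.
    - by move=> x _; rewrite lee_fin; have := le_Im_sqr (fun x => u m x - u k x) x; rewrite CImD CImN.
  by rewrite nB lee_fin; exact: hN.
pose g x := gr x +i* gi x.
have mg : cmeasurable g by split.
have mD m : cmeasurable (fun x => u m x - g x) by apply: cmeasurableD => //; exact: cmeasurableN.
have near_g e : 0 < e -> exists N, forall m, (N <= m)%N ->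
    (\int[mu]_x (normc (u m x - g x) ^+ 2)%:E <= e%:E)%E.
  move=> e0; have e2 : 0 < e / 2 by rewrite divr_gt0.
  have [N1 h1] := hgr _ e2; have [N2 h2] := hgi _ e2.
  exists (maxn N1 N2) => m; rewrite geq_max => /andP[m1 m2].
  under eq_integral do rewrite sqr_normcE CReD CReN CImD CImN /= EFinD.
  rewrite ge0_integralD //.
  - by rewrite [e]splitr EFinD; apply: leeD; [exact: h1|exact: h2].
  - by move=> x _; rewrite lee_fin sqr_ge0.
  - apply/measurable_EFinP; apply: measurable_funX; apply: measurable_funB => //; exact: (mu_ _).1.
  - by move=> x _; rewrite lee_fin sqr_ge0.
  - apply/measurable_EFinP; apply: measurable_funX; apply: measurable_funB => //; exact: (mu_ _).2.
have sg : sqintegrable g.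
  have [N /(_ N (leqnn _)) hN] := near_g 1 ltr01.
  have sB : sqintegrable (fun x => u N x - g x).
    by split; [exact: (mD N).1|exact: (mD N).2|exact: le_lt_trans hN (ltry _)].
  have := sqintegrableB (L2P (u N)) sB.
  by congr sqintegrable; apply/funext => x; rewrite opprB addrC subrK.
exists (toL2 g); apply/cvgrPdist_le => e e0.
have [N hN] := near_g e e0; near=> m.
rewrite sub0r normrN ger0_norm; last exact: sqnorm_ge0 ipL2_inner _.
rewrite -lee_fin sqnorm_L2E; apply: le_trans (hN m _); last by near: m; exists N.
rewrite le_eqVlt; apply/orP; left; apply/eqP; apply: ge0_integral_ae_eq => //.
- by apply: cmeasurable_sqr_normc; exact: L2_cmeasurable.
- exact: cmeasurable_sqr_normc.
- by apply: filterS2 (L2BE (u m) (toL2 g)) (toL2E sg) => x -> ->.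
Unshelve. all: by end_near. Qed.

Lemma sqnorm_toL2 (h : R -> R[i]) : sqintegrable h ->
  ((sqnorm ipL2 (toL2 h))%:E = \int[mu]_x (normc (h x) ^+ 2)%:E)%E.
Proof.
move=> hh; rewrite sqnorm_L2E; apply: ge0_integral_ae_eq => //.
- by apply: cmeasurable_sqr_normc; exact: L2_cmeasurable.
- by apply: cmeasurable_sqr_normc; case: hh.
- by apply: filterS (toL2E hh) => x ->.
Qed.

End L2Hilbert.

(** * Uniqueness of Fourier coefficients on an interval *)

Section HeavisideApproximation.
Context {R : realType}.

Lemma cvg_expr0 (z : R) : 0 <= z < 1 -> z ^+ n @[n --> \oo] --> (0 : R).
Proof.
move=> /andP[z0 z1]; have := @cvg_geometric R 1 z.
rewrite ger0_norm // => /(_ z1); apply: cvg_trans; apply: near_eq_cvg.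
by near=> n; rewrite /geometric /= mul1r.
Unshelve. all: by end_near. Qed.

Lemma bernoulli_ge (x : R) n : 0 <= x -> 1 + x *+ n <= (1 + x) ^+ n.
Proof.
move=> x0; elim: n => [|n ih]; first by rewrite mulr0n addr0 expr0.
rewrite exprS mulrS; apply: le_trans (ler_wpM2l _ ih); last by rewrite addr_ge0.
have : 0 <= x * (x *+ n) by rewrite mulr_ge0 // mulrn_wge0.
nra.
Qed.

Lemma bernoulli_le (x : R) n : 0 <= x <= 1 -> 1 - x *+ n <= (1 - x) ^+ n.
Proof.
move=> /andP[x0 x1]; elim: n => [|n ih]; first by rewrite mulr0n subr0 expr0.
rewrite exprS mulrS; apply: le_trans (ler_wpM2l _ ih); last by rewrite subr_ge0.
have : 0 <= x * (x *+ n) by rewrite mulr_ge0 // mulrn_wge0.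
nra.
Qed.

(* Composed with affine functions of cosines, these polynomials approximate the
   indicator function of an interval by trigonometric polynomials. *)
Definition stepq (n : nat) (v : R) : R := (1 - v ^+ n) ^+ (2 ^ n)%N.

Lemma stepq_itv n v : 0 <= v <= 1 -> 0 <= stepq n v <= 1.
Proof.
move=> /andP[v0 v1]; have vn : 0 <= v ^+ n <= 1 by rewrite exprn_ge0 // exprn_ile1.
by rewrite /stepq exprn_ge0 ?exprn_ile1 //; lra.
Qed.

(** By Bernoulli's inequality [stepq n v] is at least [1 - (2 * v) ^+ n]. *)
Lemma stepq_cvg1 (v : R) : 0 <= v < 2^-1 -> stepq n v @[n --> \oo] --> (1 : R).
Proof.
move=> /andP[v0 v1].
have h : 1 - (2 * v) ^+ n @[n --> \oo] --> (1 : R).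
  rewrite -[X in _ --> X]subr0; apply: cvgB; first exact: cvg_cst.
  by apply: cvg_expr0; lra.
apply: (@squeeze_cvgr _ _ _ _ (fun n => 1 - (2 * v) ^+ n) (cst 1)); [|exact: h|exact: cvg_cst].
near=> n; rewrite /cst.
have vn : 0 <= v ^+ n <= 1 by rewrite exprn_ge0 //= exprn_ile1 //; lra.
have := bernoulli_le (2 ^ n) vn.
have /andP[_ ->] := stepq_itv n (v := v) ltac:(lra).
by rewrite andbT exprMn -natrX mulr_natl.
Unshelve. all: by end_near. Qed.

(** Put a = v^n and m = 2^n. Since (1 - a)^m (1 + a)^m is at most 1 and (1 + a)^m is at least 1 + m
    a by Bernoulli, [stepq n v] is at most 1/(m a) = (2 v)^(-n). *)
Lemma stepq_cvg0 (v : R) : 2^-1 < v <= 1 -> stepq n v @[n --> \oo] --> (0 : R).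
Proof.
move=> /andP[v0 v1].
have h : ((2 * v)^-1) ^+ n @[n --> \oo] --> (0 : R).
  apply: cvg_expr0; rewrite invr_ge0 invf_lt1; first by apply/andP; split; lra.
  lra.
apply: (squeeze_cvgr _ (cvg_cst 0) h); near=> n.
have vn : 0 <= v ^+ n <= 1 by rewrite exprn_ge0 ?exprn_ile1 //; lra.
have /andP[-> _] := stepq_itv n (v := v) ltac:(lra).
have p0 : 0 < (1 + v ^+ n) ^+ (2 ^ n)%N by rewrite exprn_gt0 //; lra.
have q0 : 0 < (2 * v) ^+ n by rewrite exprn_gt0 //; lra.
rewrite andTb exprVn -[leRHS]mul1r ler_pdivlMr //.
apply: (@le_trans _ _ (stepq n v * (1 + v ^+ n) ^+ (2 ^ n)%N)).
  apply: ler_wpM2l; first by have /andP[] := stepq_itv n (v := v) ltac:(lra).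
  have /andP[vn0 _] := vn; apply: le_trans (bernoulli_ge (2 ^ n) vn0).
  by rewrite exprMn -natrX mulr_natl; lra.
rewrite /stepq -exprMn (_ : (1 - v ^+ n) * (1 + v ^+ n) = 1 - (v ^+ n) ^+ 2); last by ring.
by apply: exprn_ile1; have := sqr_ge0 (v ^+ n); nra.
Unshelve. all: by end_near. Qed.

End HeavisideApproximation.

Section FourierUniqueness.
Context {R : realType}.
Local Notation mu := (@lebesgue_measure R).
Variable l : R.
Hypothesis l0 : 0 < l.
Local Notation D := [set` `[- l, l]].
Local Notation w := (pi / l).

Let mD : measurable (D : set (measurableTypeR R)).
Proof. exact: measurable_itv. Qed.

Definition null_integral (h : R -> R) :=
  mu.-integrable D (EFin \o h) /\ Rintegral mu D h = 0.

Lemma null_integralD h k : null_integral h -> null_integral k ->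
  null_integral (fun x => h x + k x).
Proof.
by move=> [ih h0] [ik k0]; split; [exact: integrable_D|rewrite RintegralD // h0 k0 addr0].
Qed.

Lemma null_integralZ (r : R) h : null_integral h -> null_integral (fun x => r * h x).
Proof.
by move=> [ih h0]; split; [exact: integrable_Zl|rewrite RintegralZl // h0 mulr0].
Qed.

Variable f : R -> R.
(** The free phase [b] covers cosine and sine at once and makes the hypothesis stable under
    product-to-sum formulas. *)
Hypothesis f_null : forall (k : int) (b : R),
  null_integral (fun x => f x * cos (w * k%:~R * x + b)).

(* The functions orthogonal to f with all their modulations are stable under
   multiplication by a cosine, by the product-to-sum formula. *)
Lemma null_integral_poly (p : {poly R}) (a b c : R) (k : int) (d : R) :
  null_integral (fun x => f x * p.[a + b * cos (w * x + c)] * cos (w * k%:~R * x + d)).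
Proof.
elim/poly_ind: p k d => [|p e ih] k d.
  rewrite (_ : (fun _ => _) = (fun x => 0 * (f x * cos (w * k%:~R * x + d)))).
    exact: null_integralZ.
  by apply/funext => x; rewrite horner0 mulr0 !mul0r.
have h1 := null_integralZ a (ih k d).
have h2 := null_integralZ (b / 2) (ih (k + 1) (d + c)).
have h3 := null_integralZ (b / 2) (ih (k - 1) (d - c)).
have h4 := null_integralZ e (f_null k d).
have := null_integralD (null_integralD h1 h2) (null_integralD h3 h4).
congr null_integral; apply/funext => x; rewrite hornerMXaddC.
rewrite intrD intrB.
have -> : w * (k%:~R + 1%:~R) * x + (d + c) = (w * k%:~R * x + d) + (w * x + c).
  by rewrite mulrDr mulr1 mulrDl; ring.
have -> : w * (k%:~R - 1%:~R) * x + (d - c) = (w * k%:~R * x + d) - (w * x + c).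
  by rewrite mulrBr mulr1 mulrBl; ring.
move: (w * k%:~R * x + d) (w * x + c) => A B.
by rewrite cosD cosB; field.
Qed.

Lemma null_integral_stepq n (a b c : R) :
  null_integral (fun x => f x * stepq n (a + b * cos (w * x + c))).
Proof.
have := null_integral_poly ((1 - 'X^n) ^+ (2 ^ n)%N) a b c 0 0.
congr null_integral; apply/funext => x.
by rewrite mulr0 mul0r addr0 cos0 mulr1 horner_exp !hornerE.
Qed.

Lemma null_f : null_integral f.
Proof.
have := f_null 0 0; congr null_integral; apply/funext => x.
by rewrite mulr0 mul0r addr0 cos0 mulr1.
Qed.

Lemma cos_gt_itv (r t : R) : 0 < r < pi -> - r < t < r -> cos r < cos t.
Proof.
move=> /andP[r0 rpi] /andP[tr rt].
rewrite -(cos_norm t) ltr_cos ?in_itv /= ?normr_ge0 ?ltW //=.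
  by rewrite ltr_norml tr rt.
by apply: (@lt_trans _ _ r) => //; rewrite ltr_norml tr rt.
Qed.

Lemma cos_lt_itv (r t : R) : 0 < r < pi -> r < t < 2 * pi - r -> cos t < cos r.
Proof.
move=> /andP[r0 rpi] /andP[rt tr].
have [tpi|pit] := leP t pi.
  by rewrite ltr_cos ?in_itv /= ?(ltW r0) ?(ltW rpi) //= tpi andbT; lra.
have -> : cos t = cos (2 * pi - t).
  by rewrite -cosN -(cosD2pi (- t)) addrC mulr_natl.
by rewrite ltr_cos ?in_itv /=; lra.
Qed.

Lemma ae_neq (a : R) : {ae mu, forall x, x != a}.
Proof.
exists [set a]; split; [exact: measurable_set1|exact: lebesgue_measure_set1|].
by move=> x /= /negP; rewrite negbK => /eqP.
Qed.

Lemma Rintegral_initial_segment x : - l < x < l -> Rintegral mu [set` `[- l, x]] f = 0.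
Proof.
move=> /andP[lx xl].
have [fi f0] := null_f.
have w0 : 0 < w by rewrite divr_gt0 // pi_gt0.
have wl : w * l = pi by rewrite mulfVK // gt_eqF.
(* [m] and [r] are the midpoint and the half-length of [-l,x]. *)
pose r := (x + l) / 2; pose m := (x - l) / 2.
have r0 : 0 < r by rewrite /r; lra.
have rl : r < l by rewrite /r; lra.
have wr : 0 < w * r < pi.
  by rewrite mulr_gt0 //= -[ltRHS]wl ltr_pM2l.
have w2 : 2 * pi - w * r = w * (2 * l - r) by rewrite -{1}wl; ring.
(* [v y] is on the same side of 1/2 as [cos (w * (y - m))] is of [cos (w * r)]: above it inside the
   segment, below it on the rest of the period. The factors 1/4 keep it in [0,1]. Hence
   [stepq n (v y)] tends to 0 inside the segment and to 1 on []x, l[]. *)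
pose v y := 2^-1 - cos (w * r) / 4 + 4^-1 * cos (w * y + (- (w * m))).
have v01 y : 0 <= v y <= 1.
  rewrite /v; have := (cos_geN1 (w * r), cos_le1 (w * r)).
  have := (cos_geN1 (w * y + - (w * m)), cos_le1 (w * y + - (w * m))).
  by move=> [h1 h2] [h3 h4]; apply/andP; split; lra.
pose fn n y := (f y * stepq n (v y))%:E.
pose g y := (f y * \1_(`]x, l]%classic : set R) y)%:E.
have fni n : mu.-integrable D (fn n) by case: (null_integral_stepq n (2^-1 - cos (w * r) / 4) 4^-1 (- (w * m))).
have mf : measurable_fun (D : set (measurableTypeR R)) f.
  by apply/measurable_EFinP; exact: measurable_int fi.
have [] := @dominated_convergence _ _ _ mu D mD fn g (fun y => `|(f y)%:E|%E).
- by move=> n; exact: measurable_int (fni n).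
- by apply/measurable_EFinP; apply: measurable_funM.
- apply: filterS3 (ae_neq x) (ae_neq l) (ae_neq (- l)) => y yx yl ynl.
  rewrite /= in_itv /= => /andP[ly yl'].
  apply: cvg_EFin; first exact: nearW.
  have mr : - l - m = - r /\ l - m = 2 * l - r by rewrite /m /r; split; field.
  have Ey : w * y - w * m = w * (y - m) by rewrite mulrBr.
  have [xy|yx'] := ltP x y.
    rewrite indicE mem_set ?mulr1 /=; last by rewrite /= in_itv /= xy yl'.
    rewrite -[X in _ --> X]mulr1; apply: cvgM; first exact: cvg_cst.
    apply: stepq_cvg1; have /andP[-> _] := v01 y; rewrite /= /v.
    have : cos (w * (y - m)) < cos (w * r).
      apply: cos_lt_itv => //; rewrite w2 !ltr_pM2l //.
      have : y < l by rewrite lt_neqAle yl.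
      by case: mr; rewrite /m /r; lra.
    rewrite Ey; lra.
  have {}yx' : y < x by rewrite lt_neqAle yx.
  rewrite indicE memNset ?mulr0 /=; last by rewrite /= in_itv /= ltNge (ltW yx').
  rewrite -[X in _ --> X](mulr0 (f y)); apply: cvgM; first exact: cvg_cst.
  apply: stepq_cvg0; have /andP[_ ->] := v01 y; rewrite andbT /v.
  have : cos (w * r) < cos (w * (y - m)).
    apply: cos_gt_itv => //; rewrite -mulrN !ltr_pM2l //.
    have : - l < y by rewrite lt_neqAle eq_sym ynl.
    by case: mr; rewrite /m /r; lra.
  rewrite Ey; lra.
- exact: integrable_abse.
- apply: aeW => y n _; rewrite /fn EFinM abseM -[leRHS]mule1; apply: lee_wpmul2l => //.
  by rewrite abse_EFin lee_fin ger0_norm; have /andP[] := stepq_itv n (v01 y).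
move=> _ _.
have -> : (fun n => \int[mu]_(y in D) fn n y)%E = cst 0%E.
  apply/funext => n; have [i e] := null_integral_stepq n (2^-1 - cos (w * r) / 4) 4^-1 (- (w * m)).
  rewrite -[RHS]/((0 : R)%:E) -e fineK //; exact: integrable_fin_num.
move=> h0.
have {h0} g0 : (\int[mu]_(y in D) g y = 0)%E by apply: (cvg_unique _ h0 (cvg_cst _)).
have sub : `]x, l]%classic `<=` (D : set R).
  by move=> y /=; rewrite !in_itv /= => /andP[? ->]; rewrite andbT; lra.
have U : (D : set R) = `[- l, x]%classic `|` `]x, l]%classic.
  apply/seteqP; split => y /=; rewrite !in_itv /=.
    by move=> /andP[h1 h2]; have [?|?] := leP y x; [left; rewrite h1|right].
  by move=> [] /andP[h1 h2]; apply/andP; split; lra.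
(* The limit function is carried by []x, l]]; since [f] has integral 0 over the whole interval, the
   integral over the segment vanishes too. *)
have := f0; rewrite U Rintegral_setU //.
- suff -> : Rintegral mu `]x, l]%classic f = 0 by rewrite addr0.
  rewrite /Rintegral.
  suff -> : (\int[mu]_(y in `]x, l]) (f y)%:E = \int[mu]_(y in D) g y)%E by rewrite g0.
  rewrite integral_mkcond [RHS]integral_mkcond; apply: eq_integral => y _.
  rewrite !patchE /g indicE.
  case: ifPn => [yin|]; first by rewrite mem_set ?mulr1 //; apply: sub; rewrite inE in yin.
  by rewrite mulr0; case: ifP.
- by rewrite -U.
- apply/disj_setPS => y /= []; rewrite !in_itv /= => /andP[_ h1] /andP[h2 _].
  by have := lt_le_trans h2 h1; rewrite ltxx.
Qed.

(** The primitive of [f], extended by 0 outside the interval, vanishes identically, and by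
    Lebesgue's theorem its derivative is the function almost everywhere. *)
Lemma fourier_coef_unique : {ae mu, forall x, D x -> f x = 0}.
Proof.
have [fi f0] := null_f.
pose g := f \_ D.
have gi : mu.-integrable setT (EFin \o g).
  by rewrite /g -restrict_EFin; apply/(integrable_mkcond _ mD).
have gl : locally_integrable setT g by exact: integrable_locally.
have gy y : mu.-integrable `]-oo, y] (EFin \o g).
  by apply: integrableS gi => //; exact: measurable_itv.
have G0 (x : R) : Rintegral mu [set` `]-oo, x]] g = 0.
  have E : Rintegral mu [set` `]-oo, x]] g = Rintegral mu [set` `[- l, Num.min x l]] f.
    rewrite /g Rintegral_mkcond [RHS]Rintegral_mkcond; congr Rintegral.
    apply/funext => y; rewrite /patch !mem_setE !in_itv /= le_min.
    by case: (y <= x); case: (y <= l); rewrite ?andbT ?andbF.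
  rewrite E; have [lx|xl] := leP l x; first exact: f0.
  have [xl'|lx] := ltP (- l) x; first by apply: Rintegral_initial_segment; rewrite xl'.
  move: lx; rewrite le_eqVlt => /orP[/eqP ->|lx].
    by rewrite set_itv1 Rintegral_set1.
  by rewrite set_itv_ge ?Rintegral_set0 // bnd_simp -ltNge.
apply: filterS (FTC1Ny gy gl) => x [_].
rewrite (_ : (fun _ => _) = cst 0) ?derive1_cst; last by apply/funext => y; exact: G0.
by rewrite /g => + Dx; rewrite patchE mem_set.
Qed.

End FourierUniqueness.

(** * Parseval's identity on an interval *)

Section RieszFischer.
Context {R : realType} {H : lmodType R[i]} (ip : H -> H -> R[i]).
Hypotheses (ipP : inner_product ip) (Hcomplete : hcomplete ip).
Variables (e : nat -> H) (c : R).
Hypotheses (c0 : 0 < c)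
  (eo : forall i j, ip (e i) (e j) = (if i == j then c else 0)%:C).
Local Notation sqnorm := (sqnorm ip).

Lemma sqnorm_residual f m :
  sqnorm (f - \sum_(0 <= i < m) (ip f (e i) / c%:C) *: e i) =
  sqnorm f - \sum_(0 <= i < m) normc (ip f (e i)) ^+ 2 / c.
Proof. by apply: sqnorm_orthogonal_residual => //; exact: iota_uniq. Qed.

Lemma bessel f : (\sum_(0 <= j <oo) (normc (ip f (e j)) ^+ 2)%:E <= (c * sqnorm f)%:E)%E.
Proof.
apply: lime_le; first by apply: is_cvg_nneseries => j _ _; rewrite lee_fin sqr_ge0.
apply: nearW => m; rewrite sumEFin lee_fin.
have := sqnorm_ge0 ipP (f - \sum_(0 <= i < m) (ip f (e i) / c%:C) *: e i).
by rewrite sqnorm_residual subr_ge0 -mulr_suml ler_pdivrMr // mulrC.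
Qed.

Lemma ip_partial (a : nat -> R[i]) m k i :
  ip (\sum_(m <= j < k) (a j / c%:C) *: e j) (e i) = if (m <= i < k)%N then a i else 0.
Proof.
have cn0 : c%:C != 0 :> R[i] by apply/eqP => /(congr1 (@complex.Re R)) /= cz; move: c0; rewrite cz ltxx.
rewrite ip_suml //; case: ifPn => mik.
  rewrite (big_rem i) ?mem_index_iota //= ipZl // eo eqxx mulfVK // big_seq.
  rewrite big1 ?addr0 // => j; rewrite mem_rem_uniq ?iota_uniq // inE => /andP[ji _].
  by rewrite ipZl // eo (negbTE ji) mulr0.
rewrite big_nat big1 // => j mjk; rewrite ipZl // eo; case: eqP => [ji|_]; last by rewrite mulr0.
by rewrite -ji mjk in mik.
Qed.

Lemma sqnorm_partial (a : nat -> R[i]) m k :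
  sqnorm (\sum_(m <= j < k) (a j / c%:C) *: e j) = \sum_(m <= j < k) normc (a j) ^+ 2 / c.
Proof.
set p := \sum_(m <= j < k) _.
have := sqnorm_orthogonal_residual ipP p (iota_uniq m (k - m)) c0 (fun i j _ _ => eo i j).
rewrite (_ : p - _ = 0) ?sqnorm0 //; last first.
  apply/eqP; rewrite subr_eq0; apply/eqP; rewrite {1}/p big_nat [RHS]big_nat.
  by apply: eq_bigr => i mik; rewrite ip_partial mik.
move/esym/eqP; rewrite subr_eq0 => /eqP ->; rewrite big_nat [RHS]big_nat.
by apply: eq_bigr => i mik; rewrite ip_partial mik.
Qed.

(** By orthogonality the squared distance between partial sums is a block of a convergent numerical
    series, so they converge. Each coefficient is eventually constant along the partial sums and
    passes to the limit. *)
Lemma riesz_fischer (a : nat -> R[i]) :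
  (\sum_(0 <= j <oo) (normc (a j) ^+ 2)%:E < +oo)%E ->
  exists g, [/\ forall j, ip g (e j) = a j &
    \sum_(0 <= j <oo) (normc (a j) ^+ 2)%:E = (c * sqnorm g)%:E]%E.
Proof.
move=> aoo.
have a0 j : (0 <= (normc (a j) ^+ 2)%:E)%E by rewrite lee_fin sqr_ge0.
pose S (m : nat) : R := \sum_(0 <= j < m) normc (a j) ^+ 2.
have [s cS] : exists s : R, S m @[m --> \oo] --> s.
  apply/cvg_ex; apply: nondecreasing_is_cvgn.
    by apply/nondecreasing_seqP => m; rewrite /S big_nat_recr //= lerDl sqr_ge0.
  exists (fine (\sum_(0 <= j <oo) (normc (a j) ^+ 2)%:E)%E) => _ [m _ <-].
  rewrite -lee_fin fineK; last by rewrite ge0_fin_numE // nneseries_ge0.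
  by rewrite /S -sumEFin; apply: nneseries_lim_ge => k _ _.
have sE : (\sum_(0 <= j <oo) (normc (a j) ^+ 2)%:E = s%:E)%E.
  apply/cvg_lim => //; under eq_cvg do rewrite sumEFin.
  by apply: cvg_EFin => //; exact: nearW.
pose p m := \sum_(0 <= j < m) (a j / c%:C) *: e j.
have pB m k : (m <= k)%N -> sqnorm (p k - p m) = (S k - S m) / c.
  move=> mk; rewrite /p /S (big_cat_nat (n := m)) //= addrAC subrr add0r sqnorm_partial.
  by rewrite [in RHS](big_cat_nat (n := m)) //= addrAC subrr add0r mulr_suml.
have [g hg] : exists g, sqnorm (p m - g) @[m --> \oo] --> (0 : R).
  apply: Hcomplete => eps eps0.
  have ec : 0 < eps * c / 2 by rewrite divr_gt0 // mulr_gt0.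
  have /cvgrPdist_le/(_ _ ec)[N _ hN] := cS.
  have dS m k : (N <= m)%N -> (N <= k)%N -> (S k - S m) / c <= eps.
    move=> /hN h1 /hN h2; rewrite ler_pdivrMr //.
    move: h1 h2; rewrite /= !ler_norml => /andP[? ?] /andP[? ?]; lra.
  exists N => m k Nm Nk; have [km|/ltnW mk] := leqP k m.
    by rewrite pB //; exact: dS.
  by rewrite sqnormBC // pB //; exact: dS.
exists g; split.
  move=> j; have [hr hi] := cvg_ipl ipP (e j) hg.
  have pj : \forall m \near \oo, ip (p m) (e j) = a j.
    by exists j.+1 => // m /= jm; rewrite ip_partial leq0n jm.
  apply: complexP.
  - have h' : complex.Re (ip (p m) (e j)) @[m --> \oo] --> complex.Re (a j).
      by apply: cvg_near_cst; apply: filterS pj => m ->.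
    exact: (cvg_unique _ hr h').
  - have h' : complex.Im (ip (p m) (e j)) @[m --> \oo] --> complex.Im (a j).
      by apply: cvg_near_cst; apply: filterS pj => m ->.
    exact: (cvg_unique _ hi h').
have h1 : S m / c @[m --> \oo] --> sqnorm g.
  apply: cvg_trans (cvg_sqnorm ipP hg); apply: near_eq_cvg; near=> m.
  by rewrite sqnorm_partial /S mulr_suml.
have h2 : S m / c @[m --> \oo] --> s / c by apply: cvgMl.
rewrite sE (cvg_unique _ h1 h2); first by rewrite mulrCA divff ?mulr1 // gt_eqF.
Unshelve. all: by end_near. Qed.

End RieszFischer.

(** The order 0, -1, 1, -2, 2, ...; it transfers statements about sequences, such as Riesz-Fischer,
    to families indexed by the integers. *)
Definition int_enum (j : nat) : int := if odd j then Negz j./2 else Posz j./2.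

Lemma int_enum_bij : set_bij [set: nat] [set: int] int_enum.
Proof.
split => //.
- move=> i j _ _; rewrite /int_enum.
  by case: ifPn => oi; case: ifPn => oj // [hij];
    rewrite -(odd_double_half i) -(odd_double_half j) hij ?(negbTE oi) ?(negbTE oj) ?oi ?oj.
- move=> [m|m] _.
    by exists m.*2 => //; rewrite /int_enum odd_double doubleK.
  by exists m.*2.+1 => //; rewrite /int_enum /= odd_double /= uphalf_double.
Qed.

Lemma int_enum_inj : injective int_enum.
Proof. by case: int_enum_bij => _ h _ i j; apply: h; rewrite inE. Qed.

Lemma int_enum_surj k : exists j, int_enum j = k.
Proof. by case: int_enum_bij => _ _ /(_ k I)[j _ <-]; exists j. Qed.

Lemma esum_int {R : realType} (a : int -> \bar R) : (forall k, 0 <= a k)%E ->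
  (\esum_(k in [set: int]) a k = \sum_(0 <= j <oo) a (int_enum j))%E.
Proof. by move=> a0; rewrite (@reindex_esum R nat int setT setT int_enum a int_enum_bij) nneseries_esumT. Qed.

Section Parseval.
Context {R : realType}.
Local Notation mu := (@lebesgue_measure R).
Variable l : R.
Hypothesis l0 : 0 < l.
Local Notation D := [set` `[- l, l]].
Local Notation w := (pi / l).

Let mD : measurable (D : set (measurableTypeR R)).
Proof. exact: measurable_itv. Qed.

Let muD : mu D = (2 * l)%:E.
Proof.
rewrite lebesgue_measure_itv /= lte_fin gtrN // -EFinB; congr EFin; ring.
Qed.

Lemma cint_mkcond f : cint D f = cint setT (fun x => (\1_D x)%:C * f x).
Proof.
apply: complexP; rewrite /= Rintegral_mkcond; congr Rintegral; apply/funext => x;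
  rewrite patchE indicE; case: ifPn => _; rewrite /= !CReImE /=.
- by rewrite mul1r mul0r subr0.
- by rewrite !mul0r subr0.
- by rewrite mul1r mul0r addr0.
- by rewrite !mul0r addr0.
Qed.

Definition fourier_coef (F : R -> R[i]) (k : int) : R[i] :=
  cint D (fun x => F x * cis (- (w * k%:~R * x))).

Lemma cmeasurable_cis_lin (a : R) : cmeasurable (fun x => cis (a * x)).
Proof. by apply: cmeasurable_cis; exact: measurable_funM. Qed.

Lemma cintble_cis (F : R -> R[i]) (h : R -> R) : cmeasurable F -> cintble D F ->
  measurable_fun setT h -> cintble D (fun x => F x * cis (h x)).
Proof.
move=> mF [Fr Fi] mh.
apply: (@cintble_dominated _ D _ (fun x => `|complex.Re (F x)| + `|complex.Im (F x)|)) => //.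
- by apply: cmeasurableM => //; exact: cmeasurable_cis.
- by apply: integrable_D => //; [exact: integrable_abse Fr|exact: integrable_abse Fi].
- move=> x; rewrite !CReImE /=.
  have := (cos_geN1 (h x), cos_le1 (h x)); have := (sin_geN1 (h x), sin_le1 (h x)).
  move=> [s1 s2] [c1 c2].
  have hs : `|sin (h x)| <= 1 by rewrite ler_norml s1.
  have hc : `|cos (h x)| <= 1 by rewrite ler_norml c1.
  split; (apply: le_trans (ler_normB _ _) _ || apply: le_trans (ler_normD _ _) _);
  by rewrite !normrM; apply: lerD || (rewrite addrC; apply: lerD);
    rewrite -[leRHS]mulr1; apply: ler_wpM2l.
Qed.

Lemma fourier_coef_eq0_Re (F : R -> R[i]) : cmeasurable F -> cintble D F ->
  (forall k, fourier_coef F k = 0) -> {ae mu, forall x, D x -> complex.Re (F x) = 0}.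
Proof.
move=> mF iF F0.
have Ik (k : int) : cintble D (fun x => F x * cis (w * k%:~R * x)).
  by apply: cintble_cis => //; exact: measurable_funM.
have I0 (k : int) : cint D (fun x => F x * cis (w * k%:~R * x)) = 0.
  rewrite -[RHS](F0 (- k)); congr cint; apply/funext => x.
  by rewrite intrN mulrN mulNr opprK.
apply: (fourier_coef_unique l0) => k b.
(* The modulations of frequency k and -k, with factors [cis b] and [cis (- b)], add up to
   [2 * cos (w * k * x + b)]. This weight is real, so the real part of the integral only involves
   that of [F]. *)
have h1 := cintble_lin (cis b) mD (Ik k) (cintble0 D).
have h2 := cintble_lin (cis (- b)) mD (Ik (- k)) (cintble0 D).
have e1 := cint_lin (cis b) mD (Ik k) (cintble0 D).
have e2 := cint_lin (cis (- b)) mD (Ik (- k)) (cintble0 D).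
rewrite (I0 k) cint0 mulr0 addr0 in e1; rewrite (I0 (- k)) cint0 mulr0 addr0 in e2.
have [i1 _] := cintble_lin 1 mD h1 h2.
have e := cint_lin 1 mD h1 h2; rewrite e1 e2 mulr0 addr0 in e.
have E x : complex.Re (1 * (cis b * (F x * cis (w * k%:~R * x)) + 0) +
    (cis (- b) * (F x * cis (w * (- k)%:~R * x)) + 0)) =
    2 * (complex.Re (F x) * cos (w * k%:~R * x + b)).
  rewrite intrN mulrN mulNr !addr0 mul1r; move: (w * k%:~R * x) => t.
  by rewrite !CReImE /= !(cosN, sinN) cosD; ring.
have /(null_integralZ 2^-1) : null_integral l
    (fun x => 2 * (complex.Re (F x) * cos (w * k%:~R * x + b))).
  split; first by apply: eq_integrable i1 => // x _ /=; rewrite E.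
  have /(congr1 (@complex.Re R)) /= := e.
  by under eq_Rintegral do rewrite E.
by congr null_integral; apply/funext => x; field.
Qed.

Lemma fourier_coef_eq0 (F : R -> R[i]) : cmeasurable F -> cintble D F ->
  (forall k, fourier_coef F k = 0) -> {ae mu, forall x, D x -> F x = 0}.
Proof.
move=> mF iF F0.
(* The real part of [- 'i * F] is the imaginary part of [F]. *)
have mF' : cmeasurable (fun x => - 'i * F x) by apply: cmeasurableM => //; exact: cmeasurable_cst.
have iF' : cintble D (fun x => - 'i * F x).
  have := cintble_lin (- 'i) mD iF (cintble0 D).
  by congr cintble; apply/funext => x; rewrite addr0.
have F0' k : fourier_coef (fun x => - 'i * F x) k = 0.
  rewrite /fourier_coef (_ : (fun _ => _) = (fun x => - 'i * (F x * cis (- (w * k%:~R * x))))).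
    2: by apply/funext => x; rewrite mulrA.
  rewrite cintZ // ?[cint _ _]F0 ?mulr0 //.
  by apply: cintble_cis => //; apply: measurableT_comp => //; exact: measurable_funM.
apply: filterS2 (fourier_coef_eq0_Re mF iF F0) (fourier_coef_eq0_Re mF' iF' F0').
move=> x hr hi Dx; apply: complexP; rewrite /= ?hr //.
by have := hi Dx; rewrite !CReImE /=; lra.
Qed.

Definition expL2 (k : int) : L2 R := toL2 (fun x => (\1_D x)%:C * cis (w * k%:~R * x)).

Lemma sqintegrable_mkcond (F : R -> R[i]) : cmeasurable F ->
  (\int[mu]_(x in D) (normc (F x) ^+ 2)%:E < +oo)%E ->
  sqintegrable (fun x => (\1_D x)%:C * F x).
Proof.
move=> mF F2; have [mr mi] := cmeasurable_indic mD mF; split => //.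
apply: le_lt_trans F2; rewrite [leRHS]integral_mkcond.
rewrite le_eqVlt; apply/orP; left; apply/eqP; apply: eq_integral => x _.
rewrite patchE indicE sqr_normcM; case: ifPn => _; rewrite sqr_normcE /=.
  by rewrite expr0n addr0 expr1n mul1r.
by rewrite expr0n addr0 mul0r.
Qed.

Lemma sqnorm_toL2_mkcond (F : R -> R[i]) : cmeasurable F ->
  (\int[mu]_(x in D) (normc (F x) ^+ 2)%:E < +oo)%E ->
  ((sqnorm ipL2 (toL2 (fun x => (\1_D x)%:C * F x)))%:E =
   \int[mu]_(x in D) (normc (F x) ^+ 2)%:E)%E.
Proof.
move=> mF F2; rewrite (sqnorm_toL2 (sqintegrable_mkcond mF F2)) [RHS]integral_mkcond.
apply: eq_integral => x _.
rewrite patchE indicE sqr_normcM; case: ifPn => _; rewrite [normc _%:C ^+ 2]sqr_normcE /=.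
  by rewrite expr0n addr0 expr1n mul1r.
by rewrite expr0n addr0 mul0r.
Qed.

Lemma cis_sq_integral (k : int) :
  (\int[mu]_(x in D) (normc (cis (w * k%:~R * x)) ^+ 2)%:E = (2 * l)%:E)%E.
Proof.
under eq_integral do rewrite sqr_normc_cis.
by rewrite integral_cst // mul1e; exact: muD.
Qed.

Lemma expL2E (k : int) : {ae mu, forall x, expL2 k x = (\1_D x)%:C * cis (w * k%:~R * x)}.
Proof.
apply: toL2E; apply: sqintegrable_mkcond; first exact: cmeasurable_cis_lin.
by rewrite cis_sq_integral ltry.
Qed.

Lemma ip_expL2 (f : L2 R) k : ipL2 f (expL2 k) = fourier_coef f k.
Proof.
rewrite /fourier_coef cint_mkcond ipL2E; apply: eq_cint_ae => //.
- by apply: cmeasurableM; [exact: L2_cmeasurable|apply: cmeasurableJ; exact: L2_cmeasurable].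
- apply: cmeasurable_indic => //; apply: cmeasurableM; first exact: L2_cmeasurable.
  by apply: cmeasurable_cis; apply: measurableT_comp => //; exact: measurable_funM.
- apply: filterS (expL2E k) => x -> _.
  by apply: complexP; rewrite !CReImE /= cosN sinN; ring.
Qed.

Lemma Rintegral_derive (g G : R -> R) : (forall x, is_derive x (1 : R) G (g x)) ->
  continuous g -> Rintegral mu D g = G l - G (- l).
Proof.
move=> dG cg; rewrite /Rintegral (continuous_FTC2 (F := G)) //.
- by rewrite gtrN.
- exact: continuous_subspaceT.
- have cG : continuous G.
    by move=> x; apply: differentiable_continuous; apply/derivable1_diffP; case: (dG x).
  split; first by move=> x _; case: (dG x).
  + by apply: cvg_at_right_filter; exact: cG.
  + by apply: cvg_at_left_filter; exact: cG.
- by move=> x _; rewrite derive1E; case: (dG x).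
Qed.

Lemma sin_mul_pi (n : int) : sin (pi * n%:~R) = 0 :> R.
Proof.
have h (m : nat) : sin (pi * m%:R) = 0 :> R.
  have := alternatingn (@sinDpi R) m 0.
  by rewrite add0r sin0 mulr0 mulr_natr.
case: n => m; first exact: h.
by rewrite NegzE intrN mulrN sinN -[_%:~R]/(m.+1%:R) h oppr0.
Qed.

Lemma expL2_orthogonal k j : ipL2 (expL2 k) (expL2 j) = (if k == j then 2 * l else 0)%:C.
Proof.
rewrite ip_expL2.
have -> : fourier_coef (expL2 k) j = cint D (fun x => cis (w * (k - j)%:~R * x)).
  apply: eq_cint_ae => //.
  - apply: cmeasurableM; first exact: L2_cmeasurable.
    by apply: cmeasurable_cis; apply: measurableT_comp => //; exact: measurable_funM.
  - exact: cmeasurable_cis_lin.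
  - apply: filterS (expL2E k) => x -> Dx; rewrite indicE mem_set // mul1r -cisD.
    by congr cis; rewrite intrB; ring.
case: eqP => [->|/eqP kj].
  rewrite subrr; under [X in cint _ X]eq_fun do rewrite mulr0 mul0r cis0.
  have E r : Rintegral mu D (fun=> r) = r * (2 * l).
    by rewrite Rintegral_cst //; congr (_ * _); exact: (congr1 fine muD).
  by apply: complexP; rewrite /= E ?mul1r ?mul0r.
set a := w * _.
have an0 : a != 0.
  by rewrite mulf_neq0 ?intr_eq0 ?subr_eq0 // gt_eqF // divr_gt0 ?pi_gt0.
(* Hence the sine in the first primitive vanishes at both ends; the cosine in the second takes equal
   values there, being even. *)
have al : exists n : int, a * l = pi * n%:~R.
  by exists (k - j); rewrite /a mulrAC mulfVK // gt_eqF.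
have cM : continuous (fun x : R => a * x).
  exact: mulrl_continuous.
have ds x : is_derive x (1 : R) (fun x => sin (a * x) / a) (cos (a * x)).
  apply: is_derive_eq; rewrite /= !scaler0 ?add0r ?addr0 /GRing.scale /= mulr1.
  by field.
have dc x : is_derive x (1 : R) (fun x => - cos (a * x) / a) (sin (a * x)).
  apply: is_derive_eq; rewrite /= !scaler0 ?add0r ?addr0 /GRing.scale /= mulr1.
  by field.
apply: complexP => /=.
- rewrite (Rintegral_derive ds).
    by rewrite mulrN sinN; case: al => n ->; rewrite sin_mul_pi oppr0 mul0r subrr.
  by move=> x; apply: continuous_comp; [exact: cM|exact: continuous_cos].
- rewrite (Rintegral_derive dc); first by rewrite mulrN cosN subrr.
  by move=> x; apply: continuous_comp; [exact: cM|exact: continuous_sin].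
Qed.

Lemma sqintegrable_cintble (F : R -> R[i]) : cmeasurable F ->
  (\int[mu]_(x in D) (normc (F x) ^+ 2)%:E < +oo)%E -> cintble D F.
Proof.
move=> mF F2; apply: (@cintble_dominated _ D _ (fun x => normc (F x) ^+ 2 + 1)) => //.
- apply: integrable_D => //.
    apply/integrableP; split; first by apply: measurable_funTS; exact: cmeasurable_sqr_normc.
    by under eq_integral do rewrite gee0_abs ?lee_fin ?sqr_ge0 //.
  apply/integrableP; split; first exact: measurable_cst.
  under eq_integral do rewrite abse1.
  by rewrite integral_cst // mul1e [X in (X < _)%E]muD ltry.
- move=> x; rewrite sqr_normcE; move: (complex.Re (F x)) (complex.Im (F x)) => u v.
  have := (sqr_ge0 (u - 1), sqr_ge0 (u + 1), sqr_ge0 (v - 1), sqr_ge0 (v + 1)).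
  by move=> [[[? ?] ?] ?]; rewrite !ler_norml; split; apply/andP; split; nra.
Qed.

(** [F] is only assumed integrable. If its coefficients are square summable, Riesz-Fischer gives an
    L^2 function with the same coefficients on the interval, and uniqueness identifies it with [F];
    this shows that [F] is square integrable and supplies the inequality opposite to Bessel's. *)
Lemma parseval (F : R -> R[i]) : cmeasurable F -> cintble D F ->
  (\esum_(k in [set: int]) (normc (fourier_coef F k) ^+ 2)%:E =
   (2 * l)%:E * \int[mu]_(x in D) (normc (F x) ^+ 2)%:E)%E.
Proof.
move=> mF iF; pose e j := expL2 (int_enum j).
have l2 : 0 < 2 * l by rewrite mulr_gt0.
have eo i j : ipL2 (e i) (e j) = (if i == j then 2 * l else 0)%:C.
  by rewrite expL2_orthogonal (inj_eq int_enum_inj).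
pose a j := fourier_coef F (int_enum j).
have -> : (\esum_(k in [set: int]) (normc (fourier_coef F k) ^+ 2)%:E =
    \sum_(0 <= j <oo) (normc (a j) ^+ 2)%:E)%E.
  by rewrite esum_int // => k; rewrite lee_fin sqr_ge0.
have mN : measurable_fun (D : set (measurableTypeR R)) (fun x => (normc (F x) ^+ 2)%:E).
  by apply: measurable_funTS; exact: cmeasurable_sqr_normc.
have ip_mkcond (F2 : (\int[mu]_(x in D) (normc (F x) ^+ 2)%:E < +oo)%E) j :
    ipL2 (toL2 (fun x => (\1_D x)%:C * F x)) (e j) = a j.
  rewrite /e ip_expL2; apply: eq_cint_ae => //.
  - apply: cmeasurableM; first exact: L2_cmeasurable.
    by apply: cmeasurable_cis; apply: measurableT_comp => //; exact: measurable_funM.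
  - apply: cmeasurableM => //.
    by apply: cmeasurable_cis; apply: measurableT_comp => //; exact: measurable_funM.
  - apply: filterS (toL2E (sqintegrable_mkcond mF F2)) => x -> Dx.
    by rewrite indicE mem_set // mul1r.
have bes (F2 : (\int[mu]_(x in D) (normc (F x) ^+ 2)%:E < +oo)%E) :
  (\sum_(0 <= j <oo) (normc (a j) ^+ 2)%:E <=
    (2 * l)%:E * \int[mu]_(x in D) (normc (F x) ^+ 2)%:E)%E.
  have := bessel ipL2_inner l2 eo (toL2 (fun x => (\1_D x)%:C * F x)).
  rewrite EFinM (sqnorm_toL2_mkcond mF F2).
  by under eq_eseriesr do rewrite (ip_mkcond F2).
(* If the coefficients are not square summable, Bessel's inequality excludes a finite right-hand
   side, and both sides are infinite. *)
have [aoo|aoo] := ltP (\sum_(0 <= j <oo) (normc (a j) ^+ 2)%:E)%E +oo%E; last first.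
  have [F2|F2] := ltP (\int[mu]_(x in D) (normc (F x) ^+ 2)%:E)%E +oo%E.
    have h := le_trans aoo (bes F2); exfalso.
    have := lte_mul_pinfty (ltW (l2 : 0%:E < (2 * l)%:E)%E) isT F2.
    by rewrite ltNge h.
  rewrite (_ : (\sum_(0 <= j <oo) _)%E = +oo%E); last by apply/eqP; rewrite eq_le leey.
  rewrite (_ : (\int[mu]_(x in D) _)%E = +oo%E); last by apply/eqP; rewrite eq_le leey.
  by rewrite gt0_muley // lte_fin.
have [g [gE SE]] : exists g : L2 R, (forall j, ipL2 g (e j) = a j) /\
    (\sum_(0 <= j <oo) (normc (a j) ^+ 2)%:E = (2 * l * sqnorm ipL2 g)%:E)%E.
  exact: (riesz_fischer ipL2_inner L2_complete l2 eo aoo).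
have mg : cmeasurable g by exact: L2_cmeasurable.
have g2 : (\int[mu]_(x in D) (normc (g x) ^+ 2)%:E <= (sqnorm ipL2 g)%:E)%E.
  rewrite sqnorm_L2E; apply: ge0_subset_integral => //.
  - by apply: cmeasurable_sqr_normc.
  - by move=> x _; rewrite lee_fin sqr_ge0.
have ig : cintble D g by apply: sqintegrable_cintble => //; apply: le_lt_trans g2 (ltry _).
have Fg : {ae mu, forall x, D x -> F x = g x}.
  have mFg : cmeasurable (fun x => -1 * g x + F x).
    by apply: cmeasurableD => //; apply: cmeasurableM => //; exact: cmeasurable_cst.
  have := fourier_coef_eq0 mFg (cintble_lin (-1) mD ig iF).
  have h k : fourier_coef (fun x => -1 * g x + F x) k = 0.
    rewrite /fourier_coef.
    have mc : measurable_fun setT (fun x : R => - (w * k%:~R * x)).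
      by apply: measurableT_comp => //; exact: measurable_funM.
    rewrite (_ : (fun _ => _) = (fun x => -1 * (g x * cis (- (w * k%:~R * x))) + F x * cis (- (w * k%:~R * x)))).
      rewrite cint_lin //; [|exact: cintble_cis|exact: cintble_cis].
      have [j jk] := int_enum_surj k; rewrite -jk.
      by rewrite -[cint D _]ip_expL2 -/(e j) gE /a /fourier_coef mulN1r addNr.
    by apply/funext => x; rewrite mulrDl mulrA.
  move=> /(_ h); apply: filterS => x gF Dx.
  by have := gF Dx; rewrite mulN1r addrC => /eqP; rewrite subr_eq0 => /eqP.
have E2 : (\int[mu]_(x in D) (normc (F x) ^+ 2)%:E = \int[mu]_(x in D) (normc (g x) ^+ 2)%:E)%E.
  apply: ge0_integral_ae_eq => //.
  - exact: cmeasurable_sqr_normc.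
  - exact: cmeasurable_sqr_normc.
  - by apply: filterS Fg => x h Dx; rewrite h.
have F2 : (\int[mu]_(x in D) (normc (F x) ^+ 2)%:E < +oo)%E.
  by rewrite E2; apply: le_lt_trans g2 (ltry _).
apply/eqP; rewrite eq_le bes //= SE [leRHS]EFinM; apply: lee_wpmul2l; first by rewrite lee_fin ltW.
by rewrite E2.
Qed.

End Parseval.

(** * The Fourier integral *)

Section ComplexFubini.
Context {R : realType}.
Local Notation mu := (@lebesgue_measure R).
Local Notation RR := (measurableTypeR R * measurableTypeR R)%type.
Implicit Types (G : R -> R -> R[i]).

Definition cmeasurable2 G :=
  measurable_fun [set: RR] (fun z => complex.Re (G z.1 z.2)) /\
  measurable_fun [set: RR] (fun z => complex.Im (G z.1 z.2)).

Lemma cmeasurable2M G K : cmeasurable2 G -> cmeasurable2 K ->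
  cmeasurable2 (fun x y => G x y * K x y).
Proof.
move=> [Gr Gi] [Kr Ki]; split.
- by under eq_fun do rewrite CReM; apply: measurable_funB; exact: measurable_funM.
- by under eq_fun do rewrite CImM; apply: measurable_funD; exact: measurable_funM.
Qed.

Lemma cmeasurable2_fst f : cmeasurable f -> cmeasurable2 (fun x _ => f x).
Proof. by move=> [fr fi]; split; [apply: (measurableT_comp fr)|apply: (measurableT_comp fi)]. Qed.

Lemma cmeasurable2_snd f : cmeasurable f -> cmeasurable2 (fun _ y => f y).
Proof. by move=> [fr fi]; split; [apply: (measurableT_comp fr)|apply: (measurableT_comp fi)]. Qed.

Lemma cmeasurable2_cis_mul : cmeasurable2 (fun x y => cis (- (x * y))).
Proof.
have m : measurable_fun [set: RR] (fun z : RR => - (z.1 * z.2)).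
  by apply: measurableT_comp => //; apply: measurable_funM.
split.
- exact: (measurableT_comp (continuous_measurable_fun (@continuous_cos R)) m).
- exact: (measurableT_comp (continuous_measurable_fun (@continuous_sin R)) m).
Qed.

Lemma measurable_Rintegral2 (g : R -> R -> R) :
  measurable_fun [set: RR] (fun z => g z.1 z.2) ->
  measurable_fun [set: R] (fun x => Rintegral mu setT (g x)).
Proof.
move=> mg; rewrite /Rintegral.
have mgE : measurable_fun [set: RR] (fun z => (g z.1 z.2)%:E) by exact/measurable_EFinP.
apply: measurableT_comp; first exact: fine_measurable.
under eq_fun do rewrite integralE.
apply: emeasurable_funB.
- have mp := measurable_funepos mgE.
  have p0 z : (0 <= (fun z : RR => (g z.1 z.2)%:E)^\+ z)%E by exact: funepos_ge0.
  have F : measurable_fun [set: measurableTypeR R] _ := @measurable_fun_fubini_tonelli_F _ _ (measurableTypeR R) (measurableTypeR R) R mu _ mp p0.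
  rewrite (_ : (fun x => _) = fubini_F mu (fun z : RR => (g z.1 z.2)%:E)^\+%E); first exact:  F.
  by apply/funext => x; apply: eq_integral => y _; rewrite !funeposE.
- have mp := measurable_funeneg mgE.
  have p0 z : (0 <= (fun z : RR => (g z.1 z.2)%:E)^\- z)%E by exact: funeneg_ge0.
  have F : measurable_fun [set: measurableTypeR R] _ := @measurable_fun_fubini_tonelli_F _ _ (measurableTypeR R) (measurableTypeR R) R mu _ mp p0.
  rewrite (_ : (fun x => _) = fubini_F mu (fun z : RR => (g z.1 z.2)%:E)^\-%E); first exact:  F.
  by apply/funext => x; apply: eq_integral => y _; rewrite !funenegE.
Qed.

Lemma cmeasurable_cint2 G : cmeasurable2 G -> cmeasurable (fun x => cint setT (G x)).
Proof. by move=> [Gr Gi]; split; [apply: measurable_Rintegral2 Gr|apply: measurable_Rintegral2 Gi]. Qed.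

(** Domination by a product at every point makes every section integrable, not just almost every
    one, so [fine] loses nothing in the inner integrals. *)
Lemma Rintegral_Fubini (g : R -> R -> R) (A B : R -> R) :
  measurable_fun [set: RR] (fun z => g z.1 z.2) ->
  (forall x, 0 <= A x) -> (forall x, 0 <= B x) ->
  mu.-integrable setT (EFin \o A) -> mu.-integrable setT (EFin \o B) ->
  (forall x y, `|g x y| <= A x * B y) ->
  Rintegral mu setT (fun x => Rintegral mu setT (g x)) =
  Rintegral mu setT (fun y => Rintegral mu setT (g^~ y)).
Proof.
move=> mg A0 B0 iA iB gAB.
have mgE : measurable_fun [set: RR] (fun z => (g z.1 z.2)%:E) by exact/measurable_EFinP.
have mA : measurable_fun [set: R] A by apply/measurable_EFinP; exact: (measurable_int _ iA).
have mB : measurable_fun [set: R] B by apply/measurable_EFinP; exact: (measurable_int _ iB).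
have m1 x : measurable_fun [set: measurableTypeR R] (g x) by exact: (measurableT_comp mg (pair1_measurable x)).
have m2 y : measurable_fun [set: measurableTypeR R] (g^~ y) by exact: (measurableT_comp mg (pair2_measurable y)).
have i1 x : mu.-integrable setT (fun y => (g x y)%:E).
  apply: le_integrable (integrable_Zl (A x) measurableT iB) => //.
    exact/measurable_EFinP.
  by move=> y _; rewrite /= lee_fin (le_trans (gAB x y)) // ler_norm.
have i2 y : mu.-integrable setT (fun x => (g x y)%:E).
  apply: le_integrable (integrable_Zl (B y) measurableT iA) => //.
    exact/measurable_EFinP.
  by move=> x _; rewrite /= lee_fin (le_trans (gAB x y)) // mulrC ler_norm.
have ig : (mu \x mu)%E.-integrable [set: RR] (fun z => (g z.1 z.2)%:E).
  apply/integrable12ltyP => //=.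
  apply: (@le_lt_trans _ _ (\int[mu]_x ((A x)%:E * \int[mu]_y (B y)%:E))%E).
    apply: ge0_le_integral => //.
    - by move=> x _; apply: integral_ge0.
    - have mab : measurable_fun [set: RR] (fun z => `|(g z.1 z.2)%:E|%E) by exact: measurableT_comp.
      apply: (@measurable_fun_fubini_tonelli_F _ _ (measurableTypeR R) (measurableTypeR R) R mu (fun z => `|(g z.1 z.2)%:E|%E)) => //.
    - by apply: emeasurable_funM => //; exact/measurable_EFinP.
    - move=> x _; rewrite -ge0_integralZl ?lee_fin //.
      + apply: ge0_le_integral => //.
        * by apply/measurable_EFinP; exact: measurableT_comp.
        * by apply: emeasurable_funM => //; exact/measurable_EFinP.
        * by move=> y _; rewrite -EFinM lee_fin; exact: gAB.
      + exact/measurable_EFinP.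
      + by move=> y _; rewrite lee_fin.
  rewrite ge0_integralZr //; last 3 first.
  - exact/measurable_EFinP.
  - by move=> x _; rewrite lee_fin.
  - by apply: integral_ge0 => y _; rewrite lee_fin.
  apply: lte_mul_pinfty; first by apply: integral_ge0 => y _; rewrite lee_fin.
    by have := integrable_fin_num measurableT iA.
  by have := integrable_fin_num measurableT iB; rewrite ge0_fin_numE //; apply: integral_ge0 => y _; rewrite lee_fin.
have E1 : (\int[mu]_x (Rintegral mu setT (g x))%:E = \int[mu]_x \int[mu]_y (g x y)%:E)%E.
  by apply: eq_integral => x _; rewrite fineK //; exact: integrable_fin_num.
have E2 : (\int[mu]_y (Rintegral mu setT (g^~ y))%:E = \int[mu]_y \int[mu]_x (g x y)%:E)%E.
  by apply: eq_integral => y _; rewrite fineK //; exact: integrable_fin_num.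
by rewrite {1}/Rintegral [RHS]/Rintegral E1 E2 (Fubini ig).
Qed.

Lemma cint_Fubini G (A B : R -> R) : cmeasurable2 G ->
  (forall x, 0 <= A x) -> (forall x, 0 <= B x) ->
  mu.-integrable setT (EFin \o A) -> mu.-integrable setT (EFin \o B) ->
  (forall x y, `|complex.Re (G x y)| <= A x * B y /\ `|complex.Im (G x y)| <= A x * B y) ->
  cint setT (fun x => cint setT (G x)) = cint setT (fun y => cint setT (G^~ y)).
Proof.
move=> [Gr Gi] A0 B0 iA iB GAB; apply: complexP => /=.
- by apply: (Rintegral_Fubini Gr A0 B0) => // x y; exact: (GAB x y).1.
- by apply: (Rintegral_Fubini Gi A0 B0) => // x y; exact: (GAB x y).2.
Qed.

End ComplexFubini.

(** * The Fourier integral and Plancherel's theorem on an interval *)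

Section FourierIntegral.
Context {R : realType}.
Local Notation mu := (@lebesgue_measure R).
Implicit Types f g h : R -> R[i].

Lemma cintble_mul_cis f (a : R -> R) : cmeasurable f -> cintble setT f ->
  measurable_fun setT a -> cintble setT (fun x => f x * cis (a x)).
Proof.
move=> mF [Fr Fi] mh.
apply: (@cintble_dominated _ setT _ (fun x => `|complex.Re (f x)| + `|complex.Im (f x)|)) => //.
- by apply: cmeasurableM => //; exact: cmeasurable_cis.
- by apply: integrable_D => //; [exact: integrable_abse Fr|exact: integrable_abse Fi].
- move=> x; rewrite !CReImE /=.
  have := (cos_geN1 (a x), cos_le1 (a x)); have := (sin_geN1 (a x), sin_le1 (a x)).
  move=> [s1 s2] [c1 c2].
  have hs : `|sin (a x)| <= 1 by rewrite ler_norml s1.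
  have hc : `|cos (a x)| <= 1 by rewrite ler_norml c1.
  split; (apply: le_trans (ler_normB _ _) _ || apply: le_trans (ler_normD _ _) _);
  by rewrite !normrM; apply: lerD || (rewrite addrC; apply: lerD);
    rewrite -[leRHS]mulr1; apply: ler_wpM2l.
Qed.

Lemma cmeasurable_fourier_integral f : cmeasurable f -> cmeasurable (fourier_integral f).
Proof.
move=> mf; apply: (@cmeasurable_cint2 _ (fun xi x => f x * cis (- (xi * x)))).
by apply: cmeasurable2M; [exact: cmeasurable2_snd|exact: cmeasurable2_cis_mul].
Qed.

Lemma fourier_integral_lin (a : R[i]) f g (xi : R) : cmeasurable f -> cmeasurable g ->
  cintble setT f -> cintble setT g ->
  fourier_integral (fun x => a * f x + g x) xi =
  a * fourier_integral f xi + fourier_integral g xi.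
Proof.
move=> mf mg fi gi.
have mc : measurable_fun setT (fun x : R => - (xi * x)).
  by apply: measurableT_comp => //; exact: measurable_funM.
rewrite /fourier_integral -[cintegral (fun x => f x * _)]/(cint setT _) -[cintegral (fun x => g x * _)]/(cint setT _).
rewrite -cint_lin //; [|exact: cintble_mul_cis|exact: cintble_mul_cis].
by congr cint; apply/funext => x; rewrite mulrDl mulrA.
Qed.

Lemma eq_fourier_integral f g (xi : R) : cmeasurable f -> cmeasurable g ->
  {ae mu, forall x, f x = g x} -> fourier_integral f xi = fourier_integral g xi.
Proof.
move=> mf mg fg; apply: eq_cint_ae => //.
- by apply: cmeasurableM => //; apply: cmeasurable_cis; apply: measurableT_comp => //; exact: measurable_funM.
- by apply: cmeasurableM => //; apply: cmeasurable_cis; apply: measurableT_comp => //; exact: measurable_funM.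
- by apply: filterS fg => x ->.
Qed.

(** Tiling the frequency line by cells of length [w = pi / l] groups the samples at [xi + w * k],
    which are the Fourier coefficients of [f x * cis (- (xi * x))]. Their square sum does not depend
    on [xi], so integrating over a cell multiplies it by [w], and [w * (2 * l) = 2 * pi]. *)
Lemma plancherel_itv f (l : R) : 0 < l -> cmeasurable f ->
  (\int[mu]_(x in [set` `[- l, l]%R]) (normc (f x) ^+ 2)%:E < +oo)%E ->
  (\int[mu]_xi (normc (fourier_integral (fun x => (\1_[set` `[- l, l]%R] x)%:C * f x) xi) ^+ 2)%:E =
    (2 * pi)%:E * \int[mu]_(x in [set` `[- l, l]%R]) (normc (f x) ^+ 2)%:E)%E.
Proof.
move=> l0 mf f2; set D := [set` `[- l, l]]; pose w := pi / l.
have w0 : 0 < w by rewrite divr_gt0 // pi_gt0.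
have mD : measurable (D : set (measurableTypeR R)) by exact: measurable_itv.
have md : cmeasurable (fun x => (\1_D x)%:C * f x) by exact: cmeasurable_indic.
have fD := sqintegrable_cintble l0 mf f2.
rewrite (ge0_integral_tile 0 w0); last 2 first.
- by apply: cmeasurable_sqr_normc; exact: cmeasurable_fourier_integral.
- by move=> xi; rewrite lee_fin sqr_ge0.
have E (xi : R) : (\esum_(k in [set: int])
  (normc (fourier_integral (fun x => (\1_D x)%:C * f x) (xi + w * k%:~R)%R) ^+ 2)%:E =
  (2 * l)%:E * \int[mu]_(x in D) (normc (f x) ^+ 2)%:E)%E.
  have mc : measurable_fun setT (fun x : R => - (xi * x)).
    by apply: measurableT_comp => //; exact: measurable_funM.
  rewrite (_ : \int[mu]_(x in D) _ = \int[mu]_(x in D) (normc (f x * cis (- (xi * x))) ^+ 2)%:E)%E; last first.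
    by apply: eq_integral => x _; rewrite sqr_normcM sqr_normc_cis mulr1.
  rewrite -(parseval l0); last 2 first.
  - by apply: cmeasurableM => //; exact: cmeasurable_cis.
  - exact: cintble_cis.
  apply: eq_esum => k _; congr ((normc _ ^+ 2)%:E).
  rewrite /fourier_coef cint_mkcond /fourier_integral.
  congr cint; apply/funext => x; rewrite -!mulrA -cisD; congr (_ * (_ * cis _)).
  by rewrite /w; ring.
under eq_integral do rewrite E.
rewrite integral_cst //= add0r.
rewrite (_ : lebesgue_measure _ = w%:E); last first.
  by rewrite lebesgue_measure_itv /= lte_fin w0 -EFinB subr0.
rewrite muleC muleA -EFinM; congr (_%:E * _)%E.
by rewrite /w; field; rewrite gt_eqF.
Qed.

End FourierIntegral.

(** * Vector-valued sequences *)

Opaque L2_add L2_opp L2_scale L2_zero toL2 classL2 reprL2 ipL2.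
Opaque ipell2 ell2_val toell2.

Section VectorValuedSequences.
Context {R : realType} {n : nat}.
Implicit Types x y : ell2n R n.
Local Notation ip := (@ipell2n R n).

Lemma ipell2n_inner : inner_product ip.
Proof. exact: (ip_fin_inner (@ipell2_inner R) n). Qed.

Lemma ell2n_complete : hcomplete ip.
Proof. exact: (ip_fin_complete (@ipell2_inner R) (@ell2_complete R)). Qed.

Lemma ipL2n_inner : inner_product (@ipL2n R n).
Proof. exact: (ip_fin_inner (@ipL2_inner R) n). Qed.

Lemma sqnorm_ell2n x : sqnorm ip x = \sum_(i < n) sqnorm ipell2 (x i).
Proof. exact: sqnorm_ip_fin. Qed.

Lemma sqnorm_L2n (f : L2n R n) : sqnorm (@ipL2n R n) f = \sum_(i < n) sqnorm ipL2 (f i).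
Proof. exact: sqnorm_ip_fin. Qed.

Lemma sqnorm_ell2nE x :
  ((sqnorm ip x)%:E = \sum_(i < n) \esum_(k in [set: int]) (normc (x i k) ^+ 2)%:E)%E.
Proof. by rewrite sqnorm_ell2n -sumEFin; apply: eq_bigr => i _; rewrite sqnorm_ell2E. Qed.

Lemma ell2n_ext x y : (forall i k, x i k = y i k) -> x = y.
Proof. by move=> xy; apply/ffunP => i; apply: ell2_ext => k; exact: xy. Qed.

Lemma ell2n_linE (c : R[i]) x y i k : (c *: x + y) i k = c * x i k + y i k.
Proof. by rewrite !ffunE ell2_linE. Qed.

Lemma ell2n_BE x y i k : (x - y) i k = x i k - y i k.
Proof. by rewrite !ffunE ell2_BE. Qed.

Lemma ell2n_DE x y i k : (x + y) i k = x i k + y i k.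
Proof. by rewrite -[x]scale1r ell2n_linE mul1r scale1r. Qed.

Lemma ell2n_0E i k : (0 : ell2n R n) i k = 0.
Proof. by rewrite -(subrr (0 : ell2n R n)) ell2n_BE subrr. Qed.

Lemma ell2n_ZE (c : R[i]) x i k : (c *: x) i k = c * x i k.
Proof. by rewrite -[c *: x]addr0 ell2n_linE ell2n_0E addr0. Qed.

Lemma ell2n_sumE (I : Type) (s : seq I) (P : pred I) (F : I -> ell2n R n) i k :
  (\sum_(j <- s | P j) F j) i k = \sum_(j <- s | P j) F j i k.
Proof. by elim/big_rec2: _ => [|j u v _ <-]; rewrite ?ell2n_0E ?ell2n_DE. Qed.

Lemma abs_sum_single (f : int -> R) k : (forall m, m != k -> f m = 0) ->
  abs_sum setT f = f k.
Proof.
move=> f0; have E (g : int -> R) : (forall m, 0 <= g m) -> (forall m, m != k -> g m = 0) ->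
    (\esum_(m in [set: int]) (g m)%:E = (g k)%:E)%E.
  move=> gp g0; rewrite -(@esum_set1 _ _ k (fun m => (g m)%:E)) ?lee_fin //.
  rewrite [RHS]esum_mkcond; apply: eq_esum => m _; case: ifPn => // /negP mk; rewrite g0 //.
  by apply/eqP => mk'; apply: mk; rewrite inE.
rewrite /abs_sum !E; [|exact: funrneg_ge0| |exact: funrpos_ge0|].
- by rewrite -[in RHS](funrposBneg f).
- by move=> m mk; rewrite /funrneg f0 // oppr0 maxxx.
- by move=> m mk; rewrite /funrpos f0 // maxxx.
Qed.

Lemma ipell2n_delta x k j : ip x (delta k j) = x j k.
Proof.
rewrite /ipell2n (bigD1 j) //= big1 ?addr0 => [|i ij]; last first.
  by rewrite /delta ffunE (negbTE ij) (ip0r ipell2_inner).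
rewrite ipell2E; apply: complexP; rewrite /= (@abs_sum_single _ k).
- by rewrite deltaE !eqxx !CReImE /= mulr1 oppr0 mulr0 subr0.
- by move=> m mk; rewrite deltaE (negbTE mk) andbF !CReImE /= oppr0 !mulr0 subr0.
- by rewrite deltaE !eqxx !CReImE /= mulr1 oppr0 mulr0 add0r.
- by move=> m mk; rewrite deltaE (negbTE mk) andbF !CReImE /= oppr0 !mulr0 add0r.
Qed.

Lemma int_shift_bij (s : int) : set_bij [set: int] [set: int] (fun k => k - s).
Proof.
split; first by [].
- by move=> k k' _ _; exact: addIr.
- by move=> k _; exists (k + s) => //; rewrite addrK.
Qed.

Lemma esum_int_shift (s : int) (a : int -> \bar R) :
  (\esum_(k in [set: int]) a (k - s)%R = \esum_(k in [set: int]) a k)%E.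
Proof. by rewrite -(reindex_esum setT setT _ a (int_shift_bij s)). Qed.

Lemma csum_int_shift (s : int) (f : int -> R[i]) :
  csum setT (fun k => f (k - s)) = csum setT f.
Proof.
have E (g : int -> R) : abs_sum setT (fun k => g (k - s)) = abs_sum setT g.
  rewrite /abs_sum -(esum_int_shift s (fun k => (g^\+ k)%:E)).
  by rewrite -(esum_int_shift s (fun k => (g^\- k)%:E)).
by apply: complexP; rewrite /= -[RHS]E.
Qed.

Lemma lamE (s : int) x i k : lam s x i k = x i (k - s).
Proof.
rewrite /lam ffunE toell2E // /sqsummable.
by rewrite (esum_int_shift s (fun k => (normc (x i k) ^+ 2)%:E)); exact: ell2P.
Qed.

Lemma ip_lam (s : int) x y : ip (lam s x) y = ip x (lam (- s) y).
Proof.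
apply: eq_bigr => i _; rewrite !ipell2E -[RHS](csum_int_shift s).
by apply: eq_csum => k _; rewrite !lamE opprK subrK.
Qed.

Lemma lamK (s : int) x : lam s (lam (- s) x) = x.
Proof. by apply: ell2n_ext => i k; rewrite !lamE opprK subrK. Qed.

Lemma lamNK (s : int) x : lam (- s) (lam s x) = x.
Proof. by apply: ell2n_ext => i k; rewrite !lamE opprK addrK. Qed.

Lemma lam_lin (s : int) (c : R[i]) x y : lam s (c *: x + y) = c *: lam s x + lam s y.
Proof. by apply: ell2n_ext => i k; rewrite ell2n_linE !lamE ell2n_linE. Qed.

Lemma sqnorm_lam (s : int) x : sqnorm ip (lam s x) = sqnorm ip x.
Proof. by rewrite /sqnorm ip_lam lamNK. Qed.

Lemma lam_delta (s k : int) (j : 'I_n) : lam s (@delta R n k j) = delta (k + s) j.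
Proof. by apply: ell2n_ext => i m; rewrite lamE !deltaE -subr_eq. Qed.

(** The shift is unitary, and the vector chosen in [adjoint] is unique because the form is
    definite. *)
Lemma adjoint_lam (s : int) x : adjoint ip (lam s) x = lam (- s) x.
Proof.
rewrite /adjoint; case: xgetP => [y _ h|/(_ (lam (- s) x)) []]; last by move=> w; exact: ip_lam.
apply/eqP; rewrite -subr_eq0; apply/eqP; apply: (sqnorm_eq0 ipell2n_inner).
by rewrite /sqnorm (ipDr ipell2n_inner) (ipNr ipell2n_inner) -ip_lam h subrr.
Qed.

Lemma oproj_lam (s : int) (V W : set (ell2n R n)) x :
  closed_subspace ip V -> closed_subspace ip W -> W = lam (- s) @` V ->
  oproj ip W (lam (- s) x) = lam (- s) (oproj ip V x).
Proof.
move=> cV cW WE; apply: (oproj_unique ipell2n_inner ell2n_complete cW).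
  by rewrite WE; exists (oproj ip V x) => //; exact: (oproj_in ipell2n_inner ell2n_complete).
move=> v; rewrite WE => -[w Vw <-].
rewrite !ip_lam opprK lamK.
by rewrite (ip_oproj ipell2n_inner ell2n_complete).
Qed.

(** Finite combinations of the [delta] vectors that tend to [x]; through them an identity known on
    these vectors reaches all of l^2. *)
Definition head_part (m : nat) x : ell2n R n :=
  \sum_(i < n) \sum_(j < m) x i (int_enum j) *: delta (int_enum j) i.

Lemma head_partE (m : nat) x i (j : nat) :
  head_part m x i (int_enum j) = if (j < m)%N then x i (int_enum j) else 0.
Proof.
rewrite /head_part ell2n_sumE (bigD1 i) //= [X in _ + X]big1 ?addr0; last first.
  move=> i' ii'; rewrite ell2n_sumE big1 // => j' _.
  by rewrite ell2n_ZE deltaE eq_sym (negbTE ii') mulr0.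
rewrite ell2n_sumE; have [jm|mj] := ltnP j m.
  rewrite (bigD1 (Ordinal jm)) //= big1 ?addr0.
    by rewrite ell2n_ZE deltaE !eqxx mulr1.
  move=> j' jj'; rewrite ell2n_ZE deltaE eqxx /= (_ : _ == _ = false) ?mulr0 //.
  apply: contra_neqF jj' => /eqP e; apply: val_inj => /=.
  by have [_ inj _] := int_enum_bij; apply/esym/inj; rewrite ?in_setT.
rewrite big1 // => j' _; rewrite ell2n_ZE deltaE eqxx /= (_ : _ == _ = false) ?mulr0 //.
apply/negP => /eqP e; have [_ inj _] := int_enum_bij.
have : j = j' by apply: inj; rewrite ?in_setT.
by move=> jj; have := ltn_ord j'; rewrite -jj ltnNge mj.
Qed.

Lemma head_part_cvg x : sqnorm ip (head_part m x - x) @[m --> \oo] --> (0 : R).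
Proof.
have -> : (fun m => sqnorm ip (head_part m x - x)) =
    (fun m => \sum_(i < n) sqnorm ipell2 (head_part m x i - x i)).
  by apply/funext => m; rewrite sqnorm_ell2n; apply: eq_bigr => i _; rewrite !ffunE.
rewrite [X in _ --> X](_ : _ = \sum_(i < n) 0); last by rewrite big1.
apply: cvg_big => [|i _]; first exact: add_continuous.
pose c j := (normc (x i (int_enum j)) ^+ 2)%:E.
have c0 j : (0 <= c j)%E by rewrite lee_fin sqr_ge0.
have fin : (\sum_(0 <= j <oo) c j < +oo)%E.
  have := ell2P (x i); rewrite /sqsummable esum_int // => k.
  by rewrite lee_fin sqr_ge0.
have tl m : ((sqnorm ipell2 (head_part m x i - x i))%:E = \sum_(m <= j <oo) c j)%E.
  rewrite sqnorm_ell2E esum_int; last by move=> k; rewrite lee_fin sqr_ge0.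
  rewrite (nneseries_split 0 m) //; last by move=> j _; rewrite lee_fin sqr_ge0.
  rewrite add0n big_nat big1 ?add0e => [|j /andP[_ jm]].
    rewrite -nneseries_addn; last by move=> j; rewrite lee_fin sqr_ge0.
    rewrite -[RHS]nneseries_addn //.
    apply: eq_eseriesr => j _; congr (_%:E).
    by rewrite ell2_BE head_partE ltnNge leq_addl sub0r /c sqr_normcN.
  by rewrite ell2_BE head_partE jm subrr /= expr0n /= addr0 sqrtr0 expr0n.
have := nneseries_tail_cvg fin (fun j _ => c0 j).
move=> /fine_cvgP[_]; rewrite (_ : fine \o _ = fun m => sqnorm ipell2 (head_part m x i - x i)) //.
by apply/funext => m; rewrite /= -tl.
Qed.

End VectorValuedSequences.

(** * The Fourier transform on L^2(R) *)

(** By polarization. It serves the Fourier transform with [c = 2 * pi] and the weighted compositions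
    with [c = 1]. *)
Lemma isometry_ip {R : realType} {H K : lmodType R[i]} (ipH : H -> H -> R[i])
    (ipK : K -> K -> R[i]) (F : H -> K) (c : R) :
  inner_product ipH -> inner_product ipK -> {morph F : x y / x + y} ->
  (forall (a : R[i]) x, F (a *: x) = a *: F x) ->
  (forall x, sqnorm ipK (F x) = c * sqnorm ipH x) ->
  forall x y, ipK (F x) (F y) = c%:C * ipH x y.
Proof.
move=> hH hK FD FZ Fs x y.
have FB u v : F (u - v) = F u - F v by rewrite FD -scaleN1r FZ scaleN1r.
rewrite (polarization hK) (polarization hH) -!FZ -!FD -!FB !Fs.
by apply: complexP; rewrite !CReImE /=; field.
Qed.

Opaque sqnorm.

Section Truncation.
Context {R : realType}.
Local Notation mu := (@lebesgue_measure R).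
Implicit Types f g h : L2 R.

(** The half-length is [m.+1] rather than [m] because Parseval's identity on [-l,l] requires
    [0 < l]. *)
Definition window (m : nat) : set R := [set` `[- m.+1%:R, m.+1%:R]].

Lemma measurable_window m : measurable (window m : set (measurableTypeR R)).
Proof. exact: measurable_itv. Qed.

Lemma window_near (x : R) : \forall m \near \oo, window m x.
Proof.
exists (Num.truncn `|x|) => // m /= hm; rewrite /window /= in_itv /= -ler_norml.
by apply: le_trans (ltW (truncnS_gt _)) _; rewrite ler_nat ltnS.
Qed.

Lemma cvg_Rintegral_window (g : R -> R) : mu.-integrable setT (EFin \o g) ->
  Rintegral mu setT (fun x => \1_(window m) x * g x) @[m --> \oo] --> Rintegral mu setT g.
Proof.
move=> ig.
have mg : measurable_fun setT g by apply/measurable_EFinP; exact: (measurable_int _ ig).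
have mm m : measurable_fun [set: measurableTypeR R] (fun x => (\1_(window m) x * g x)%:E).
  by apply/measurable_EFinP; apply: measurable_funM => //; apply: measurable_indic; exact: measurable_window.
have ib x m : `|\1_(window m) x * g x| <= `|g x|.
  by rewrite normrM indicE; case: (_ \in _); rewrite ?normr1 ?mul1r ?normr0 ?mul0r.
have [||||ig' _ h] := @dominated_convergence _ _ _ mu setT measurableT
  (fun m x => (\1_(window m) x * g x)%:E) (EFin \o g) (fun x => `|(g x)%:E|%E) mm.
- exact: measurable_int ig.
- apply: aeW => x _; apply: cvg_EFin; first exact: nearW.
  apply: cvg_near_cst; apply: filterS (window_near x) => m wx.
  by rewrite /= indicE mem_set // mul1r.
- exact: integrable_abse.
- by apply: aeW => x m _; rewrite abse_EFin lee_fin.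
apply: fine_cvg; rewrite fineK //; exact: integrable_fin_num.
Qed.

Definition trunc (m : nat) f : L2 R := toL2 (fun x => (\1_(window m) x)%:C * f x).

Lemma window_sq_lty m f : (\int[mu]_(x in window m) (normc (f x) ^+ 2)%:E < +oo)%E.
Proof.
apply: le_lt_trans (ltry (sqnorm ipL2 f)); rewrite sqnorm_L2E.
apply: ge0_subset_integral => //; first exact: measurable_window.
  by apply: cmeasurable_sqr_normc; exact: L2_cmeasurable.
by move=> x _; rewrite lee_fin sqr_ge0.
Qed.

Lemma sqintegrable_window m f : sqintegrable (fun x => (\1_(window m) x)%:C * f x).
Proof. by apply: sqintegrable_mkcond; [exact: L2_cmeasurable|exact: window_sq_lty]. Qed.

Lemma truncE m f : {ae mu, forall x, trunc m f x = (\1_(window m) x)%:C * f x}.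
Proof. by apply: toL2E; exact: sqintegrable_window. Qed.

Lemma cintble_mkcond (D : set R) (f : R -> R[i]) : measurable (D : set (measurableTypeR R)) ->
  cintble D f -> cintble setT (fun x => (\1_D x)%:C * f x).
Proof.
move=> mD [fr fi].
have e (g : R -> R) x : (((fun x => (g x)%:E) \_ D) x = (\1_D x * g x)%:E)%E.
  by rewrite patchE indicE; case: ifPn; rewrite ?mul1r ?mul0r.
split.
- move/(integrable_mkcond _ mD): fr; apply: eq_integrable => // x _.
  by rewrite e CReM CReC CImC mul0r subr0.
- move/(integrable_mkcond _ mD): fi; apply: eq_integrable => // x _.
  by rewrite e CImM CReC CImC mul0r addr0.
Qed.

Lemma cintble_ae (D : set R) (f g : R -> R[i]) : measurable (D : set (measurableTypeR R)) ->
  cmeasurable f -> cmeasurable g -> {ae mu, forall x, f x = g x} ->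
  cintble D f -> cintble D g.
Proof.
move=> mD [fr fi] [gr gi] fg [ir ii]; have h (u v : R -> R) : measurable_fun [set: R] u -> measurable_fun [set: R] v ->
    {ae mu, forall x, u x = v x} -> mu.-integrable D (fun x => (u x)%:E) ->
    mu.-integrable D (fun x => (v x)%:E).
  move=> mu_ mv uv /integrableP[_ u1]; apply/integrableP.
  have mE k : measurable_fun [set: R] k -> measurable_fun D (fun x : measurableTypeR R => (k x)%:E).
    by move=> mk; apply: measurable_funTS; exact/measurable_EFinP.
  split; first exact: mE.
  rewrite (_ : (\int[mu]_(x in D) `|(v x)%:E| = \int[mu]_(x in D) `|(u x)%:E|)%E) //.
  apply: ae_eq_integral => //.
  - by apply: measurableT_comp => //; exact: mE.
  - by apply: measurableT_comp => //; exact: mE.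
  - by apply: filterS uv => x -> _.
split.
- by apply: (h _ _ fr gr _ ir); apply: filterS fg => x ->.
- by apply: (h _ _ fi gi _ ii); apply: filterS fg => x ->.
Qed.

Lemma cintegrable_trunc m f : cintegrable (trunc m f).
Proof.
apply: (@cintble_ae setT (fun x => (\1_(window m) x)%:C * f x)) => //.
- by have [] := sqintegrable_window m f.
- exact: L2_cmeasurable.
- by apply: filterS (truncE m f) => x ->.
- apply: cintble_mkcond; first exact: measurable_window.
  by apply: sqintegrable_cintble => //; [exact: L2_cmeasurable|exact: window_sq_lty].
Qed.

Lemma trunc_cvg f : sqnorm ipL2 (trunc m f - f) @[m --> \oo] --> (0 : R).
Proof.
pose g x := normc (f x) ^+ 2.
have ig : mu.-integrable setT (EFin \o g) by exact: sqintegrable_norm (L2P f).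
have h := cvg_Rintegral_window ig.
rewrite -(subrr (Rintegral mu setT g)).
have -> : (fun m => sqnorm ipL2 (trunc m f - f)) =
    (fun m => Rintegral mu setT g - Rintegral mu setT (fun x => \1_(window m) x * g x)).
  apply/funext => m.
  have mwg : measurable_fun setT (fun x => \1_(window m) x * g x).
    apply: measurable_funM; first by apply: measurable_indic; exact: measurable_window.
    by apply/measurable_EFinP; exact: measurable_int ig.
  have iw : mu.-integrable setT (EFin \o (fun x => \1_(window m) x * g x)).
    apply: le_integrable ig => //; first exact/measurable_EFinP.
    move=> x _ /=; rewrite lee_fin normrM indicE.
    by case: (_ \in _); rewrite ?normr1 ?mul1r ?normr0 ?mul0r.
  rewrite -RintegralB //; apply: EFin_inj; rewrite sqnorm_L2E.
  rewrite fineK; last by apply: integrable_fin_num => //; exact: integrable_B.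
  apply: ge0_integral_ae_eq => //.
  - by apply: cmeasurable_sqr_normc; exact: L2_cmeasurable.
  - apply/measurable_EFinP; apply: measurable_funB => //.
    by apply/measurable_EFinP; exact: measurable_int ig.
  - apply: filterS2 (L2BE (trunc m f) f) (truncE m f) => x -> -> _.
    rewrite /g indicE; case: (_ \in _); rewrite ?mul1r ?subrr.
      by rewrite sqr_normcE /= expr0n /= addr0.
    by rewrite !mul0r sub0r subr0 sqr_normcN.
by apply: cvgB => //; exact: cvg_cst.
Qed.

End Truncation.

Opaque trunc.

Section FourierL2.
Context {R : realType}.
Local Notation mu := (@lebesgue_measure R).
Implicit Types f g h : L2 R.
Local Notation sqn := (sqnorm (@ipL2 R)).

Lemma fourier_integral_trunc m f xi : fourier_integral (trunc m f) xi =
  fourier_integral (fun x => (\1_(window m) x)%:C * f x) xi.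
Proof.
apply: eq_fourier_integral; first exact: L2_cmeasurable.
  by have [] := sqintegrable_window m f.
exact: truncE.
Qed.

Lemma plancherel_trunc m f :
  (\int[mu]_xi (normc (fourier_integral (trunc m f) xi) ^+ 2)%:E =
   (2 * pi * sqn (trunc m f))%:E)%E.
Proof.
have m0 : 0 < m.+1%:R :> R by rewrite ltr0n.
under eq_integral do rewrite fourier_integral_trunc.
rewrite (plancherel_itv m0) ?window_sq_lty //; last exact: L2_cmeasurable.
rewrite [RHS]EFinM; congr (_ * _)%E.
by rewrite -sqnorm_toL2_mkcond //; [exact: L2_cmeasurable|exact: window_sq_lty].
Qed.

Lemma cvg_fourier_integral_trunc f xi : cintegrable f ->
  complex.Re (fourier_integral (trunc m f) xi) @[m --> \oo] --> complex.Re (fourier_integral f xi) /\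
  complex.Im (fourier_integral (trunc m f) xi) @[m --> \oo] --> complex.Im (fourier_integral f xi).
Proof.
move=> fi.
have mc : measurable_fun setT (fun x : R => - (xi * x)).
  by apply: measurableT_comp => //; exact: measurable_funM.
have [ir ii] := cintble_mul_cis (L2_cmeasurable f) fi mc.
split.
- under eq_cvg do rewrite fourier_integral_trunc /=.
  have := cvg_Rintegral_window ir; apply: cvg_trans; apply: near_eq_cvg; near=> m.
  by apply: eq_Rintegral => x _; rewrite -mulrA (CReM (_ %:C)) CReC CImC mul0r subr0.
- under eq_cvg do rewrite fourier_integral_trunc /=.
  have := cvg_Rintegral_window ii; apply: cvg_trans; apply: near_eq_cvg; near=> m.
  by apply: eq_Rintegral => x _; rewrite -mulrA (CImM (_ %:C)) CReC CImC mul0r addr0.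
Unshelve. all: by end_near. Qed.

(** The transforms of the truncations converge pointwise for integrable [f], and Fatou's lemma then
    gives an inequality. It is enough to place the transform in L^2 and to make it Lipschitz;
    equality follows in [sqnorm_fourier]. *)
Lemma plancherel_le f : cintegrable f ->
  (\int[mu]_xi (normc (fourier_integral f xi) ^+ 2)%:E <= (2 * pi * sqn f)%:E)%E.
Proof.
move=> fi.
pose F m xi := (normc (fourier_integral (trunc m f) xi) ^+ 2)%:E.
have mF m : measurable_fun setT (F m).
  by apply: cmeasurable_sqr_normc; apply: cmeasurable_fourier_integral; exact: L2_cmeasurable.
have F0 m xi : setT xi -> (0 <= F m xi)%E by move=> _; rewrite lee_fin sqr_ge0.
have -> : (\int[mu]_xi (normc (fourier_integral f xi) ^+ 2)%:E = \int[mu]_xi limn_einf (F^~ xi))%E.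
  apply: eq_integral => xi _.
  suff /cvg_limn_einf_sup[-> _] : F^~ xi @ \oo --> (normc (fourier_integral f xi) ^+ 2)%:E by [].
  apply: cvg_EFin; first exact: nearW.
  have [hr hi] := cvg_fourier_integral_trunc xi fi.
  rewrite (_ : fine \o F^~ xi = fun m => complex.Re (fourier_integral (trunc m f) xi) ^+ 2 +
      complex.Im (fourier_integral (trunc m f) xi) ^+ 2); last first.
    by apply/funext => m; exact: sqr_normcE.
  by rewrite sqr_normcE; apply: cvgD; [exact: (cvgM hr hr)|exact: (cvgM hi hi)].
apply: le_trans (@fatou _ _ _ mu setT measurableT F mF F0) _.
have h : (2 * pi * sqn (trunc m f))%:E @[m --> \oo] --> (2 * pi * sqn f)%:E.
  apply: cvg_EFin; first exact: nearW.
  by apply: cvgMr; apply: (cvg_sqnorm (@ipL2_inner R)); exact: trunc_cvg.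
have [<- _] := cvg_limn_einf_sup h.
rewrite le_eqVlt; apply/orP; left; apply/eqP; congr limn_einf.
by apply/funext => m; exact: plancherel_trunc.
Qed.

(** The transform on the intersection of L^1 and L^2; [toL2] is guaranteed not to fall back on its
    default only for [cintegrable f]. *)
Definition FL f : L2 R := toL2 (fourier_integral f).

Lemma sqintegrable_fourier_integral f : cintegrable f -> sqintegrable (fourier_integral f).
Proof.
move=> fi; have [mr mi] := cmeasurable_fourier_integral (L2_cmeasurable f).
by split => //; apply: le_lt_trans (plancherel_le fi) (ltry _).
Qed.

Lemma FLE f : cintegrable f -> {ae mu, forall xi, FL f xi = fourier_integral f xi}.
Proof. by move=> fi; apply: toL2E; exact: sqintegrable_fourier_integral. Qed.

Lemma cintegrable_lin (a : R[i]) f g : cintegrable f -> cintegrable g ->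
  cintegrable (a *: f + g : L2 R).
Proof.
move=> fi gi; apply: (@cintble_ae _ setT (fun x => a * f x + g x)) => //.
- apply: cmeasurableD; last exact: L2_cmeasurable.
  by apply: cmeasurableM; [exact: cmeasurable_cst|exact: L2_cmeasurable].
- exact: L2_cmeasurable.
- by apply: filterS (L2linE a f g) => x ->.
- exact: cintble_lin.
Qed.

Lemma cintegrableB f g : cintegrable f -> cintegrable g -> cintegrable (f - g : L2 R).
Proof. by move=> fi gi; rewrite addrC -scaleN1r; exact: cintegrable_lin. Qed.

Lemma FL_lin (a : R[i]) f g : cintegrable f -> cintegrable g ->
  FL (a *: f + g) = a *: FL f + FL g.
Proof.
move=> fi gi; apply: L2_ext.
apply: filterS (filterI (FLE (cintegrable_lin a fi gi)) (filterI (L2linE a (FL f) (FL g)) (filterI (FLE fi) (FLE gi)))).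
move=> xi [e1 [e2 [e3 e4]]].
apply: (etrans e1); apply: (etrans _ (esym e2)).
apply: (etrans _ (esym (congr2 (fun u v => a * u + v) e3 e4))).
rewrite -fourier_integral_lin //; try exact: L2_cmeasurable.
apply: eq_fourier_integral; first exact: L2_cmeasurable.
  apply: cmeasurableD; last exact: L2_cmeasurable.
  by apply: cmeasurableM; [exact: cmeasurable_cst|exact: L2_cmeasurable].
exact: L2linE.
Qed.

Lemma FL_B f g : cintegrable f -> cintegrable g -> FL (f - g) = FL f - FL g.
Proof. by move=> fi gi; rewrite addrC -scaleN1r FL_lin // scaleN1r addrC. Qed.

Lemma sqnorm_FL_le f : cintegrable f -> sqn (FL f) <= 2 * pi * sqn f.
Proof.
move=> fi; rewrite -lee_fin sqnorm_toL2; first exact: plancherel_le.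
exact: sqintegrable_fourier_integral.
Qed.

Opaque FL.

(** In terms of [FL] both limits are limits in the norm of L^2. *)
Lemma is_fourierP f g : is_fourier f g <->
  forall h : nat -> L2 R, (forall m, cintegrable (h m)) ->
    sqn (h m - f) @[m --> \oo] --> (0 : R) -> sqn (FL (h m) - g) @[m --> \oo] --> (0 : R).
Proof.
have E h : cintegrable h -> (\int[mu]_xi (normc (fourier_integral h xi - g xi) ^+ 2)%:E = (sqn (FL h - g))%:E)%E.
  move=> hi; rewrite sqnorm_L2E; apply: ge0_integral_ae_eq => //.
  - apply: cmeasurable_sqr_normc; apply: cmeasurableD; last by apply: cmeasurableN; exact: L2_cmeasurable.
    by apply: cmeasurable_fourier_integral; exact: L2_cmeasurable.
  - by apply: cmeasurable_sqr_normc; exact: L2_cmeasurable.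
  - by apply: filterS2 (L2BE (FL h) g) (FLE hi) => x -> ->.
split=> H h hi hf.
- have := H h hi; move=> /(_ ((cvg_hnorm (@ipL2_inner R) h f).1 hf)).
  under eq_cvg do rewrite E //.
  by move/fine_cvg.
- have := H h hi ((cvg_hnorm (@ipL2_inner R) h f).2 hf).
  under [X in _ -> X]eq_cvg do rewrite E //.
  by move=> h0; apply: cvg_EFin => //; exact: nearW.
Qed.

Lemma fourier_exists f : exists g, is_fourier f g.
Proof.
have tc := trunc_cvg f.
have [g hg] : exists g : L2 R, sqn (FL (trunc m f) - g) @[m --> \oo] --> (0 : R).
  apply: (@L2_complete R (fun m => FL (trunc m f))) => e e0.
  (* Two truncations within d of [f] in squared norm are within 2 d + 2 d of each other, and the
     transform multiplies this by at most 2 pi; 8 pi d is then [e]. *)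
  have d0 : 0 < e / (8 * pi) by rewrite divr_gt0 // mulr_gt0 // pi_gt0.
  have /cvgrPdist_le/(_ _ d0)[N _ hN] := tc.
  exists N => m k Nm Nk; rewrite -FL_B; [|exact: cintegrable_trunc|exact: cintegrable_trunc].
  apply: le_trans (sqnorm_FL_le _) _; first by apply: cintegrableB; exact: cintegrable_trunc.
  have := sqnormB3 (@ipL2_inner R) (trunc m f) f (trunc k f).
  have hN' j : (N <= j)%N -> sqn (trunc j f - f) <= e / (8 * pi).
    by move=> /hN; rewrite /= sub0r normrN ger0_norm //; exact: (sqnorm_ge0 (@ipL2_inner R)).
  have := hN' _ Nm; have := hN' _ Nk.
  rewrite (sqnormBC (@ipL2_inner R) f) => h1 h2 h3.
  have p0 := pi_gt0 R.
  apply: (@le_trans _ _ (2 * pi * (4 * (e / (8 * pi))))).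
    rewrite ler_pM2l ?mulr_gt0 //; apply: le_trans h3 _.
    rewrite (_ : 4 * (e / (8 * pi)) = 2 * (e / (8 * pi)) + 2 * (e / (8 * pi))).
      exact: (lerD (ler_wpM2l (ler0n R 2) h2) (ler_wpM2l (ler0n R 2) h1)).
    by move: (e / (8 * pi)) => d; ring.
  have pn0 : 8 * pi != 0 :> R by apply: lt0r_neq0; rewrite mulr_gt0.
  rewrite (_ : 2 * pi * (4 * (e / (8 * pi))) = e / (8 * pi) * (8 * pi)); last by ring.
  by rewrite divfK.
exists g; apply/is_fourierP => h hi hf.
(* The transform being Lipschitz, an arbitrary integrable approximation [h] of [f] has the same
   limit of transforms as the truncations. *)
have h0 : 4 * pi * (2 * sqn (h m - f) + 2 * sqn (trunc m f - f)) + 2 * sqn (FL (trunc m f) - g) @[m --> \oo] --> (0 : R).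
  rewrite (_ : 0 = 4 * pi * (2 * 0 + 2 * 0) + 2 * 0); last by rewrite !(mulr0, addr0).
  apply: cvgD; last exact: cvgMr.
  by apply: cvgMr; apply: cvgD; exact: cvgMr.
apply: (@squeeze_cvgr _ _ _ _ (cst 0) _ _ _ _ (cvg_cst _) h0); near=> m.
have ci := cintegrable_trunc m f.
rewrite /cst sqnorm_ge0 /=; last exact: ipL2_inner.
apply: le_trans (sqnormB3 (@ipL2_inner R) _ (FL (trunc m f)) _) _; rewrite lerD2r.
rewrite -FL_B //.
apply: le_trans (ler_wpM2l _ (sqnorm_FL_le (cintegrableB (hi m) ci))) _ => //.
have := sqnormB3 (@ipL2_inner R) (h m) f (trunc m f).
rewrite (sqnormBC (@ipL2_inner R) f) => h3.
have p0 := pi_gt0 R.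
rewrite mulrA (_ : 2 * (2 * pi) = 4 * pi); last by ring.
by rewrite ler_pM2l ?mulr_gt0.
Unshelve. all: by end_near. Qed.

Lemma fourierP f : is_fourier f (fourier f).
Proof.
rewrite /fourier; case: xgetP => [g -> //|h].
by have [g /(h g)] := fourier_exists f.
Qed.

Lemma fourier_cvg (h : nat -> L2 R) f : (forall m, cintegrable (h m)) ->
  sqn (h m - f) @[m --> \oo] --> (0 : R) -> sqn (FL (h m) - fourier f) @[m --> \oo] --> (0 : R).
Proof.
move=> hi hf; have H := proj1 (is_fourierP f (fourier f)) (@fourierP f) h hi hf.
exact: H.
Qed.

Opaque fourier.

Lemma fourier_trunc_cvg f : sqn (FL (trunc m f) - fourier f) @[m --> \oo] --> (0 : R).
Proof. by apply: fourier_cvg; [move=> m; exact: cintegrable_trunc|exact: trunc_cvg]. Qed.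

(** The identity is exact for truncations, by Plancherel's theorem on intervals, and passes to the
    limit. *)
Lemma sqnorm_fourier f : sqn (fourier f) = 2 * pi * sqn f.
Proof.
have h1 := cvg_sqnorm (@ipL2_inner R) (fourier_trunc_cvg f).
have h2 : 2 * pi * sqn (trunc m f) @[m --> \oo] --> 2 * pi * sqn f.
  by apply: cvgMr; apply: (cvg_sqnorm (@ipL2_inner R)); exact: trunc_cvg.
have e m : sqn (FL (trunc m f)) = 2 * pi * sqn (trunc m f).
  apply: EFin_inj; rewrite -plancherel_trunc sqnorm_toL2 //.
  by apply: sqintegrable_fourier_integral; exact: cintegrable_trunc.
by move: h1; under eq_cvg do rewrite e; move=> h1; exact: (cvg_unique _ h1 h2).
Qed.

Lemma fourier_FL f : cintegrable f -> fourier f = FL f.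
Proof.
move=> fi.
have h : sqn (f - f) @[m --> \oo] --> (0 : R).
  rewrite subrr (sqnorm0 (@ipL2_inner R)).
  exact: cvg_cst.
apply/esym; apply: (hlim_unique (@ipL2_inner R) (u := fun=> FL f)).
  by rewrite subrr (sqnorm0 (@ipL2_inner R)); exact: cvg_cst.
exact: (@fourier_cvg (fun=> f) f (fun=> fi) h).
Qed.

Lemma sqnorm_cvg_lin (a : R[i]) (u v : nat -> L2 R) f g :
  sqn (u m - f) @[m --> \oo] --> (0 : R) -> sqn (v m - g) @[m --> \oo] --> (0 : R) ->
  sqn (a *: u m + v m - (a *: f + g)) @[m --> \oo] --> (0 : R).
Proof.
move=> uf vg.
have h0 : 2 * (normc a ^+ 2 * sqn (u m - f)) + 2 * sqn (v m - g) @[m --> \oo] --> (0 : R).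
  rewrite (_ : 0 = 2 * (normc a ^+ 2 * 0) + 2 * 0); last by rewrite !mulr0 addr0.
  by apply: cvgD; apply: cvgMr => //; exact: cvgMr.
apply: (@squeeze_cvgr _ _ _ _ (cst 0) _ _ _ _ (cvg_cst _) h0); near=> m.
rewrite /cst (sqnorm_ge0 (@ipL2_inner R)) opprD addrACA -scalerBr /=.
by rewrite -(sqnormZ (@ipL2_inner R)); exact: (sqnormD2 (@ipL2_inner R)).
Unshelve. all: by end_near. Qed.

Lemma fourier_lin (a : R[i]) f g : fourier (a *: f + g) = a *: fourier f + fourier g.
Proof.
have h1 := sqnorm_cvg_lin a (trunc_cvg f) (trunc_cvg g).
have h2 := sqnorm_cvg_lin a (fourier_trunc_cvg f) (fourier_trunc_cvg g).
have ci m : cintegrable (a *: trunc m f + trunc m g : L2 R).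
  by apply: cintegrable_lin; exact: cintegrable_trunc.
apply: (hlim_unique (@ipL2_inner R) _ h2).
have e m : FL (a *: trunc m f + trunc m g) = a *: FL (trunc m f) + FL (trunc m g).
  by rewrite FL_lin //; exact: cintegrable_trunc.
by have := fourier_cvg ci h1; under eq_cvg do rewrite e.
Qed.

Lemma fourierB f g : fourier (f - g) = fourier f - fourier g.
Proof. by rewrite addrC -scaleN1r fourier_lin scaleN1r addrC. Qed.

Lemma fourierD f g : fourier (f + g) = fourier f + fourier g.
Proof. by rewrite -{1}[f]scale1r fourier_lin scale1r. Qed.

Lemma fourierZ (a : R[i]) f : fourier (a *: f) = a *: fourier f.
Proof.
have f0 : fourier (0 : L2 R) = 0 by have := fourierB 0 0; rewrite !subrr.
by rewrite -[a *: f]addr0 fourier_lin f0 addr0.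
Qed.

Lemma ip_fourier f g : ipL2 (fourier f) (fourier g) = (2 * pi)%:C * ipL2 f g.
Proof. exact: (isometry_ip (@ipL2_inner R) (@ipL2_inner R) fourierD fourierZ sqnorm_fourier). Qed.

(** Truncations are integrable and dense, and the Lipschitz bounds make both maps continuous. *)
Lemma L2_operator_ext (A B : L2 R -> L2 R) (c : R) :
  (forall f g, sqn (A f - A g) <= c * sqn (f - g)) ->
  (forall f g, sqn (B f - B g) <= c * sqn (f - g)) ->
  (forall f, cintegrable f -> A f = B f) -> A =1 B.
Proof.
move=> hA hB AB f.
have h0 : c * sqn (trunc m f - f) @[m --> \oo] --> (0 : R).
  by rewrite -(mulr0 c); apply: cvgMr; exact: trunc_cvg.
apply: (hlim_unique (@ipL2_inner R) (u := fun m => A (trunc m f))).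
  apply: (@squeeze_cvgr _ _ _ _ (cst 0) _ _ _ _ (cvg_cst _) h0); near=> m.
  by rewrite /cst (sqnorm_ge0 (@ipL2_inner R)); exact: hA.
apply: (@squeeze_cvgr _ _ _ _ (cst 0) _ _ _ _ (cvg_cst _) h0); near=> m.
rewrite /cst (sqnorm_ge0 (@ipL2_inner R)) AB; last exact: cintegrable_trunc.
exact: hB.
Unshelve. all: by end_near. Qed.

End FourierL2.

(** * Translates and surjectivity of the Fourier transform *)

Lemma rotation_bound {R : realType} (c s p q : R) : c ^+ 2 + s ^+ 2 = 1 ->
  `|p * c - q * s| <= `|p| + `|q| /\ `|p * s + q * c| <= `|p| + `|q|.
Proof.
move=> cs.
have hc : `|c| <= 1 by rewrite ler_norml; apply/andP; split; nra.
have hs : `|s| <= 1 by rewrite ler_norml; apply/andP; split; nra.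
split.
- by apply: le_trans (ler_normB _ _) _; rewrite !normrM; apply: lerD; exact: ler_piMr.
- by apply: le_trans (ler_normD _ _) _; rewrite !normrM; apply: lerD; exact: ler_piMr.
Qed.

Section WeightedComposition.
Context {R : realType}.
Local Notation mu := (@lebesgue_measure R).
Local Notation sqn := (sqnorm (@ipL2 R)).
Implicit Types f g h : L2 R.

(** The last clause lets almost everywhere identities be composed with [t], so that the class of
    [f \o t] depends only on that of [f]. *)
Definition measure_preserving (t : R -> R) : Prop :=
  [/\ measurable_fun setT t,
      forall F : R -> \bar R, measurable_fun setT F -> (forall x, 0 <= F x)%E ->
        (\int[mu]_x F (t x) = \int[mu]_x F x)%E &
      forall P : R -> Prop, {ae mu, forall x, P x} -> {ae mu, forall x, P (t x)}].

Lemma measure_preserving_add (a : R) : measure_preserving (fun x => x + a).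
Proof.
split; first exact: measurable_funD.
- by move=> F mF F0; exact: ge0_integral_shift.
- by move=> P hP; exact: ae_shift.
Qed.

Lemma measure_preserving_opp : measure_preserving (fun x => - x).
Proof.
split; first exact: oppr_measurable.
- by move=> F mF F0; exact: ge0_integral_opp.
- by move=> P hP; exact: ae_opp.
Qed.

Lemma measure_preserving_id : measure_preserving (fun x => x).
Proof. by split. Qed.

Lemma Rintegral_comp (t : R -> R) (g : R -> R) : measure_preserving t ->
  measurable_fun setT g -> Rintegral mu setT (fun x => g (t x)) = Rintegral mu setT g.
Proof.
move=> [mt ht _] mg; rewrite /Rintegral integralE [in RHS]integralE.
have mgE : measurable_fun setT (EFin \o g) by exact/measurable_EFinP.
have hp := ht _ (measurable_funepos mgE) (fun x => funepos_ge0 _ x).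
have hn := ht _ (measurable_funeneg mgE) (fun x => funeneg_ge0 _ x).
congr fine; congr (_ - _)%E.
- by rewrite -hp; apply: eq_integral => x _; rewrite !funeposE.
- by rewrite -hn; apply: eq_integral => x _; rewrite !funenegE.
Qed.

Lemma cint_comp (t : R -> R) (g : R -> R[i]) : measure_preserving t ->
  cmeasurable g -> cint setT (fun x => g (t x)) = cint setT g.
Proof.
move=> ht [gr gi]; apply: complexP => /=.
- exact: (Rintegral_comp ht gr).
- exact: (Rintegral_comp ht gi).
Qed.

Lemma cintble_comp (t : R -> R) (g : R -> R[i]) : measure_preserving t ->
  cmeasurable g -> cintble setT g -> cintble setT (fun x => g (t x)).
Proof.
move=> [mt ht _] [gr gi] [ir ii].
have h (k : R -> R) : measurable_fun setT k -> mu.-integrable setT (fun x => (k x)%:E) ->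
    mu.-integrable setT (fun x => (k (t x))%:E).
  move=> mk /integrableP[_ k1]; apply/integrableP; split.
    by apply/measurable_EFinP; exact: (measurableT_comp mk mt).
  have := ht (fun x => `|(k x)%:E|%E); rewrite -[X in (_ -> _ -> _ = X)]/(\int[mu]_x `|(k x)%:E|)%E => -> //.
  by apply: measurableT_comp => //; exact/measurable_EFinP.
by split; [exact: h gr ir|exact: h gi ii].
Qed.

Variables (w : R -> R[i]) (t : R -> R).
Hypotheses (mw : cmeasurable w) (w1 : forall x, normc (w x) ^+ 2 = 1)
  (ht : measure_preserving t).

(** A common form for translations, modulations and the reflection, which are thus shown to be
    isometries in one go. *)
Definition wcomp f : L2 R := toL2 (fun x => w x * f (t x)).

Lemma sqintegrable_wcomp f : sqintegrable (fun x => w x * f (t x)).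
Proof.
have [mt hi _] := ht.
have [mr mi] : cmeasurable (fun x => w x * f (t x)).
  by apply: cmeasurableM => //; exact: (cmeasurable_comp (L2_cmeasurable f) mt).
split => //; apply: le_lt_trans (ltry (sqn f)); rewrite sqnorm_L2E.
rewrite -(hi (fun x => (normc (f x) ^+ 2)%:E)).
- rewrite le_eqVlt; apply/orP; left; apply/eqP; apply: eq_integral => x _.
  by rewrite sqr_normcM w1 mul1r.
- by apply: cmeasurable_sqr_normc; exact: L2_cmeasurable.
- by move=> x; rewrite lee_fin sqr_ge0.
Qed.

Lemma wcompE f : {ae mu, forall x, wcomp f x = w x * f (t x)}.
Proof. by apply: toL2E; exact: sqintegrable_wcomp. Qed.

Lemma sqnorm_wcomp f : sqn (wcomp f) = sqn f.
Proof.
have [mt hi _] := ht.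
apply: EFin_inj; rewrite (sqnorm_toL2 (sqintegrable_wcomp f)) sqnorm_L2E.
rewrite -(hi (fun x => (normc (f x) ^+ 2)%:E)).
- by apply: eq_integral => x _; rewrite sqr_normcM w1 mul1r.
- by apply: cmeasurable_sqr_normc; exact: L2_cmeasurable.
- by move=> x; rewrite lee_fin sqr_ge0.
Qed.

Lemma wcompB f g : wcomp (f - g) = wcomp f - wcomp g.
Proof.
have [_ _ ha] := ht; apply: L2_ext.
apply: filterS (filterI (wcompE (f - g)) (filterI (L2BE (wcomp f) (wcomp g))
  (filterI (wcompE f) (filterI (wcompE g) (ha _ (L2BE f g)))))).
move=> x [e1 [e2 [e3 [e4 e5]]]].
apply: (etrans e1); apply: (etrans _ (esym e2)).
apply: (etrans _ (esym (congr2 (fun u v => u - v) e3 e4))).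
by apply: (etrans (congr1 (fun u => w x * u) e5)); rewrite mulrBr.
Qed.

Lemma wcomp_lin (a : R[i]) f g : wcomp (a *: f + g) = a *: wcomp f + wcomp g.
Proof.
have [_ _ ha] := ht; apply: L2_ext.
apply: filterS (filterI (wcompE (a *: f + g)) (filterI (L2linE a (wcomp f) (wcomp g))
  (filterI (wcompE f) (filterI (wcompE g) (ha _ (L2linE a f g)))))).
move=> x [e1 [e2 [e3 [e4 e5]]]].
apply: (etrans e1); apply: (etrans _ (esym e2)).
apply: (etrans _ (esym (congr2 (fun u v => a * u + v) e3 e4))).
by apply: (etrans (congr1 (fun u => w x * u) e5)); rewrite mulrDr mulrCA.
Qed.

Lemma wcomp_lipschitz f g : sqn (wcomp f - wcomp g) <= 1 * sqn (f - g).
Proof. by rewrite -wcompB sqnorm_wcomp mul1r. Qed.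

Lemma ip_wcomp f g : ipL2 (wcomp f) (wcomp g) = ipL2 f g.
Proof.
have D : {morph wcomp : x y / x + y}.
  by move=> x y; have := wcomp_lin 1 x y; rewrite !scale1r.
have Z (a : R[i]) x : wcomp (a *: x) = a *: wcomp x.
  have w0 : wcomp 0 = 0 by have := wcompB 0 0; rewrite !subrr.
  by have := wcomp_lin a x 0; rewrite w0 !addr0.
have N x : sqn (wcomp x) = 1 * sqn x by rewrite sqnorm_wcomp mul1r.
by rewrite (isometry_ip (@ipL2_inner R) (@ipL2_inner R) D Z N) mul1r.
Qed.

Lemma cintegrable_wcomp f : cintegrable f -> cintegrable (wcomp f).
Proof.
move=> fi; have [mt hi _] := ht.
have [mr mi] : cmeasurable (fun x => w x * f (t x)) by have [] := sqintegrable_wcomp f.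
apply: (@cintble_ae _ setT (fun x => w x * f (t x))) => //.
- exact: L2_cmeasurable.
- by apply: filterS (wcompE f) => x ->.
have [ir ii] := cintble_comp ht (L2_cmeasurable f) fi.
have /= := @cintble_dominated _ setT _
  (fun x => `|complex.Re (f (t x))| + `|complex.Im (f (t x))|) measurableT (conj mr mi).
apply.
  by apply: integrable_D => //; [exact: integrable_abse ir|exact: integrable_abse ii].
move=> x; have := w1 x; rewrite sqr_normcE !CReImE.
move: (complex.Re (w x)) (complex.Im (w x)) (complex.Re (f (t x))) (complex.Im (f (t x))).
move=> a b c d ab.
have [h1 h2] := rotation_bound c d ab.
by rewrite (mulrC a c) (mulrC b d) (mulrC a d) (mulrC b c) (addrC (d * a)).
Qed.

End WeightedComposition.

Section FourierOperators.
Context {R : realType}.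
Local Notation mu := (@lebesgue_measure R).
Local Notation sqn := (sqnorm (@ipL2 R)).
Implicit Types f g h : L2 R.

Lemma one_ok : cmeasurable (fun _ : R => 1 : R[i]) /\ forall x : R, normc (1 : R[i]) ^+ 2 = 1.
Proof.
split; first exact: cmeasurable_cst.
by move=> x; rewrite sqr_normcE /= expr1n expr0n addr0.
Qed.

Lemma shiftL2E (s : R) f : shiftL2 s f = wcomp (fun=> 1) (fun x => x + (- s)) f.
Proof. by rewrite /shiftL2 /wcomp; congr toL2; apply/funext => x; rewrite mul1r. Qed.

Lemma shiftL2_ae (s : R) f : {ae mu, forall x, shiftL2 s f x = f (x - s)}.
Proof.
have [m1 n1] := one_ok.
rewrite shiftL2E; apply: filterS (wcompE m1 n1 (measure_preserving_add (- s)) f) => x e.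
by apply: (etrans e); rewrite mul1r.
Qed.

Definition reflL2 f : L2 R := wcomp (fun=> 1) (fun x => - x) f.

Definition modL2 (s : R) f : L2 R := wcomp (fun xi => cis (- (s * xi))) (fun x => x) f.

Lemma mod_ok (s : R) : cmeasurable (fun xi : R => cis (- (s * xi))) /\
  forall xi, normc (cis (- (s * xi))) ^+ 2 = 1.
Proof.
split; last by move=> x; exact: sqr_normc_cis.
by apply: cmeasurable_cis; apply: measurableT_comp => //; exact: measurable_funM.
Qed.

Lemma modL2_ae (s : R) f : {ae mu, forall xi, modL2 s f xi = cis (- (s * xi)) * f xi}.
Proof. by have [m1 n1] := mod_ok s; exact: (wcompE m1 n1 measure_preserving_id f). Qed.

Lemma fourier_lipschitz f g : sqn (fourier f - fourier g) <= 2 * pi * sqn (f - g).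
Proof. by rewrite -fourierB sqnorm_fourier. Qed.

Lemma fourier_shift (s : R) f : fourier (shiftL2 s f) = modL2 s (fourier f).
Proof.
have [m1 n1] := one_ok; have [m2 n2] := mod_ok s.
have ms := measure_preserving_add (- s).
have shB u v : sqn (shiftL2 s u - shiftL2 s v) <= 1 * sqn (u - v).
  by rewrite !shiftL2E; exact: wcomp_lipschitz.
move: f; apply: (@L2_operator_ext _ (fun f => fourier (shiftL2 s f))
  (fun f => modL2 s (fourier f)) (2 * pi)).
- move=> u v; apply: le_trans (fourier_lipschitz _ _) _.
  by apply: ler_wpM2l; [rewrite mulr_ge0 // pi_ge0|have := shB u v; rewrite mul1r].
- move=> u v; apply: le_trans (wcomp_lipschitz m2 n2 measure_preserving_id _ _) _.
  by rewrite mul1r; exact: fourier_lipschitz.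
move=> f fi.
have si : cintegrable (shiftL2 s f) by rewrite shiftL2E; exact: cintegrable_wcomp.
rewrite !fourier_FL //; apply: L2_ext.
apply: filterS (filterI (FLE si) (filterI (modL2_ae s (FL f)) (FLE fi))) => xi [e1 [e2 e3]].
apply: (etrans e1); apply: (etrans _ (esym e2)).
apply: (etrans _ (esym (congr1 (fun u => cis (- (s * xi)) * u) e3))).
have mc : measurable_fun setT (fun x : R => - (xi * x)).
  by apply: measurableT_comp => //; exact: measurable_funM.
rewrite (@eq_fourier_integral _ _ (fun x => f (x - s))); first last.
- exact: shiftL2_ae.
- by apply: (cmeasurable_comp (L2_cmeasurable f)); exact: measurable_funD.
- exact: L2_cmeasurable.
have mfc : cmeasurable (fun x => cis (- (s * xi)) * (f x * cis (- (xi * x)))).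
  apply: cmeasurableM; first exact: cmeasurable_cst.
  by apply: cmeasurableM; [exact: L2_cmeasurable|exact: cmeasurable_cis].
rewrite /fourier_integral -[cintegral (fun x => f x * _)]/(cint setT _) -cintZ //; last first.
  by apply: cintble_mul_cis => //; exact: L2_cmeasurable.
rewrite -(cint_comp ms mfc) /cintegral -/(cint setT _).
congr cint; apply/funext => x; rewrite mulrCA -cisD; congr (_ * cis _); ring.
Qed.

Lemma lipschitz_trunc (A : L2 R -> L2 R) (c : R) f :
  (forall f g, sqn (A f - A g) <= c * sqn (f - g)) ->
  sqn (A (trunc m f) - A f) @[m --> \oo] --> (0 : R).
Proof.
move=> hA.
have h0 : c * sqn (trunc m f - f) @[m --> \oo] --> (0 : R).
  by rewrite -(mulr0 c); apply: cvgMr; exact: trunc_cvg.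
apply: (@squeeze_cvgr _ _ _ _ (cst 0) _ _ _ _ (cvg_cst _) h0); near=> m.
by rewrite /cst (sqnorm_ge0 (@ipL2_inner R)); exact: hA.
Unshelve. all: by end_near. Qed.

(** Truncations are removed one variable at a time, first in [u], then in [h], where the roles of
    [A] and [B] are exchanged by conjugate symmetry. *)
Lemma adjoint_ext (A B : L2 R -> L2 R) (c : R) :
  (forall f g, sqn (A f - A g) <= c * sqn (f - g)) ->
  (forall f g, sqn (B f - B g) <= c * sqn (f - g)) ->
  (forall u h : L2 R, cintegrable u -> cintegrable h -> ipL2 (A u) h = ipL2 u (B h)) ->
  forall u h : L2 R, ipL2 (A u) h = ipL2 u (B h).
Proof.
move=> hA hB AB.
have AB1 u h : cintegrable h -> ipL2 (A u) h = ipL2 u (B h).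
  move=> ih.
  have [r1 i1] := cvg_ipl (@ipL2_inner R) h (lipschitz_trunc u hA).
  have [r2 i2] := cvg_ipl (@ipL2_inner R) (B h) (trunc_cvg u).
  have e m : ipL2 (A (trunc m u)) h = ipL2 (trunc m u) (B h).
    by apply: AB => //; exact: cintegrable_trunc.
  apply: complexP.
  - by move: r1; under eq_cvg do rewrite e; move=> r1; exact: (cvg_unique _ r1 r2).
  - by move: i1; under eq_cvg do rewrite e; move=> i1; exact: (cvg_unique _ i1 i2).
move=> u h.
have [r1 i1] := cvg_ipl (@ipL2_inner R) u (lipschitz_trunc h hB).
have [r2 i2] := cvg_ipl (@ipL2_inner R) (A u) (trunc_cvg h).
have e m : ipL2 (trunc m h) (A u) = ipL2 (B (trunc m h)) u.
  rewrite (ipC (@ipL2_inner R) (A u)) AB1; last exact: cintegrable_trunc.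
  by rewrite -(ipC (@ipL2_inner R)).
rewrite (ipC (@ipL2_inner R) h) (ipC (@ipL2_inner R) (B h)); congr (_^*).
apply: complexP.
- by move: r2; under eq_cvg do rewrite e; move=> r2; exact: (cvg_unique _ r2 r1).
- by move: i2; under eq_cvg do rewrite e; move=> i2; exact: (cvg_unique _ i2 i1).
Qed.

(** For integrable functions this is Fubini's theorem; moving the kernel into the conjugated factor
    changes the sign of its exponent, which produces the reflection. *)
Lemma fourier_adjoint u h : ipL2 (fourier u) h = ipL2 u (reflL2 (fourier h)).
Proof.
have [m1 n1] := one_ok.
move: u h; apply: (@adjoint_ext fourier (fun h => reflL2 (fourier h)) (2 * pi)).
- exact: fourier_lipschitz.
- move=> f g; apply: le_trans (wcomp_lipschitz m1 n1 measure_preserving_opp _ _) _.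
  by rewrite mul1r; exact: fourier_lipschitz.
move=> u h ui hi; rewrite !fourier_FL //.
have [mu_ mh] := (L2_cmeasurable u, L2_cmeasurable h).
have mc (a : R) : measurable_fun setT (fun x : R => - (a * x)).
  by apply: measurableT_comp => //; exact: measurable_funM.
pose G (xi x : R) : R[i] := u x * cis (- (xi * x)) * (h xi)^*.
have E1 : ipL2 (FL u) h = cint setT (fun xi => cint setT (G xi)).
  rewrite ipL2E (@eq_cint_ae _ setT _ (fun xi => (h xi)^* * fourier_integral u xi)) //.
  - congr cint; apply/funext => xi; rewrite -cintZ //; last by apply: cintble_mul_cis.
    by congr cint; apply/funext => x; rewrite mulrC.
  - by apply: cmeasurableM; [exact: L2_cmeasurable|exact: cmeasurableJ].
  - by apply: cmeasurableM; [exact: cmeasurableJ|exact: cmeasurable_fourier_integral].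
  - by apply: filterS (FLE ui) => xi -> _; rewrite mulrC.
have E2 : ipL2 u (reflL2 (FL h)) = cint setT (fun x => cint setT (G^~ x)).
  rewrite ipL2E (@eq_cint_ae _ setT _ (fun x => u x * (fourier_integral h (- x))^*)).
  - congr cint; apply/funext => x.
    rewrite /fourier_integral -[cintegral _]/(cint setT _).
    have J : (cint setT (fun y => h y * cis (- (- x * y))))^* =
        cint setT (fun y => (h y * cis (- (- x * y)))^*).
      by rewrite -cintJ //; apply: cintble_mul_cis.
    apply: (etrans (congr1 (fun v => u x * v) J)).
    rewrite -cintZ //.
      congr cint; apply/funext => xi; rewrite /G.
      apply: complexP; rewrite !CReImE /= mulNr opprK cosN sinN (mulrC x); ring.
    have [j1 j2] := cintble_mul_cis mh hi (mc (- x)).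
    have [j3 j4] : cintble setT (fun xi => (h xi * cis (- (- x * xi)))^* ).
      split; first by apply: eq_integrable j1 => // y _; rewrite CReJ.
      have := integrable_Zl (-1) measurableT j2.
      by apply: eq_integrable => // y _ /=; rewrite CImJ mulN1r.
    by [].
  - exact: measurableT.
  - by apply: cmeasurableM => //; apply: cmeasurableJ; exact: L2_cmeasurable.
  - apply: cmeasurableM => //; apply: cmeasurableJ.
    apply: (cmeasurable_comp (cmeasurable_fourier_integral mh)); exact: oppr_measurable.
  - have [_ _ ha] := measure_preserving_opp (R := R).
    apply: filterS2 (wcompE m1 n1 measure_preserving_opp (FL h)) (ha _ (FLE hi)) => x e1 e2 _.
    by congr (_ * _^*); apply: (etrans e1); rewrite mul1r.
rewrite E1 E2.
pose N (f : L2 R) x := `|complex.Re (f x)| + `|complex.Im (f x)|.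
have N0 f x : 0 <= N f x by rewrite addr_ge0.
have iN f : cintegrable f -> mu.-integrable setT (EFin \o N f).
  by move=> [fr fi]; apply: integrable_D => //; [exact: integrable_abse fr|exact: integrable_abse fi].
apply: (@cint_Fubini _ G (N h) (N u)) => //.
- apply: cmeasurable2M; last by apply: cmeasurable2_fst; exact: cmeasurableJ.
  by apply: cmeasurable2M; [exact: cmeasurable2_snd|exact: cmeasurable2_cis_mul].
- exact: iN.
- exact: iN.
move=> xi x; rewrite /G /N.
have := sqr_normc_cis (- (xi * x)); rewrite sqr_normcE !CReImE.
move: (complex.Re (cis _)) (complex.Im (cis _)) (complex.Re (h xi)) (complex.Im (h xi)) (complex.Re (u x)) (complex.Im (u x)).
move=> c s a b p q cs.
have [h1 h2] := rotation_bound p q cs.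
rewrite (_ : (`|a| + `|b|) * _ = `|a| * (`|p| + `|q|) + `|b| * (`|p| + `|q|)); last by rewrite mulrDl.
split.
- apply: le_trans (ler_normB _ _) _; rewrite !normrM normrN; apply: lerD; rewrite mulrC; exact: ler_wpM2l.
- apply: le_trans (ler_normD _ _) _; rewrite !normrM normrN addrC; apply: lerD; rewrite mulrC; exact: ler_wpM2l.
Qed.

(* By Plancherel and the previous lemma, the adjoint of the Fourier transform,
   divided by 2 pi, is a right inverse. *)
Lemma fourier_surjective g : exists f, fourier f = g.
Proof.
have [m1 n1] := one_ok.
pose c : R[i] := ((2 * pi)^-1)%:C.
have pi2 : 2 * pi != 0 :> R by rewrite mulf_neq0 // lt0r_neq0 // pi_gt0.
exists (c *: reflL2 (fourier g)).
have h k : ipL2 (fourier (c *: reflL2 (fourier g))) k = ipL2 g k.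
  rewrite fourierZ (ipZl (@ipL2_inner R)) fourier_adjoint.
  rewrite (ip_wcomp m1 n1 measure_preserving_opp) ip_fourier.
  by rewrite mulrA -rmorphM mulVf // mul1r.
apply/eqP; rewrite -subr_eq0; apply/eqP; apply: (sqnorm_eq0 (@ipL2_inner R)).
set d := fourier _ - g.
have : ipL2 d d = 0 by rewrite {1}/d (ipDl (@ipL2_inner R)) (ipNl (@ipL2_inner R)) h subrr.
by rewrite (ip_selfE (@ipL2_inner R)) => /(congr1 (@complex.Re R)).
Qed.

End FourierOperators.

(** * Fibers *)

Opaque ipell2n ipL2n.

Section MeasurableFields.
Context {R : realType} {n : nat}.
Local Notation mu := (@lebesgue_measure R).
Local Notation ip := (@ipell2n R n).
Local Notation sqn := (sqnorm ip).
Implicit Types X Y : R -> ell2n R n.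

(** Measurable coordinates suffice: squared norms are countable sums of them, and inner products
    follow by polarization. *)
Definition borel_field X : Prop := forall i k, cmeasurable (fun xi => X xi i k).

Lemma borel_field_lin (a : R[i]) X Y : borel_field X -> borel_field Y ->
  borel_field (fun xi => a *: X xi + Y xi).
Proof.
move=> bX bY i k; rewrite (_ : (fun xi => _) = (fun xi => a * X xi i k + Y xi i k)).
  by apply: cmeasurableD => //; apply: cmeasurableM => //; exact: cmeasurable_cst.
by apply/funext => xi; rewrite ell2n_linE.
Qed.

Lemma borel_field_cst (x : ell2n R n) : borel_field (fun=> x).
Proof. by move=> i k; exact: cmeasurable_cst. Qed.

Lemma measurable_sqnorm_field X : borel_field X ->
  measurable_fun [set: R] (fun xi => (sqn (X xi))%:E).
Proof.
move=> bX; rewrite (_ : (fun xi => _) =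
    (fun xi => \sum_(i < n) \esum_(k in [set: int]) (normc (X xi i k) ^+ 2)%:E)%E).
  apply: emeasurable_sum => i; apply: emeasurable_fun_esum => //.
  - exact: countable_int.
  - by move=> k _; apply: cmeasurable_sqr_normc; exact: bX.
  - by move=> k x _ _; rewrite lee_fin sqr_ge0.
by apply/funext => xi; rewrite sqnorm_ell2nE.
Qed.

Lemma cmeasurable_ip_field X Y : borel_field X -> borel_field Y ->
  cmeasurable (fun xi => ip (X xi) (Y xi)).
Proof.
move=> bX bY.
have ms (a : R[i]) : measurable_fun [set: R] (fun xi => sqn (X xi + a *: Y xi)).
  apply/measurable_EFinP; rewrite (_ : (fun xi => _) = fun xi => sqn (a *: Y xi + X xi)).
    by apply: measurable_sqnorm_field; exact: borel_field_lin.
  by apply/funext => xi; rewrite addrC.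
have mn (a : R[i]) : measurable_fun [set: R] (fun xi => sqn (X xi - a *: Y xi)).
  have E : (fun xi => sqn (X xi - a *: Y xi)) = (fun xi => sqn (X xi + (- a) *: Y xi)).
    by apply/funext => xi; rewrite scaleNr.
  by rewrite E; exact: ms.
have md (a : R[i]) : measurable_fun [set: R]
    (fun xi => (sqn (X xi + a *: Y xi) - sqn (X xi - a *: Y xi)) / 4).
  by apply: measurable_funM => //; apply: measurable_funB; [exact: ms|exact: mn].
split.
- rewrite (_ : (fun xi => _) = (fun xi => (sqn (X xi + 1 *: Y xi) - sqn (X xi - 1 *: Y xi)) / 4)) //.
  by apply/funext => xi; rewrite (polarization ipell2n_inner) /= scale1r.
- rewrite (_ : (fun xi => _) = (fun xi => (sqn (X xi + 'i *: Y xi) - sqn (X xi - 'i *: Y xi)) / 4)) //.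
  by apply/funext => xi; rewrite (polarization ipell2n_inner).
Qed.

(** The default of [toell2] replaces a coordinate sequence by 0 exactly off the set [S] of points
    where it is square summable, and [S] is Borel. *)
Lemma borel_field_toell2 (h : 'I_n -> int -> R -> R[i]) : (forall i k, cmeasurable (h i k)) ->
  borel_field (fun xi => [ffun i => toell2 (fun k => h i k xi)] : ell2n R n).
Proof.
move=> mh i k; pose S := [set xi | sqsummable setT (fun k : int => h i k xi)].
have mS : measurable S.
  rewrite (_ : S = setT `&` [set xi | \esum_(k in [set: int]) (normc (h i k xi) ^+ 2)%:E < +oo]%E);
    last by rewrite setTI.
  apply: emeasurable_fun_infty_o => //; apply: emeasurable_fun_esum => //.
  - exact: countable_int.
  - by move=> k' _; exact: cmeasurable_sqr_normc.
  - by move=> k' x _ _; rewrite lee_fin sqr_ge0.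
rewrite (_ : (fun xi => _) = (fun xi => (\1_S xi)%:C * h i k xi)).
  exact: cmeasurable_indic.
apply/funext => xi; rewrite ffunE indicE; have [Sx|nSx] := pselect (S xi).
  by rewrite mem_set // mul1r toell2E.
by rewrite memNset // mul0r toell2_default.
Qed.

End MeasurableFields.

Section Fibers.
Context {R : realType} {n : nat} (theta : 'I_n -> R).
Local Notation mu := (@lebesgue_measure R).
Local Notation ip := (@ipell2n R n).
Local Notation sqn := (sqnorm ip).
Local Notation T := (Tper theta).
Local Notation cell := [set` `[(- pi : R), - pi + 2 * pi[%R].
Implicit Types F G : L2n R n.

Lemma period_gt0 : 0 < 2 * pi :> R.
Proof. by rewrite mulr_gt0 // pi_gt0. Qed.

Lemma fiberE F xi i (k : int) :
  sqsummable setT (fun k : int => fourier (F i) (xi - theta i + 2 * k%:~R * pi)) ->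
  T F xi i k = fourier (F i) (xi - theta i + 2 * k%:~R * pi).
Proof. by move=> s; rewrite /Tper ffunE toell2E. Qed.

Lemma measurable_fiber_sum (g : L2 R) (t : R) :
  measurable_fun [set: R] (fun xi => \esum_(k in [set: int])
    (normc (g (xi - t + 2 * k%:~R * pi)) ^+ 2)%:E)%E.
Proof.
apply: emeasurable_fun_esum => //; first exact: countable_int.
- move=> k _; apply: cmeasurable_sqr_normc.
  apply: (cmeasurable_comp (L2_cmeasurable g)); apply: measurable_funD => //.
  exact: measurable_funB.
- by move=> k x _ _; rewrite lee_fin sqr_ge0.
Qed.

(** Integrated over one period, the sum of squares is the squared norm of [g], so it is finite
    almost everywhere in the cell. On the other cells it is the same sum reindexed by an integer
    shift. *)
Lemma sqsum_fiber_ae (g : L2 R) (t : R) :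
  {ae mu, forall xi, sqsummable setT (fun k : int => g (xi - t + 2 * k%:~R * pi))}.
Proof.
pose P xi := sqsummable setT (fun k : int => g (xi + 2 * k%:~R * pi)).
suff : {ae mu, forall xi, P xi} by move=> /(ae_shift (- t)).
apply: (@ae_tile _ (- pi) _ period_gt0) => s.
pose f x := (\esum_(k in [set: int]) (normc (g (x + 2 * pi * k%:~R)) ^+ 2)%:E)%E.
have mf : measurable_fun cell f.
  apply: measurable_funTS; have := measurable_fiber_sum g 0; rewrite /f.
  by under eq_fun => x do under eq_esum => k _ do rewrite subr0 mulrAC.
have fi : mu.-integrable cell f.
  apply/integrableP; split => //.
  under eq_integral => x _.
    rewrite gee0_abs; last by apply: esum_ge0 => k _; rewrite lee_fin sqr_ge0.
    over.
  rewrite -(ge0_integral_tile (- pi) period_gt0 (f := fun x => (normc (g x) ^+ 2)%:E)).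
  - by rewrite -sqnorm_L2E ltry.
  - by apply: cmeasurable_sqr_normc; exact: L2_cmeasurable.
  - by move=> x; rewrite lee_fin sqr_ge0.
have : {ae mu, forall x, cell x -> f x \is a fin_num} by apply: (integrable_ae _ fi).
apply: filterS => x h cx; rewrite /P /sqsummable.
have := h cx; rewrite ge0_fin_numE; last by apply: esum_ge0 => k _; rewrite lee_fin sqr_ge0.
rewrite /f -(esum_int_shift (- s) (fun k => (normc (g (x + 2 * pi * k%:~R)) ^+ 2)%:E)).
apply: le_lt_trans; apply: le_esum => k _; rewrite le_eqVlt; apply/orP; left; apply/eqP.
congr (normc (g _) ^+ 2)%:E; rewrite opprK rmorphD /=; ring.
Qed.

Lemma fiber_ae F : {ae mu, forall xi, forall i (k : int),
  T F xi i k = fourier (F i) (xi - theta i + 2 * k%:~R * pi)}.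
Proof.
have := ae_all_fin (fun i => sqsum_fiber_ae (fourier (F i)) (theta i)).
by apply: filterS => xi h i k; apply: fiberE; exact: h.
Qed.

Lemma borel_field_fiber F : borel_field (T F).
Proof.
apply: (@borel_field_toell2 _ _ (fun i (k : int) xi => fourier (F i) (xi - theta i + 2 * k%:~R * pi))).
move=> i k; apply: (cmeasurable_comp (L2_cmeasurable (fourier (F i)))); apply: measurable_funD => //.
exact: measurable_funB.
Qed.

(** Valid at every [xi], exceptional points included: the two coordinate sequences are shifts of
    each other, so either both are square summable or both are replaced by 0. *)
Lemma fiber_periodic F (s : int) xi : T F (xi + 2 * s%:~R * pi) = lam (- s) (T F xi).
Proof.
apply: ell2n_ext => i k; rewrite lamE opprK /Tper !ffunE.
pose g (x : R) (k : int) := fourier (F i) (x - theta i + 2 * k%:~R * pi).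
have gE k' : g (xi + 2 * s%:~R * pi) k' = g xi (k' + s).
  by rewrite /g; congr (fourier (F i) _); rewrite rmorphD /=; ring.
have E : (\esum_(k in [set: int]) (normc (g (xi + 2 * s%:~R * pi) k) ^+ 2)%:E =
    \esum_(k in [set: int]) (normc (g xi k) ^+ 2)%:E)%E.
  rewrite -[RHS](esum_int_shift (- s)); apply: eq_esum => k' _.
  by rewrite gE opprK.
have [h|h] := pselect (sqsummable setT (g xi)).
- rewrite toell2E; last by rewrite /sqsummable E.
  by rewrite toell2E // -[LHS]/(g _ _) gE.
- by rewrite !toell2_default // /sqsummable E.
Qed.

Lemma fiber_lin (a : R[i]) F G : {ae mu, forall xi, T (a *: F + G) xi = a *: T F xi + T G xi}.
Proof.
have h : {ae mu, forall xi, forall i (k : int),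
    fourier ((a *: F + G) i) (xi - theta i + 2 * k%:~R * pi) =
    a * fourier (F i) (xi - theta i + 2 * k%:~R * pi) +
    fourier (G i) (xi - theta i + 2 * k%:~R * pi)}.
  apply: ae_all_fin => i; apply: ae_all_int => k.
  have e : fourier ((a *: F + G) i) = a *: fourier (F i) + fourier (G i).
    by rewrite !ffunE fourier_lin.
  have := ae_shift (- theta i + 2 * k%:~R * pi) (L2linE a (fourier (F i)) (fourier (G i))).
  by apply: filterS => xi; rewrite e addrA.
apply: filterS (filterI h (filterI (fiber_ae (a *: F + G)) (filterI (fiber_ae F) (fiber_ae G)))).
move=> xi [e0 [e1 [e2 e3]]]; apply: ell2n_ext => i k; rewrite ell2n_linE.
exact: (etrans (e1 i k) (etrans (e0 i k)
  (congr2 (fun u v => a * u + v) (esym (e2 i k)) (esym (e3 i k))))).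
Qed.

Lemma sqnorm_fiber F : (\int[mu]_(xi in cell) (sqn (T F xi))%:E =
  (2 * pi * sqnorm (@ipL2n R n) F)%:E)%E.
Proof.
have mes i : measurable_fun [set: R]
    (fun xi => \esum_(k in [set: int]) (normc (T F xi i k) ^+ 2)%:E)%E.
  apply: emeasurable_fun_esum => //; first exact: countable_int.
  + by move=> k _; apply: cmeasurable_sqr_normc; exact: borel_field_fiber.
  + by move=> k x _ _; rewrite lee_fin sqr_ge0.
rewrite sqnorm_L2n mulr_sumr -sumEFin.
under eq_integral do rewrite sqnorm_ell2nE.
rewrite ge0_integral_sum //; last 2 first.
- by move=> i; apply: measurable_funTS; exact: mes.
- by move=> i x _; apply: esum_ge0 => k _; rewrite lee_fin sqr_ge0.
apply: eq_bigr => i _; rewrite -sqnorm_fourier sqnorm_L2E.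
rewrite -(ge0_integral_shift (- theta i)); first last.
- by move=> x; rewrite lee_fin sqr_ge0.
- by apply: cmeasurable_sqr_normc; exact: L2_cmeasurable.
rewrite (ge0_integral_tile (- pi) period_gt0); first last.
- by move=> x; rewrite lee_fin sqr_ge0.
- apply: cmeasurable_sqr_normc; apply: (cmeasurable_comp (L2_cmeasurable _)).
  exact: measurable_funD.
have arg x (k : int) : x + 2 * pi * k%:~R - theta i = x - theta i + 2 * k%:~R * pi by ring.
apply: ge0_integral_ae_eq; [exact: measurable_itv|exact: mes| |].
- have := measurable_fiber_sum (fourier (F i)) (theta i).
  apply: eq_measurable_fun => x _; apply: eq_esum => k _; by rewrite arg.
- by apply: filterS (fiber_ae F) => xi h _; apply: eq_esum => k _; rewrite h arg.
Qed.

End Fibers.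

Opaque Tper.

Lemma Rintegral_ae_combination {R : realType} (D : set R) (s a b r : R -> R) :
  measurable D -> measurable_fun setT s ->
  (@lebesgue_measure R).-integrable D (fun x => (a x)%:E) ->
  (@lebesgue_measure R).-integrable D (fun x => (b x)%:E) ->
  (@lebesgue_measure R).-integrable D (fun x => (r x)%:E) ->
  {ae lebesgue_measure, forall x, D x -> s x = a x + b x + 2 * r x} ->
  Rintegral lebesgue_measure D s =
  Rintegral lebesgue_measure D a + Rintegral lebesgue_measure D b +
  2 * Rintegral lebesgue_measure D r.
Proof.
move=> mD ms ia ib ir sE.
have i1 := integrable_D mD ia ib; have i2 := integrable_Zl 2 mD ir.
rewrite -RintegralD // -RintegralZl // -RintegralD //.
rewrite /Rintegral; congr fine; apply: ae_eq_integral => //.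
- by apply/measurable_EFinP; exact: measurable_funTS.
- by have /integrableP[] := integrable_D mD i1 i2.
- by apply: filterS sE => x h Dx; rewrite h.
Qed.

(** This is [parseval] with [l = pi], where the frequency step is 1. The missing endpoint is a null
    set, and [k] is replaced by [- k] to obtain the sign of the exponent that translations
    produce. *)
Lemma parseval_cell {R : realType} (h : R -> R[i]) : cmeasurable h ->
  cintble [set` `[- pi, - pi + 2 * pi[%R] h ->
  (\esum_(k in [set: int])
    (normc (cint [set` `[- pi, - pi + 2 * pi[%R] (fun x => h x * cis (k%:~R * x))) ^+ 2)%:E =
   (2 * pi)%:E * \int[lebesgue_measure]_(x in [set` `[- pi, - pi + 2 * pi[%R]) (normc (h x) ^+ 2)%:E)%E.
Proof.
have -> : - pi + 2 * pi = pi :> R by ring.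
move=> mh [ir ii].
have cE (f : R -> R[i]) : cmeasurable f ->
    cint [set` `[- pi, pi[%R] f = cint [set` `[- pi, pi]%R] f.
  move=> [fr fi]; apply: complexP; rewrite /= /Rintegral; congr fine;
    apply: integral_itv_bndo_bndc; apply: measurable_funTS; exact/measurable_EFinP.
have ic : cintble [set` `[- pi, pi]%R] h.
  have e (f : R -> R) : measurable_fun setT f ->
      (@lebesgue_measure R).-integrable [set` `[- pi, pi[%R] (fun x => (f x)%:E) ->
      (@lebesgue_measure R).-integrable [set` `[- pi, pi]%R] (fun x => (f x)%:E).
    move=> mf /integrableP[_ fin]; apply/integrableP; split.
      by apply: measurable_funTS; exact/measurable_EFinP.
    rewrite -integral_itv_bndo_bndc //; apply: measurable_funTS.
    by apply: measurableT_comp => //; exact/measurable_EFinP.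
  by case: mh => hr hi; split; exact: e.
rewrite integral_itv_bndo_bndc; last by apply: measurable_funTS; exact: cmeasurable_sqr_normc.
rewrite -(parseval (pi_gt0 R) mh ic).
have bij : set_bij [set: int] [set: int] -%R.
  split=> [//|k k' _ _ /oppr_inj //|k _]; by exists (- k); rewrite ?opprK.
rewrite (reindex_esum _ _ _ _ bij); apply: eq_esum => k _.
rewrite cE; last by apply: cmeasurableM => //; apply: cmeasurable_cis; exact: measurable_funM.
rewrite /fourier_coef divff ?mul1r; last by rewrite gt_eqF // pi_gt0.
by congr (normc (cint _ _) ^+ 2)%:E; apply/funext => x; rewrite mulrNz mulNr.
Qed.

Lemma half_difference {R : realFieldType} (t a b c d s : R) : s = a + b + 2 * d ->
  t * s = t * a + t * b + 2 * c -> c = t * d.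
Proof. by move=> -> h; lra. Qed.

(** * Inner products and translations in the fibers *)

Section FiberInnerProduct.
Context {R : realType} {n : nat} (theta : 'I_n -> R).
Local Notation mu := (@lebesgue_measure R).
Local Notation ip := (@ipell2n R n).
Local Notation sqn := (sqnorm ip).
Local Notation T := (Tper theta).
Local Notation cell := [set` `[(- pi : R), - pi + 2 * pi[%R].
Implicit Types F G : L2n R n.

Definition l2_field (X : R -> ell2n R n) : Prop :=
  borel_field X /\ (\int[mu]_(xi in cell) (sqn (X xi))%:E < +oo)%E.

Lemma l2_field_fiber F : l2_field (T F).
Proof. by split; [exact: borel_field_fiber|rewrite sqnorm_fiber ltry]. Qed.

Lemma integrable_sqnorm_field (X : R -> ell2n R n) : l2_field X ->
  mu.-integrable cell (EFin \o (fun xi => sqn (X xi))).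
Proof.
move=> [bX fX]; apply/integrableP; split.
  by apply: measurable_funTS; exact: measurable_sqnorm_field.
under eq_integral => x _.
  rewrite /= ger0_norm; last exact: (sqnorm_ge0 ipell2n_inner).
  over.
exact: fX.
Qed.

Lemma normc_ip_le (x y : ell2n R n) :
  `|complex.Re (ip x y)| <= sqn x + sqn y /\ `|complex.Im (ip x y)| <= sqn x + sqn y.
Proof.
have := cauchy_schwarz ipell2n_inner x y; rewrite sqr_normcE.
have := sqnorm_ge0 ipell2n_inner x; have := sqnorm_ge0 ipell2n_inner y.
move: (sqn x) (sqn y) (complex.Re _) (complex.Im _) => a b r i a0 b0 h.
have ab : 0 <= a + b by rewrite addr_ge0.
split.
- rewrite -ler_sqr ?nnegrE // real_normK ?num_real //; nra.
- rewrite -ler_sqr ?nnegrE // real_normK ?num_real //; nra.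
Qed.

Lemma cintble_ip_field (X Y : R -> ell2n R n) : l2_field X -> l2_field Y ->
  cintble cell (fun xi => ip (X xi) (Y xi)).
Proof.
move=> lX lY; have [[bX _] [bY _]] := (lX, lY).
apply: (@cintble_dominated _ _ _ (fun xi => sqn (X xi) + sqn (Y xi))).
- exact: measurable_itv.
- exact: cmeasurable_ip_field.
- apply: integrable_D; first exact: measurable_itv.
  + exact: integrable_sqnorm_field.
  + exact: integrable_sqnorm_field.
- by move=> xi; exact: normc_ip_le.
Qed.

Lemma Rintegral_sqnorm_fiber F :
  Rintegral mu cell (fun xi => sqn (T F xi)) = 2 * pi * sqnorm (@ipL2n R n) F.
Proof. by rewrite /Rintegral sqnorm_fiber. Qed.

(** Fibers are additive only almost everywhere, so [isometry_ip] does not apply; the square of a sum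
    is expanded under the integral instead. *)
Lemma Re_ip_fiber F G :
  complex.Re (cint cell (fun xi => ip (T F xi) (T G xi))) =
  2 * pi * complex.Re (ipL2n F G).
Proof.
have mc : measurable (cell : set R) by exact: measurable_itv.
have [lF lG] := (l2_field_fiber F, l2_field_fiber G).
have iF := integrable_sqnorm_field lF; have iG := integrable_sqnorm_field lG.
have [iR _] := cintble_ip_field lF lG.
have e := @Rintegral_ae_combination _ cell (fun xi => sqn (T (F + G) xi)) _ _ _ mc _ iF iG iR.
have {e} : Rintegral mu cell (fun xi => sqn (T (F + G) xi)) =
    Rintegral mu cell (fun xi => sqn (T F xi)) + Rintegral mu cell (fun xi => sqn (T G xi)) +
    2 * complex.Re (cint cell (fun xi => ip (T F xi) (T G xi))).
  apply: e.
  - by apply/measurable_EFinP; apply: measurable_sqnorm_field; exact: borel_field_fiber.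
  - have := fiber_lin theta 1 F G; rewrite scale1r; apply: filterS => xi + _.
    rewrite scale1r => h.
    exact: (etrans (congr1 (fun v => sqn v) h) (sqnormD ipell2n_inner _ _)).
move=> e.
have e2 : 2 * pi * sqnorm (@ipL2n R n) (F + G) =
    2 * pi * sqnorm (@ipL2n R n) F + 2 * pi * sqnorm (@ipL2n R n) G +
    2 * complex.Re (cint cell (fun xi => ip (T F xi) (T G xi))).
  apply: (etrans (esym (Rintegral_sqnorm_fiber _))); apply: (etrans e).
  exact: (congr2 (fun u v => u + v + _) (Rintegral_sqnorm_fiber F) (Rintegral_sqnorm_fiber G)).
have e3 := sqnormD ipL2n_inner F G.
exact: (half_difference e3 e2).
Qed.

Lemma fiberZ (a : R[i]) F : {ae mu, forall xi, T (a *: F) xi = a *: T F xi}.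
Proof.
have q1 : a *: F + 0 = a *: F by rewrite addr0.
have q2 : (-1) *: 0 + 0 = 0 :> L2n R n by rewrite scaler0 addr0.
apply: filterS2 (fiber_lin theta a F 0) (fiber_lin theta (-1) 0 0) => xi h h0.
have e0 : T 0 xi = 0.
  apply: (etrans (congr1 (fun G => T G xi) (esym q2))); apply: (etrans h0).
  by rewrite scaleN1r addNr.
apply: (etrans (congr1 (fun G => T G xi) (esym q1))); apply: (etrans h).
by apply: (etrans (congr1 (fun v => a *: T F xi + v) e0)); rewrite addr0.
Qed.

Lemma ip_fiber F G :
  cint cell (fun xi => ip (T F xi) (T G xi)) = (2 * pi)%:C * ipL2n F G.
Proof.
have mc : measurable (cell : set R) by exact: measurable_itv.
(* The imaginary part for [G] is the real part for ['i *: G]. *)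
have ReI (w : R[i]) : complex.Re (('i)^* * w) = complex.Im w by rewrite !CReImE /=; ring.
apply: complexP; first by rewrite Re_ip_fiber !CReImE /= mul0r subr0.
have := Re_ip_fiber F ('i *: G); rewrite (ipZr ipL2n_inner) ReI => e.
rewrite CImM /= mul0r addr0 -e; congr fine.
apply: ae_eq_integral => //.
- have [_ m] := cmeasurable_ip_field (borel_field_fiber theta F) (borel_field_fiber theta G).
  by apply/measurable_EFinP; exact: measurable_funTS.
- have [m _] := cmeasurable_ip_field (borel_field_fiber theta F) (borel_field_fiber theta ('i *: G)).
  by apply/measurable_EFinP; exact: measurable_funTS.
apply: filterS (fiberZ 'i G) => xi h _.
apply: (etrans _ (esym (congr1 (fun v => (complex.Re (ip (T F xi) v))%:E) h))).
by rewrite (ipZr ipell2n_inner) ReI.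
Qed.

Lemma cis_period (k : int) : cis (2 * k%:~R * pi) = 1 :> R[i].
Proof.
have N (m : nat) : cis (2 * m%:R * pi) = 1 :> R[i].
  elim: m => [|m IH]; first by rewrite mulr0 mul0r cis0.
  rewrite (_ : 2 * _ * pi = 2 * m%:R * pi + pi *+ 2); last by rewrite -natr1; ring.
  by rewrite cisD IH mul1r; apply: complexP; rewrite /= ?cos2pi ?sin2pi.
case: k => m; first exact: N.
by rewrite NegzE mulrNz mulrN mulNr -cisV N invr1.
Qed.

(** The factor [z i] cancels the phase due to the offset [theta i], and the offset 2 k pi
    contributes 1 since [s] is an integer; so all coordinates are multiplied by the same scalar. The
    cases s = 1 and s = -1 are [transl] and [transl_inv]. *)
Lemma fiber_shift (s : int) (z : 'I_n -> R[i]) F :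
  (forall i, z i = cis (- (s%:~R * theta i))) ->
  {ae mu, forall xi, T [ffun i => z i *: shiftL2 s%:~R (F i)] xi = cis (- (s%:~R * xi)) *: T F xi}.
Proof.
move=> hz; set F' : L2n R n := [ffun i => _].
have h : {ae mu, forall xi, forall i (k : int),
    fourier (F' i) (xi - theta i + 2 * k%:~R * pi) =
    cis (- (s%:~R * xi)) * fourier (F i) (xi - theta i + 2 * k%:~R * pi)}.
  apply: ae_all_fin => i; apply: ae_all_int => k.
  have e : fourier (F' i) = z i *: modL2 s%:~R (fourier (F i)).
    by rewrite ffunE fourierZ fourier_shift.
  have h1 := ae_shift (- theta i + 2 * k%:~R * pi) (L2ZE (z i) (modL2 s%:~R (fourier (F i)))).
  have h2 := ae_shift (- theta i + 2 * k%:~R * pi) (modL2_ae s%:~R (fourier (F i))).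
  apply: filterS2 h1 h2 => xi; rewrite e addrA => e1 e2.
  apply: (etrans e1); apply: (etrans (congr1 (fun u => z i * u) e2)).
  rewrite mulrA; congr (_ * _); rewrite hz -cisD.
  rewrite -[LHS]mulr1 -(cis_period (s * k)) -cisD; congr cis; rewrite rmorphM /=; ring.
apply: filterS (filterI h (filterI (fiber_ae theta F') (fiber_ae theta F))).
move=> xi [e0 [e1 e2]]; apply: ell2n_ext => i k; rewrite ell2n_ZE.
exact: (etrans (e1 i k) (etrans (e0 i k) (congr1 (fun v => cis (- (s%:~R * xi)) * v) (esym (e2 i k))))).
Qed.

Variable z : 'I_n -> R[i].
Hypothesis hz : forall k, z k = cis (- theta k).

Lemma fiber_transl F : {ae mu, forall xi, T (transl z F) xi = cis (- xi) *: T F xi}.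
Proof.
have h i : z i = cis (- (1%:~R * theta i)) by rewrite hz mul1r.
by apply: filterS (fiber_shift F h) => xi; rewrite mul1r.
Qed.

Lemma fiber_transl_inv F : {ae mu, forall xi, T (transl_inv z F) xi = cis xi *: T F xi}.
Proof.
have h i : (z i)^-1 = cis (- ((-1)%:~R * theta i)).
  by rewrite hz cisV mulN1r.
have := fiber_shift F h.
by apply: filterS => xi; rewrite mulN1r opprK.
Qed.

Lemma fiber_transl_pow (k : int) F :
  {ae mu, forall xi, T (transl_pow z k F) xi = cis (- (k%:~R * xi)) *: T F xi}.
Proof.
have iterE (A : L2n R n -> L2n R n) (c : R -> R) :
    (forall G, {ae mu, forall xi, T (A G) xi = cis (c xi) *: T G xi}) ->
    forall m, {ae mu, forall xi, T (iter m A F) xi = cis (m%:R * c xi) *: T F xi}.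
  move=> hA; elim=> [|m IH]; first by apply: aeW => xi; rewrite mul0r cis0 scale1r.
  apply: filterS2 (hA (iter m A F)) IH => xi e1 e2.
  apply: (etrans e1); apply: (etrans (congr1 (fun v => cis (c xi) *: v) e2)).
  by rewrite scalerA -cisD; congr (cis _ *: _); rewrite -[m.+1]addn1 natrD; ring.
case: k => m.
- by apply: filterS (iterE _ _ fiber_transl m) => xi e; apply: (etrans e); rewrite mulrN.
- apply: filterS (iterE _ _ fiber_transl_inv m.+1) => xi e; apply: (etrans e).
  by rewrite NegzE mulrNz mulNr opprK.
Qed.

Lemma parseval_fiber F G :
  ((2 * pi)%:E * (\esum_(k in [set: int]) (normc (ipL2n F (transl_pow z k G)) ^+ 2)%:E) =
   \int[mu]_(xi in cell) (normc (ip (T F xi) (T G xi)) ^+ 2)%:E)%E.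
Proof.
pose h xi := ip (T F xi) (T G xi).
have mh : cmeasurable h by apply: cmeasurable_ip_field; exact: borel_field_fiber.
have ih : cintble cell h by apply: cintble_ip_field; exact: l2_field_fiber.
have mc : measurable (cell : set R) by exact: measurable_itv.
have p0 : 0 < 2 * pi :> R by exact: period_gt0.
have coef (k : int) : (2 * pi)%:C * ipL2n F (transl_pow z k G) =
    cint cell (fun xi => h xi * cis (k%:~R * xi)).
  rewrite -ip_fiber; apply: eq_cint_ae; first exact: mc.
  - by apply: cmeasurable_ip_field; exact: borel_field_fiber.
  - by apply: cmeasurableM; [exact: mh|apply: cmeasurable_cis; exact: measurable_funM].
  - apply: filterS (fiber_transl_pow k G) => xi e _.
    apply: (etrans (congr1 (fun v => ip (T F xi) v) e)).
    rewrite (ipZr ipell2n_inner) mulrC; congr (_ * _).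
    by rewrite -[LHS]/((cis (- (k%:~R * xi)))^*)%C conj_cis opprK.
have N k : normc (ipL2n F (transl_pow z k G)) ^+ 2 =
    (2 * pi) ^- 2 * normc (cint cell (fun xi => h xi * cis (k%:~R * xi))) ^+ 2.
  have nz : normc ((2 * pi)%:C : R[i]) ^+ 2 = (2 * pi) ^+ 2.
    by rewrite sqr_normcE /= expr0n addr0.
  rewrite -coef sqr_normcM nz mulrA mulVf ?mul1r //.
  by rewrite expf_neq0 // gt_eqF.
(* The constants cancel: 2 pi from the statement, (2 pi)^(-2) from the coefficients and 2 pi from
   Parseval's identity. *)
under eq_esum do rewrite N EFinM.
rewrite esum_mulE; last 2 first.
- by rewrite invr_ge0 exprn_ge0 // ltW.
- by move=> k; rewrite lee_fin sqr_ge0.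
rewrite (parseval_cell mh ih) muleA -EFinM muleA -EFinM.
rewrite (_ : 2 * pi * _ * _ = 1) ?mul1e //.
by move: p0; move: (2 * pi) => t t0; field; rewrite lt0r_neq0.
Qed.

End FiberInnerProduct.

(** * Realizing measurable fields as fibers *)

Lemma measurable_piecewise {R : realType} (c : R -> int) (f : int -> R -> R) :
  (forall k, measurable [set x | c x = k]) -> (forall k, measurable_fun setT (f k)) ->
  measurable_fun [set: R] (fun x => f (c x) x).
Proof.
move=> mc mf.
have -> : [set: R] = \bigcup_j [set x | c x = int_enum j].
  apply/esym; rewrite -subTset => x _; have [_ _ /(_ (c x) I)[j _ jc]] := int_enum_bij.
  by exists j.
apply/measurable_fun_bigcup => [j|j]; first exact: mc.
apply: (@eq_measurable_fun _ _ _ _ _ (f (int_enum j))).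
  by move=> x; rewrite inE /= => ->.
exact: measurable_funTS.
Qed.

(* It suffices to change g on a Borel null set outside of which the countably
   many sets {g > q}, q rational, are Borel. *)
Lemma ae_eq_measurable {R : realType} (g : R -> R) : lebesgue_measurable g ->
  exists2 h : R -> R, measurable_fun setT h & {ae lebesgue_measure, forall x, g x = h x}.
Proof.
move=> mg.
have /choice[BM hBM] (q : rat) : exists BM : set R * set R,
    [/\ measurable BM.1, measurable BM.2, lebesgue_measure BM.2 = 0%E &
        forall x, ~ BM.2 x -> (ratr q < g x <-> BM.1 x)].
  have [B mB [N [M [mM M0 NM]] BN]] := mg _ (measurable_itv `]ratr q, +oo[%R).
  exists (B, M); split => // x nMx; have := congr1 (@^~ x) BN.
  rewrite /preimage /= in_itv /= andbT => <-; split; last by left.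
  by move=> [//|/NM].
pose M := \bigcup_(q : rat) (BM q).2.
have mM : measurable M by apply: bigcupT_measurable_rat => q; have [] := hBM q.
have M0 : {ae lebesgue_measure, forall x, ~ M x}.
  have := @ae_countable _ _ _ (@lebesgue_measure R) rat setT (fun q x => ~ (BM q).2 x) (countableP _).
  have h q : setT q -> {ae lebesgue_measure, forall x, ~ (BM q).2 x}.
    have [_ m2 z2 _] := hBM q; move=> _; exists (BM q).2; split => // x /= /contrapT //.
  move=> /(_ h); apply: filterS => x hx [q _ Mx]; exact: (hx q I).
exists (fun x => if `[< M x >] then 0 else g x); last first.
  by apply: filterS M0 => x nMx; case: asboolP.
move=> _; apply: (measurability _ (RGenOInfty.measurableE R)) => //.
move=> /= _ [_ [a ->] <-]; rewrite setTI preimage_itvoy.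
(* The set where the function exceeds [a] is the union over rationals q > a of the sets where it
   exceeds q. Off [M] these coincide with the Borel sets [(BM q).1], and on [M] the function is
   0. *)
rewrite [X in measurable X](_ : _ = \bigcup_(q : rat) ([set x | a < ratr q] `&`
   (((BM q).1 `\` M) `|` (M `&` [set x | ratr q < (0 : R)])))).
  apply: bigcupT_measurable_rat => q; apply: measurableI.
    by have [aq|qa] := boolP (a < ratr q); [rewrite (_ : [set _ | _] = setT)|rewrite (_ : [set _ | _] = set0)] => //;
      apply/seteqP; split => x //=; rewrite ?aq ?(negbTE qa).
  apply: measurableU; first by apply: measurableD => //; have [] := hBM q.
  apply: measurableI => //.
  by have [aq|qa] := boolP (ratr q < (0 : R)); [rewrite (_ : [set _ | _] = setT)|rewrite (_ : [set _ | _] = set0)] => //;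
      apply/seteqP; split => x //=; rewrite ?aq ?(negbTE qa).
apply/seteqP; split => x /=.
- move=> /rat_in_itvoo[q]; rewrite inE /= => /itvP hq; exists q => //; split; first by rewrite /= hq.
  move: hq; case: asboolP => Mx hq; first by right; split => //=; rewrite hq.
  left; split => //; have [_ _ _ h] := hBM q; apply/h; last by rewrite hq.
  by move=> m; apply: Mx; exists q.
- move=> [q _ [/= aq [[Bx nMx]|[Mx q0]]]].
  + case: asboolP => // _; apply: lt_trans aq _; have [_ _ _ h] := hBM q; apply/h => //.
    by move=> m; apply: nMx; exists q.
  + by case: asboolP => // _; exact: lt_trans aq q0.
Qed.

Section FieldRealization.
Context {R : realType} {n : nat} (theta : 'I_n -> R).
Local Notation mu := (@lebesgue_measure R).
Local Notation ip := (@ipell2n R n).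
Local Notation sqn := (sqnorm ip).
Local Notation T := (Tper theta).
Local Notation cell := [set` `[(- pi : R), - pi + 2 * pi[%R].
Local Notation cidx := (cell_index (- pi : R) (2 * pi)).

Lemma measurable_cell_index (k : int) : measurable [set x | cidx x = k].
Proof.
rewrite (_ : [set x | _] = [set` `[(- pi + 2 * pi * k%:~R : R), - pi + 2 * pi + 2 * pi * k%:~R[%R]).
  exact: measurable_itv.
apply/seteqP; split => x /=.
- move=> <-; have := cell_indexP (- pi) (period_gt0 (R := R)) x; rewrite /= !in_itv /=.
  by rewrite lerBrDr ltrBlDr.
- rewrite in_itv /= => h; rewrite -[x](subrK (2 * pi * k%:~R)).
  by apply: (cell_indexE period_gt0); rewrite /= in_itv /= lerBrDr ltrBlDr.
Qed.

(* X is the fiber field of the function whose Fourier transform takes, at the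
   points xi - theta i + 2 k pi with xi in the cell, the values X xi i k. *)
Lemma fiber_surjective (X : R -> ell2n R n) : l2_field X ->
  exists F : L2n R n, {ae mu, forall xi, cell xi -> T F xi = X xi}.
Proof.
move=> [bX fX].
pose H i (x : R) : R[i] := X (x - 2 * pi * (cidx x)%:~R) i (cidx x).
have HE i xi (k : int) : cell xi -> H i (xi + 2 * pi * k%:~R) = X xi i k.
  by move=> cx; rewrite /H (cell_indexE period_gt0 k cx) addrK.
have mH i : cmeasurable (H i).
  have ms (k : int) : measurable_fun [set: R] (fun x => x - 2 * pi * k%:~R) by exact: measurable_funB.
  split.
  - apply: (@measurable_piecewise _ cidx (fun k x => complex.Re (X (x - 2 * pi * k%:~R) i k))).
      exact: measurable_cell_index.
    by move=> k; have [m _] := cmeasurable_comp (bX i k) (ms k).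
  - apply: (@measurable_piecewise _ cidx (fun k x => complex.Im (X (x - 2 * pi * k%:~R) i k))).
      exact: measurable_cell_index.
    by move=> k; have [_ m] := cmeasurable_comp (bX i k) (ms k).
have fH i : (\int[mu]_x (normc (H i x) ^+ 2)%:E < +oo)%E.
  rewrite (ge0_integral_tile (- pi) period_gt0); first last.
  - by move=> x; rewrite lee_fin sqr_ge0.
  - exact: cmeasurable_sqr_normc.
  apply: le_lt_trans fX; apply: ge0_le_integral => //.
  - by move=> x _; apply: esum_ge0 => k _; rewrite lee_fin sqr_ge0.
  - apply: measurable_funTS; apply: emeasurable_fun_esum => //; first exact: countable_int.
      move=> k _; apply: cmeasurable_sqr_normc; apply: (cmeasurable_comp (mH i)).
      exact: measurable_funD.
    by move=> k x _ _; rewrite lee_fin sqr_ge0.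
  - by apply: measurable_funTS; exact: measurable_sqnorm_field.
  - move=> x cx; rewrite sqnorm_ell2nE (bigD1 i) //=.
    under eq_esum do rewrite HE //.
    by rewrite leeDl // sume_ge0 // => j _; apply: esum_ge0 => k _; rewrite lee_fin sqr_ge0.
have sG i : sqintegrable (fun eta => H i (eta + theta i)).
  have [mr mi] : cmeasurable (fun eta => H i (eta + theta i)).
    by apply: (cmeasurable_comp (mH i)); exact: measurable_funD.
  split => //; rewrite (ge0_integral_shift (theta i) (f := fun x => (normc (H i x) ^+ 2)%:E)) //.
    exact: cmeasurable_sqr_normc.
  by move=> x; rewrite lee_fin sqr_ge0.
have /choice[F hF] (i : 'I_n) : exists f, fourier f = toL2 (fun eta => H i (eta + theta i)).
  exact: fourier_surjective.
exists [ffun i => F i].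
have h : {ae mu, forall xi, forall i (k : int),
    fourier ([ffun i => F i] i) (xi - theta i + 2 * k%:~R * pi) =
    H i (xi + 2 * pi * k%:~R)}.
  apply: ae_all_fin => i; apply: ae_all_int => k.
  have h1 := ae_shift (- theta i + 2 * k%:~R * pi) (toL2E (sG i)).
  apply: filterS h1 => xi; rewrite ffunE hF addrA => e; apply: (etrans e).
  by congr (H i _); ring.
apply: filterS2 h (fiber_ae theta [ffun i => F i]) => xi e1 e2 cx.
by apply: ell2n_ext => i k; apply: (etrans (e2 i k)); apply: (etrans (e1 i k)); exact: HE.
Qed.

End FieldRealization.

(** * The frame identity in one fiber *)

Opaque csum oproj.

(* With t small and |b| tending to 0, this gives the continuity of the frame sum. *)
Lemma sqr_normcD_le {R : realType} (t : R) (a b : R[i]) : 0 < t ->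
  normc (a + b) ^+ 2 <= (1 + t) * normc a ^+ 2 + (1 + t^-1) * normc b ^+ 2.
Proof.
move=> t0; rewrite !sqr_normcE !CReImE.
move: (complex.Re a) (complex.Im a) (complex.Re b) (complex.Im b) => p q r s.
have key (u v : R) : 2 * u * v <= t * u ^+ 2 + t^-1 * v ^+ 2.
  rewrite -subr_ge0 (_ : _ - _ = t^-1 * (t * u - v) ^+ 2).
    by rewrite mulr_ge0 ?sqr_ge0 // invr_ge0 ltW.
  by field; rewrite lt0r_neq0.
have := key p r; have := key q s; nra.
Qed.

Lemma Re_polar {R : realType} (a d u w : R[i]) : complex.Re u = 0 -> complex.Re w = 0 ->
  complex.Re (a * (a * w + d^*)^* + (a * d + u)^*) = 0 -> complex.Re (a * d) = 0.
Proof. by case: a d u w => [p q] [r s] [? ?] [? ?] /= -> ->; lra. Qed.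

Section TightIdentity.
Context {R : realType} {n : nat} {I : choiceType} (A : set I) (x : I -> ell2n R n).
Variable J : set (ell2n R n).
Local Notation ip := (@ipell2n R n).
Local Notation sqn := (sqnorm ip).
Local Notation P := (oproj ip J).
Hypothesis cJ : closed_subspace ip J.
Implicit Types f g h : ell2n R n.

Definition frame_sum f : \bar R := (\esum_(i in A) (normc (ip f (x i)) ^+ 2)%:E)%E.

Definition frame_summable f : Prop := sqsummable A (fun i => ip f (x i)).

(* The frame identity at f says that the diagonal entry defect f f vanishes; as
   a Hermitian form, defect can be polarized. *)
Definition defect f g : R[i] :=
  csum A (fun i => ip f (x i) * (ip g (x i))^*) - ip (P f) (P g).

Lemma frame_summable_lin (a : R[i]) f g : frame_summable f -> frame_summable g ->
  frame_summable (a *: f + g).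
Proof.
move=> sf sg; rewrite /frame_summable.
rewrite (_ : (fun i => _) = (fun i => a * ip f (x i) + ip g (x i))).
  exact: sqsummable_lin.
by apply/funext => i; rewrite (ip_linl ipell2n_inner).
Qed.

Lemma defect_lin (a : R[i]) f g h : frame_summable f -> frame_summable g -> frame_summable h ->
  defect (a *: f + g) h = a * defect f h + defect g h.
Proof.
move=> sf sg sh; rewrite /defect (oproj_linear ipell2n_inner ell2n_complete) //.
rewrite (ip_linl ipell2n_inner).
rewrite (@eq_csum _ _ _ _ (fun i => a * (ip f (x i) * (ip h (x i))^*) + ip g (x i) * (ip h (x i))^*)).
  rewrite csum_lin; [|exact: csummable_mul_conj|exact: csummable_mul_conj].
  by rewrite opprD addrACA mulrBr.
by move=> i _; rewrite (ip_linl ipell2n_inner) mulrDl mulrA.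
Qed.

Lemma defectC f g : frame_summable f -> frame_summable g -> defect g f = (defect f g)^*.
Proof.
move=> sf sg; have e := ipC ipell2n_inner (P f) (P g).
apply: (etrans (congr1 (fun v => csum A (fun i => ip g (x i) * (ip f (x i))^*) - v) e)).
have e2 : csum A (fun i => ip g (x i) * (ip f (x i))^*) = (csum A (fun i => ip f (x i) * (ip g (x i))^*))^*.
  rewrite -csumJ; last exact: csummable_mul_conj.
  by apply: eq_csum => i _; apply: complexP; rewrite !CReImE; ring.
apply: (etrans (congr1 (fun v => v - _) e2)).
by rewrite /defect; apply: complexP; rewrite !CReImE; ring.
Qed.

Lemma defect_diag f : frame_summable f ->
  ((complex.Re (defect f f))%:E = frame_sum f - (sqn (P f))%:E)%E.
Proof.
move=> sf; rewrite /defect CReD CReN EFinB /frame_sum -(csum_mul_conj sf).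
by rewrite (ip_selfE ipell2n_inner).
Qed.

Local Opaque defect.

Lemma frame_sum_tight f : frame_sum f = (sqn (P f))%:E -> frame_summable f.
Proof. by move=> e; rewrite /frame_summable /sqsummable -/(frame_sum f) e ltry. Qed.

Lemma defect_diag_tight f : frame_sum f = (sqn (P f))%:E -> complex.Re (defect f f) = 0.
Proof.
move=> e; apply: EFin_inj; rewrite defect_diag; last exact: frame_sum_tight.
by rewrite e subee.
Qed.

(** In the expansion of the form at [a *: g + f] the two diagonal terms have real part 0, and the
    two mixed terms are conjugate to each other. *)
Lemma defect_polar (a : R[i]) f g : frame_sum f = (sqn (P f))%:E ->
  frame_sum g = (sqn (P g))%:E ->
  frame_sum (f + a *: g) = (sqn (P (f + a *: g)))%:E ->
  complex.Re (a * defect g f) = 0.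
Proof.
move=> tf tg; rewrite addrC => tfg.
have [sf sg] := (frame_sum_tight tf, frame_sum_tight tg).
have sfg := frame_summable_lin a sg sf.
have e : defect (a *: g + f) (a *: g + f) =
    a * (a * defect g g + (defect g f)^*)^* + (a * defect g f + defect f f)^*.
  rewrite (defect_lin a sg sf sfg) (defectC sfg sg) (defectC sfg sf).
  by rewrite (defect_lin a sg sf sg) (defect_lin a sg sf sf) (defectC sg sf).
apply: (Re_polar (defect_diag_tight tf) (defect_diag_tight tg)).
by rewrite -e; exact: defect_diag_tight.
Qed.

Hypothesis tight_deltas : forall (k k' : int) (l j : 'I_n) (a : R[i]), (k', j) != (k, l) ->
  a \in [:: 0; 1; 'i] ->
  frame_sum (delta k l + a *: delta k' j) = (sqn (P (delta k l + a *: delta k' j)))%:E.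

(** With [a = 0] the second vector drops out; the index [(k + 1, l)] only has to differ from
    [(k, l)]. *)
Lemma tight_delta (k : int) (l : 'I_n) :
  frame_sum (delta k l) = (sqn (P (delta k l)))%:E.
Proof.
have := @tight_deltas k (k + 1) l l 0; rewrite scale0r addr0; apply.
  by rewrite xpair_eqE eqxx andbT -subr_eq0 addrAC subrr add0r.
by rewrite inE eqxx.
Qed.

(** Off the diagonal, [a = 1] kills the real part and [a = 'i] the imaginary part. On the diagonal
    the entry is real by Hermitian symmetry. *)
Lemma defect_delta (k k' : int) (l j : 'I_n) : defect (delta k' j) (delta k l) = 0.
Proof.
have [td td'] := (tight_delta k l, tight_delta k' j).
have [/eqP[-> ->]|ne] := boolP ((k', j) == (k, l)).
  apply: complexP; first exact: defect_diag_tight.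
  have := congr1 (@complex.Im R) (defectC (frame_sum_tight td) (frame_sum_tight td)).
  by rewrite CImJ /=; move: (complex.Im _) => t; lra.
have h1 := defect_polar td td' (tight_deltas ne (a := 1) _).
have hi := defect_polar td td' (tight_deltas ne (a := 'i) _).
rewrite !inE !eqxx !orbT in h1 hi.
have {h1} := h1 isT; have {hi} := hi isT; move: (defect _ _) => d.
rewrite !CReImE /= => hi h1; apply: complexP; rewrite /=.
  by move: h1; rewrite mul1r mul0r subr0.
by move: hi; rewrite mul0r mul1r sub0r => /eqP; rewrite oppr_eq0 => /eqP.
Qed.

Lemma frame_sum_head_part (m : nat) f :
  frame_sum (head_part m f) = (sqn (P (head_part m f)))%:E.
Proof.
(* Linearity is used in one argument at a time: vectors whose defect with every [delta] vanishes
   form a space [S] containing the finite combinations, and so do the vectors whose defect with all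
   of [S] vanishes. *)
pose S g := frame_summable g /\ forall k l, defect g (delta k l) = 0.
pose S' g := frame_summable g /\ forall h, S h -> defect h g = 0.
have sd k l : frame_summable (delta k l) := frame_sum_tight (tight_delta k l).
have head (Q : ell2n R n -> Prop) : (forall (a : R[i]) u v, Q u -> Q v -> Q (a *: u + v)) ->
    Q 0 -> (forall k l, Q (delta k l)) -> Q (head_part m f).
  move=> ql q0 qd; rewrite /head_part.
  have qD u v : Q u -> Q v -> Q (u + v) by move=> qu qv; rewrite -[u]scale1r; exact: ql.
  apply: big_ind => // i _; apply: big_ind => // j _; rewrite -[_ *: _]addr0; exact: ql.
have s0 : frame_summable 0.
  rewrite /frame_summable /sqsummable esum1 ?ltry // => i _.
  by rewrite (ip0l ipell2n_inner) /= expr0n /= addr0 sqrtr0 expr0n.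
have d0 g : frame_summable g -> defect 0 g = 0.
  move=> sg; have := defect_lin (-1) s0 s0 sg.
  by rewrite scaler0 addr0 mulN1r addNr.
have hS : S (head_part m f).
  apply: head.
  - move=> a u v [su hu] [sv hv]; split; first exact: frame_summable_lin.
    by move=> k l; rewrite (defect_lin a su sv (sd k l)) hu hv mulr0 addr0.
  - by split; [exact: s0|move=> k l; exact: (d0 _ (sd k l))].
  - by move=> k l; split; [exact: sd|move=> k' l'; exact: defect_delta].
have hS' : S' (head_part m f).
  apply: head.
  - move=> a u v [su hu] [sv hv]; split; first exact: frame_summable_lin.
    move=> h Sh; have sh := Sh.1; rewrite (defectC (frame_summable_lin a su sv) sh) defect_lin //.
    rewrite (defectC sh su) (defectC sh sv) hu // hv //.
    by apply: complexP; rewrite !CReImE /=; ring.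
  - split => // h [sh _]; rewrite (defectC s0 sh) (d0 h sh).
    by apply: complexP; rewrite !CReImE /= ?oppr0.
  - by move=> k l; split; [exact: sd|move=> h [_]; apply].
have := defect_diag hS.1; rewrite (hS'.2 _ hS); case: (frame_sum _) => [r| |] //=.
by move=> e; have {e} : 0 = r - sqn (P (head_part m f)) := EFin_inj e; move=> /esym/eqP; rewrite subr_eq0 => /eqP ->.
Qed.

Lemma head_part_oproj_cvg f : sqn (P (head_part m f)) @[m --> \oo] --> sqn (P f).
Proof.
apply: (cvg_sqnorm ipell2n_inner).
apply: (@squeeze_cvgr _ _ _ _ (fun=> 0) (fun m => sqn (head_part m f - f))).
- near=> m; rewrite (sqnorm_ge0 ipell2n_inner) /=.
  have -> : P (head_part m f) - P f = P (head_part m f - f).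
    have := oproj_linear ipell2n_inner ell2n_complete (-1) f (head_part m f) cJ.
    by rewrite !scaleN1r addrC => ->; rewrite addrC.
  exact: (sqnorm_oproj_le ipell2n_inner ell2n_complete).
- exact: cvg_cst.
- exact: head_part_cvg.
Unshelve. all: by end_near. Qed.

(** Finite partial sums are continuous in [f], so the identity at the head parts bounds each of
    them; only this inequality survives the supremum. *)
Lemma frame_sum_le f : (frame_sum f <= (sqn (P f))%:E)%E.
Proof.
apply: ge_ereal_sup => _ [F [finF FA] <-].
rewrite (fsbig_finite _ _ finF) sumEFin lee_fin.
have cF : \sum_(i <- finmap.enum_fset (fset_set F)) normc (ip (head_part m f) (x i)) ^+ 2 @[m --> \oo] -->
    \sum_(i <- finmap.enum_fset (fset_set F)) normc (ip f (x i)) ^+ 2.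
  apply: cvg_big => [|i _]; first exact: add_continuous.
  have [cr ci] := cvg_ipl ipell2n_inner (x i) (head_part_cvg f).
  rewrite sqr_normcE (_ : (fun m => _) = fun m => complex.Re (ip (head_part m f) (x i)) * complex.Re (ip (head_part m f) (x i)) +
    complex.Im (ip (head_part m f) (x i)) * complex.Im (ip (head_part m f) (x i))).
    by rewrite !expr2; apply: cvgD; apply: cvgM.
  by apply/funext => m; rewrite sqr_normcE !expr2.
apply: (ler_cvg_to cF (@head_part_oproj_cvg f)); near=> m.
rewrite -lee_fin -frame_sum_head_part -sumEFin -(fsbig_finite _ _ finF).
by apply: esum_ge; exists F.
Unshelve. all: by end_near. Qed.

(** For the opposite inequality the frame sum at [head_part m f] is compared with that at [f]; the
    difference of the two vectors is controlled by [frame_sum_le]. First [m] tends to infinity with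
    [t] fixed, then [t] tends to 0. *)
Lemma frame_sum_all f : frame_sum f = (sqn (P f))%:E.
Proof.
apply/eqP; rewrite eq_le frame_sum_le /=.
have sf : frame_summable f by apply: le_lt_trans (frame_sum_le f) (ltry _).
pose q := fine (frame_sum f).
have qE : q%:E = frame_sum f.
  by rewrite fineK // ge0_fin_numE // esum_ge0 // => i _; rewrite lee_fin sqr_ge0.
have step (t : R) m : 0 < t -> sqn (P (head_part m f)) <=
    (1 + t) * q + (1 + t^-1) * sqn (head_part m f - f).
  move=> t0; rewrite -lee_fin -frame_sum_head_part EFinD !EFinM qE.
  have ti : 0 < t^-1 by rewrite invr_gt0.
  apply: (@le_trans _ _ ((1 + t)%:E * frame_sum f + (1 + t^-1)%:E * frame_sum (head_part m f - f)%R)%E).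
    rewrite /frame_sum -!esum_mulE; last 4 first.
    - by rewrite addr_ge0 // ltW.
    - by move=> i; rewrite lee_fin sqr_ge0.
    - by rewrite addr_ge0 // ltW.
    - by move=> i; rewrite lee_fin sqr_ge0.
    rewrite -esumD; last 2 first.
    - by move=> i _; rewrite -EFinM lee_fin mulr_ge0 ?sqr_ge0 // addr_ge0 // ltW.
    - by move=> i _; rewrite -EFinM lee_fin mulr_ge0 ?sqr_ge0 // addr_ge0 // ltW.
    apply: le_esum => i _; rewrite -!EFinM -EFinD lee_fin.
    rewrite -{1}(subrK f (head_part m f)) (ipDl ipell2n_inner) addrC.
    exact: sqr_normcD_le.
  apply: leeD => //; apply: lee_wpmul2l; first by rewrite lee_fin addr_ge0 // ltW.
  apply: le_trans (frame_sum_le _) _; rewrite lee_fin.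
  exact: (sqnorm_oproj_le ipell2n_inner ell2n_complete).
have bound (t : R) : 0 < t -> sqn (P f) <= (1 + t) * q.
  move=> t0.
  have c : (1 + t) * q + (1 + t^-1) * sqn (head_part m f - f) @[m --> \oo] --> (1 + t) * q + (1 + t^-1) * 0.
    by apply: cvgD; [exact: cvg_cst|apply: cvgMr; exact: head_part_cvg].
  rewrite mulr0 addr0 in c.
  by apply: (ler_cvg_to (@head_part_oproj_cvg f) c); near=> m; exact: step.
rewrite -qE lee_fin; apply/ler_addgt0Pr => e e0.
have q0 : 0 <= q by rewrite /q fine_ge0 // esum_ge0 // => i _; rewrite lee_fin sqr_ge0.
(* This value of [t] gives [t * q <= e], even when [q = 0]. *)
have t0 : 0 < e / (q + 1) by rewrite divr_gt0 // ltr_wpDl.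
apply: le_trans (bound _ t0) _; rewrite mulrDl mul1r lerD2l mulrAC ler_pdivrMr ?ltr_wpDl //.
by rewrite ler_pM2l // lerDl.
Unshelve. all: by end_near. Qed.

End TightIdentity.

Section TightMembership.
Context {R : realType} {n : nat} {I : choiceType} (A : set I) (x : I -> ell2n R n).
Local Notation ip := (@ipell2n R n).

(** For f = x i - P (x i) the right-hand side of the identity is 0, while the term of index [i] on
    the left is the squared modulus of [ip f (x i)], and [ip f (x i)] has real part
    [sqnorm ip f]. *)
Lemma tight_mem (J : set (ell2n R n)) : closed_subspace ip J ->
  (forall f, frame_sum A x f = (sqnorm ip (oproj ip J f))%:E) ->
  forall i, A i -> J (x i).
Proof.
move=> cJ h i Ai.
pose p := oproj ip J (x i); pose f := x i - p.
have Jp : J p by exact: (oproj_in ipell2n_inner ell2n_complete).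
have fJ v : J v -> ip f v = 0.
  by move=> Jv; rewrite (ipDl ipell2n_inner) (ipNl ipell2n_inner) (ip_oproj ipell2n_inner ell2n_complete) // subrr.
have Pf : oproj ip J f = 0.
  apply: (oproj_unique ipell2n_inner ell2n_complete) => //; first by case: cJ.
  by move=> v Jv; rewrite fJ // (ip0l ipell2n_inner).
have f0 : ip f (x i) = 0.
  apply: sqr_normc_eq0; apply/eqP; rewrite eq_le sqr_ge0 andbT -lee_fin.
  apply: (@le_trans _ _ (frame_sum A x f)); last by rewrite h Pf (sqnorm0 ipell2n_inner).
  apply: esum_ge; exists [set i].
    by split => // j ->.
  by rewrite fsbig_set1.
have : sqnorm ip f = 0.
  have -> : sqnorm ip f = complex.Re (ip f (x i) - ip f p).
    by rewrite -(ipNr ipell2n_inner) -(ipDr ipell2n_inner).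
  by rewrite f0 fJ // subrr.
move=> /(sqnorm_eq0 ipell2n_inner) /eqP; rewrite subr_eq0 => /eqP ->.
exact: Jp.
Qed.

End TightMembership.

(** * Range functions *)

Opaque frame_sum transl_pow.

Lemma lam_lin1 {R : realType} {n : nat} (s : int) (a : R[i]) (x y : ell2n R n) :
  lam s (x + a *: y) = lam s x + a *: lam s y.
Proof. by rewrite addrC lam_lin addrC. Qed.

Lemma emul_cancel {R : realType} (t a : R) (x : \bar R) : 0 < t ->
  (t%:E * x = (t * a)%:E -> x = a%:E)%E.
Proof.
move=> t0 e; have := congr1 (fun y => t^-1%:E * y)%E e.
by rewrite muleA -!EFinM mulrA mulVf ?lt0r_neq0 // mul1r mul1e.
Qed.

Lemma ae_eq_of_integrals {R : realType} (D : set R) (f g : R -> \bar R) :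
  measurable D -> (@lebesgue_measure R).-integrable D f -> measurable_fun D g ->
  (forall E : set R, E `<=` D -> measurable E ->
    \int[lebesgue_measure]_(x in E) f x = \int[lebesgue_measure]_(x in E) g x)%E ->
  {ae lebesgue_measure, forall x : R, D x -> f x = g x}.
Proof. by move=> mD fi mg fg; exact: (@integral_ae_eq _ _ R (@lebesgue_measure R) D mD g f fi mg fg). Qed.

Section RangeFunction.
Context {R : realType} {n : nat} (theta : 'I_n -> R).
Variables (z : 'I_n -> R[i]) (V Phi : set (L2n R n)) (J : R -> set (ell2n R n)).
Hypothesis hz : forall k, z k = cis (- theta k).
Hypothesis hV : shift_invariant z V.
Hypothesis hJ : periodic_range_function theta V J.
Hypothesis hPhi : countable Phi.
Local Notation mu := (@lebesgue_measure R).
Local Notation ip := (@ipell2n R n).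
Local Notation sqn := (sqnorm ip).
Local Notation T := (Tper theta).
Local Notation cell := [set` `[(- pi : R), - pi + 2 * pi[%R].
Local Notation P xi := (oproj ip (J xi)).
Implicit Types (f g : ell2n R n) (F : L2n R n).

Definition fsum (xi : R) f : \bar R := frame_sum Phi (fun phi => T phi xi) f.

Let cJ xi : closed_subspace ip (J xi).
Proof. by case: hJ. Qed.

Let mc : measurable (cell : set R).
Proof. exact: measurable_itv. Qed.

Let muc : mu cell = (2 * pi)%:E.
Proof.
rewrite lebesgue_measure_itv /= lte_fin ltrDl period_gt0 -EFinB; congr EFin; ring.
Qed.

Lemma range_periodic xi (s : int) : J (xi + 2 * s%:~R * pi) = lam (- s) @` J xi.
Proof.
have [_ _ -> _] := hJ; apply/seteqP; split => y [x Jx <-]; exists x => //.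
- by rewrite adjoint_lam.
- by rewrite adjoint_lam.
Qed.

Lemma fiber_mem F : V F <-> {ae mu, forall xi, J xi (T F xi)}.
Proof. by have [_ _ _ VE] := hJ; rewrite {1}VE. Qed.

Lemma fsumE xi f : fsum xi f = (\esum_(phi in Phi) (normc (ip f (T phi xi)) ^+ 2)%:E)%E.
Proof. by []. Qed.

Lemma fsum_translate xi (s : int) f : fsum (xi + 2 * s%:~R * pi) f = fsum xi (lam s f).
Proof.
rewrite !fsumE; apply: eq_esum => phi _.
by rewrite fiber_periodic ip_lam.
Qed.

Lemma sqnorm_proj_translate xi (s : int) f :
  sqn (P (xi + 2 * s%:~R * pi) f) = sqn (P xi (lam s f)).
Proof.
have := @oproj_lam R n s _ _ (lam s f) (cJ xi) (cJ _) (range_periodic xi s).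
by rewrite lamNK => ->; rewrite sqnorm_lam.
Qed.

Lemma tight_translate xi (s : int) f :
  fsum (xi + 2 * s%:~R * pi) f = (sqn (P (xi + 2 * s%:~R * pi) f))%:E <->
  fsum xi (lam s f) = (sqn (P xi (lam s f)))%:E.
Proof. by rewrite fsum_translate sqnorm_proj_translate. Qed.

Lemma measurable_fsum (X : R -> ell2n R n) : borel_field X ->
  measurable_fun [set: R] (fun xi => fsum xi (X xi)).
Proof.
move=> bX; rewrite (_ : (fun xi => _) =
  (fun xi => \esum_(phi in Phi) (normc (ip (X xi) (T phi xi)) ^+ 2)%:E)%E) //.
apply: emeasurable_fun_esum => //.
- move=> phi _; apply: cmeasurable_sqr_normc; apply: cmeasurable_ip_field => //.
  exact: borel_field_fiber.
- by move=> phi xi _ _; rewrite lee_fin sqr_ge0.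
Qed.

(** Weak measurability tested against the [delta] vectors makes each coordinate Lebesgue measurable,
    hence almost everywhere equal to a Borel function. There are countably many coordinates, so the
    changes together stay within a null set. *)
Lemma proj_field f : exists2 X : R -> ell2n R n, borel_field X &
  {ae mu, forall xi, X xi = P xi f}.
Proof.
have [_ wJ _ _] := hJ.
have /choice[h hh] (p : 'I_n * int) : exists h : R -> R[i], cmeasurable h /\
    {ae mu, forall xi, P xi f p.1 p.2 = h xi}.
  have [lr li] := wJ f (delta p.2 p.1).
  have [hr mr er] := ae_eq_measurable lr; have [hi mi ei] := ae_eq_measurable li.
  exists (fun xi => hr xi +i* hi xi); split; first by [].
  apply: filterS2 er ei => xi; rewrite ipell2n_delta => e1 e2.
  by apply: complexP.
exists (fun xi => [ffun i => toell2 (fun k => h (i, k) xi)]).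
  by apply: (@borel_field_toell2 _ _ (fun i k => h (i, k))) => i k; have [] := hh (i, k).
have : {ae mu, forall xi, forall i k, P xi f i k = h (i, k) xi}.
  by apply: ae_all_fin => i; apply: ae_all_int => k; have [] := hh (i, k).
apply: filterS => xi e; apply: ell2n_ext => i k; rewrite ffunE.
have ek : (fun k => h (i, k) xi) = P xi f i by apply/funext => k'; rewrite e.
by rewrite toell2E ?e //; exact: (eq_ind_r (sqsummable setT) (ell2P _) ek).
Qed.

Lemma fsum_proj xi f : (forall phi, Phi phi -> J xi (T phi xi)) -> fsum xi (P xi f) = fsum xi f.
Proof.
move=> h; rewrite !fsumE; apply: eq_esum => phi Pphi.
by rewrite (ip_oproj ipell2n_inner ell2n_complete) //; exact: h.
Qed.

Lemma fsum0 xi : fsum xi 0 = 0%E.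
Proof.
rewrite fsumE esum1 // => phi _.
by rewrite (ip0l ipell2n_inner) /= expr0n /= addr0 sqrtr0 expr0n.
Qed.

Lemma borel_field_indic (E : set R) (X : R -> ell2n R n) : measurable E -> borel_field X ->
  borel_field (fun xi => (\1_E xi)%:C *: X xi).
Proof.
move=> mE bX i k; rewrite (_ : (fun xi => _) = (fun xi => (\1_E xi)%:C * X xi i k)).
  exact: cmeasurable_indic.
by apply/funext => xi; rewrite ell2n_ZE.
Qed.

(** [N] stands for the squared norm or for [fsum]; as both vanish at 0, cutting the field down to
    [E] cuts down the domain of integration. *)
Lemma integral_indic_field (E : set R) (X : R -> ell2n R n) (N : R -> ell2n R n -> \bar R) :
  E `<=` cell -> (forall xi, N xi 0 = 0%E) ->
  (\int[mu]_(xi in E) N xi (X xi) = \int[mu]_(xi in cell) N xi ((\1_E xi)%:C *: X xi))%E.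
Proof.
move=> Ec N0; rewrite -{1}((setIidPr _ _).2 Ec) integral_mkcondr.
apply: eq_integral => xi _; rewrite patchE indicE.
by case: ifPn => _; rewrite ?scale1r ?scale0r ?N0.
Qed.

(** Summing over the integers first reduces each [phi] to [parseval_fiber]; countability of [Phi]
    allows the sum over [phi] to enter the integral. *)
Lemma frame_total F :
  ((2 * pi)%:E * (\esum_(p in [set: int] `*` Phi) (normc (ipL2n F (transl_pow z p.1 p.2)) ^+ 2)%:E) =
   \int[mu]_(xi in cell) fsum xi (T F xi))%E.
Proof.
pose a (phi : L2n R n) (k : int) := (normc (ipL2n F (transl_pow z k phi)) ^+ 2)%:E.
have a0 phi k : (0 <= a phi k)%E by rewrite lee_fin sqr_ge0.
have -> : (\esum_(p in [set: int] `*` Phi) (normc (ipL2n F (transl_pow z p.1 p.2)) ^+ 2)%:E =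
    \esum_(phi in Phi) \esum_(k in [set: int]) a phi k)%E.
  rewrite esum_esum; last by move=> i j _ _; exact: a0.
  have bij : set_bij (Phi `*`` (fun=> [set: int])) ([set: int] `*` Phi) (fun p => (p.2, p.1)).
    split.
    - by move=> [phi k] [/= Pphi _].
    - by move=> [phi k] [phi' k'] _ _ /= [-> ->].
    - by move=> [k phi] [/= _ Pphi]; exists (phi, k).
  by rewrite (reindex_esum _ _ _ _ bij).
rewrite -esum_mulE; last 2 first.
- by rewrite ltW // period_gt0.
- by move=> phi; exact: esum_ge0.
rewrite (ge0_integral_esum _ hPhi) //.
- by apply: eq_esum => phi _; rewrite -(parseval_fiber hz).
- move=> phi _; apply: measurable_funTS; apply: cmeasurable_sqr_normc.
  by apply: cmeasurable_ip_field; exact: borel_field_fiber.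
- by move=> phi xi _ _; rewrite lee_fin sqr_ge0.
Qed.

Lemma tight_of_generator : Phi `<=` V -> NTF_generator z Phi V ->
  forall f, {ae mu, forall xi, fsum xi f = (sqn (P xi f))%:E}.
Proof.
move=> PhiV [_ ntf] f.
(* The identity for [f] on the [s]-th translate of the cell is the one for [lam s f] on the cell
   itself. *)
suff cellcase g : {ae mu, forall xi, cell xi -> fsum xi g = (sqn (P xi g))%:E}.
  apply: (@ae_tile _ (- pi) _ period_gt0) => s; apply: filterS (cellcase (lam s f)) => xi h cx.
  by have := (tight_translate xi s f).2 (h cx); rewrite (mulrAC 2).
have [X bX XE] := proj_field g.
have PhiJ : {ae mu, forall xi, forall phi, Phi phi -> J xi (T phi xi)}.
  by apply: ae_countable => // phi /PhiV /fiber_mem.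
(* A projection does not increase the norm, so the field is bounded on a cell of finite measure;
   this makes it realizable by fibers. *)
have leX : {ae mu, forall xi, cell xi -> ((sqn (X xi))%:E <= (sqn g)%:E)%E}.
  apply: filterS XE => xi e _; rewrite lee_fin (congr1 (fun v => sqn v) e).
  exact: (sqnorm_oproj_le ipell2n_inner ell2n_complete).
have finX : (\int[mu]_(xi in cell) (sqn (X xi))%:E < +oo)%E.
  apply: (@le_lt_trans _ _ (\int[mu]_(xi in cell) (sqn g)%:E)%E).
    apply: ae_ge0_le_integral => //.
    - by move=> xi _; rewrite lee_fin (sqnorm_ge0 ipell2n_inner).
    - by apply: measurable_funTS; exact: measurable_sqnorm_field.
    - by move=> xi _; rewrite lee_fin (sqnorm_ge0 ipell2n_inner).
  rewrite integral_cst // [X in (_ * X)%E](_ : _ = (2 * pi)%:E); last exact: muc.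
  by rewrite -EFinM ltry.
have lX : l2_field X by [].
have restrict (E : set R) : measurable E -> E `<=` cell ->
    (\int[mu]_(xi in E) (sqn (X xi))%:E = \int[mu]_(xi in E) fsum xi g)%E.
  move=> mE Ec.
  have bXE := borel_field_indic mE bX.
  have lXE : l2_field (fun xi => (\1_E xi)%:C *: X xi).
    split; first exact: bXE.
    apply: le_lt_trans finX; apply: ge0_le_integral => //.
    - by move=> xi _; rewrite lee_fin (sqnorm_ge0 ipell2n_inner).
    - by apply: measurable_funTS; exact: measurable_sqnorm_field.
    - by apply: measurable_funTS; exact: measurable_sqnorm_field.
    - move=> xi _; rewrite lee_fin indicE; case: (_ \in _).
        by rewrite scale1r.
      by rewrite scale0r (sqnorm0 ipell2n_inner) (sqnorm_ge0 ipell2n_inner).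
  have [F TF] := fiber_surjective theta lXE.
  (* The fibers of [F] are prescribed on one cell only; periodicity of the fibers and of [J] carries
     the membership to the whole line. *)
  have VF : V F.
    apply/fiber_mem; apply: (@ae_tile _ (- pi) _ period_gt0) => s.
    apply: filterS2 TF XE => xi e1 e2 cx.
    have Jx : J xi (T F xi).
      apply: (eq_ind_r (J xi) _ (e1 cx)); apply: (closed_subspaceZ _ (cJ xi)).
      apply: (eq_ind_r (J xi) _ e2).
      exact: (oproj_in ipell2n_inner ell2n_complete).
    have q : xi + 2 * pi * s%:~R = xi + 2 * s%:~R * pi by rewrite (mulrAC 2).
    rewrite q range_periodic fiber_periodic.
    by exists (T F xi).
  have total : (\int[mu]_(xi in cell) (sqn (T F xi))%:E = \int[mu]_(xi in cell) fsum xi (T F xi))%E.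
    by rewrite -frame_total (ntf F VF) sqnorm_fiber (sqr_hnorm ipL2n_inner) EFinM.
  have N0 (xi : R) : (sqn (0 : ell2n R n))%:E = 0%E by rewrite (sqnorm0 ipell2n_inner).
  have i1 := @integral_indic_field E X (fun _ v => (sqn v)%:E) Ec N0.
  have i2 := @integral_indic_field E (fun=> g) fsum Ec fsum0.
  have e1 : (\int[mu]_(xi in cell) (sqn ((\1_E xi)%:C *: X xi))%:E =
      \int[mu]_(xi in cell) (sqn (T F xi))%:E)%E.
    apply: ge0_integral_ae_eq; first exact: mc.
    - exact: measurable_sqnorm_field.
    - by apply: measurable_sqnorm_field; exact: borel_field_fiber.
    - apply: filterS TF => xi e cx.
      exact: (esym (congr1 (fun v => (sqn v)%:E) (e cx))).
  have e2 : (\int[mu]_(xi in cell) fsum xi ((\1_E xi)%:C *: g) =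
      \int[mu]_(xi in cell) fsum xi (T F xi))%E.
    apply: ge0_integral_ae_eq; first exact: mc.
    - exact: (measurable_fsum (borel_field_indic mE (borel_field_cst g))).
    - by apply: measurable_fsum; exact: borel_field_fiber.
    (* On [E] the fiber of [F] is the projection of [g]. Since the fibers of [Phi] lie in [J xi],
       the sum does not distinguish this projection from [g] itself. *)
    - apply: filterS (filterI TF (filterI XE PhiJ)) => xi [e [eX hP]] cx.
      apply: (etrans _ (esym (congr1 (fun v => fsum xi v) (e cx)))).
      rewrite indicE; case: (_ \in _); [rewrite !scale1r|by rewrite !scale0r].
      apply: (etrans (esym (fsum_proj g hP))).
      exact: (esym (congr1 (fun v => fsum xi v) eX)).
  exact: (etrans i1 (etrans e1 (etrans total (esym (etrans i2 e2))))).
(* Equal integrals over all Borel subsets of the cell, one of the two functions being integrable,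
   force equality almost everywhere. *)
have : {ae mu, forall xi, cell xi -> (sqn (X xi))%:E = fsum xi g}.
  apply: (ae_eq_of_integrals mc); first exact: integrable_sqnorm_field.
  - by apply: measurable_funTS; apply: measurable_fsum; exact: borel_field_cst.
  - by move=> E Ec mE; exact: restrict.
move=> h; apply: filterS2 h XE => xi e eX cx.
apply: (etrans (esym (e cx))); exact: (congr1 (fun v => (sqn v)%:E) eX).
Qed.

Lemma generator_of_tight : {ae mu, forall xi, forall f, fsum xi f = (sqn (P xi f))%:E} ->
  Phi `<=` V /\ NTF_generator z Phi V.
Proof.
move=> tight.
have PhiV : Phi `<=` V.
  move=> phi Pphi; apply/fiber_mem; apply: filterS tight => xi h.
  exact: (tight_mem (cJ xi) h Pphi).
split => //; split.
  by move=> [k phi] [/= _ Pphi]; have [_ inv] := hV; apply: inv; exact: PhiV.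
move=> F VF; rewrite (sqr_hnorm ipL2n_inner).
have e : (\int[mu]_(xi in cell) fsum xi (T F xi) = \int[mu]_(xi in cell) (sqn (T F xi))%:E)%E.
  apply: ge0_integral_ae_eq; first exact: mc.
  - by apply: measurable_fsum; exact: borel_field_fiber.
  - by apply: measurable_sqnorm_field; exact: borel_field_fiber.
  - apply: filterS2 tight ((fiber_mem F).1 VF) => xi h JF _.
    by rewrite h (oproj_id ipell2n_inner ell2n_complete).
move: e; rewrite -frame_total sqnorm_fiber.
by move=> /(emul_cancel period_gt0).
Qed.

Lemma tight_ae_of_deltas :
  (forall (k : int) (l j : 'I_n) (alpha : R[i]), (k, j) != (0, l) -> alpha \in [:: 0; 1; 'i] ->
    {ae mu, forall xi, fsum xi (delta 0 l + alpha *: delta k j) =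
      (sqn (P xi (delta 0 l + alpha *: delta k j)))%:E}) ->
  {ae mu, forall xi, forall f, fsum xi f = (sqn (P xi f))%:E}.
Proof.
move=> iii.
pose good xi := forall (k k' : int) (l j : 'I_n) (a : R[i]), (k', j) != (k, l) ->
  a \in [:: 0; 1; 'i] -> fsum xi (delta k l + a *: delta k' j) =
    (sqn (P xi (delta k l + a *: delta k' j)))%:E.
suff : {ae mu, forall xi, good xi}.
  by apply: filterS => xi h; exact: (frame_sum_all (cJ xi) h).
have one (a : R[i]) : a \in [:: 0; 1; 'i] -> {ae mu, forall xi, forall (k k' : int) (l j : 'I_n),
    (k', j) != (k, l) -> fsum xi (delta k l + a *: delta k' j) =
    (sqn (P xi (delta k l + a *: delta k' j)))%:E}.
  move=> ha; apply: ae_all_int => k; apply: ae_all_int => k'.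
  apply: ae_all_fin => l; apply: ae_all_fin => j.
  have [ne|eq] := boolP ((k', j) != (k, l)); last exact: aeW.
  have ne0 : (k' - k, j) != (0, l) by move: ne; rewrite !xpair_eqE subr_eq0.
  (* Evaluation at [xi + 2 k pi] shifts the pair of indices 0 and [k' - k] to [k] and [k']. The
     union of null sets is over countably many indices. *)
  apply: filterS (ae_shift (2 * k%:~R * pi) (iii _ _ _ _ ne0 ha)) => xi /tight_translate.
  by rewrite lam_lin1 !lam_delta add0r subrK.
have h0 := one 0 _; have h1 := one 1 _; have hi := one 'i _.
rewrite !inE !eqxx !orbT in h0 h1 hi.
apply: filterS3 (h0 isT) (h1 isT) (hi isT) => xi e0 e1 ei k k' l j a ne.
rewrite !inE => /orP[/eqP ->|/orP[/eqP ->|/eqP ->]]; [exact: e0|exact: e1|exact: ei].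
Qed.

(** Exchanging the arguments of the inner product leaves the modulus unchanged and conjugates the
    scalar, whence [alpha^*] in the formula. *)
Lemma fsum_deltas_ae (k : int) (l j : 'I_n) (alpha : R[i]) :
  {ae mu, forall xi, fsum xi (delta 0 l + alpha *: delta k j) =
    (\esum_(phi in Phi) (normc (fourier (phi l) (xi - theta l) +
      alpha^* * fourier (phi j) (xi - theta j + 2 * k%:~R * pi)) ^+ 2)%:E)%E}.
Proof.
have : {ae mu, forall xi, forall phi, Phi phi -> forall i (k : int),
    T phi xi i k = fourier (phi i) (xi - theta i + 2 * k%:~R * pi)}.
  by apply: ae_countable => // phi _; exact: fiber_ae.
apply: filterS => xi h; rewrite fsumE; apply: eq_esum => phi /h {}h.
congr (_%:E); rewrite (ipC ipell2n_inner) sqr_normcJ (ipDr ipell2n_inner) (ipZr ipell2n_inner).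
by rewrite !ipell2n_delta !h mulr0 mul0r addr0.
Qed.

End RangeFunction.

Theorem theorem4p5 (R : realType) (N n : nat) (hN : (2 <= N)%N) (hn : (1 <= n)%N)
    (sigma : {perm 'I_n}) (theta : 'I_n -> R) (z : 'I_n -> R[i])
    (htheta : forall k, - pi <= theta k < pi)
    (hz : forall k, z k = cis (- theta k))
    (hsigma : forall k, z k ^+ N = z (sigma k))
    (V : set (L2n R n)) (hV : shift_invariant z V)
    (J : R -> set (ell2n R n)) (hJ : periodic_range_function theta V J)
    (Phi : set (L2n R n)) (hPhi : countable Phi) :
  let stmt_i := Phi `<=` V /\ NTF_generator z Phi V in
  let stmt_ii := forall f : ell2n R n,
    {ae lebesgue_measure, forall xi : R,
      \esum_(phi in Phi) (normc (ipell2n f (Tper theta phi xi)) ^+ 2)%:E =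
      (hnorm ipell2n (oproj ipell2n (J xi) f) ^+ 2)%:E} in
  let stmt_iii := forall (k : int) (l j : 'I_n) (alpha : R[i]),
    (k, j) != (0, l) -> alpha \in [:: 0; 1; 'i] ->
    {ae lebesgue_measure, forall xi : R,
      \esum_(phi in Phi)
        (normc (fourier (phi l) (xi - theta l) +
                alpha^* * fourier (phi j) (xi - theta j + 2 * k%:~R * pi)) ^+ 2)%:E =
      (hnorm ipell2n (oproj ipell2n (J xi) (delta 0 l + alpha *: delta k j)) ^+ 2)%:E} in
  (stmt_i <-> stmt_ii) /\ (stmt_ii <-> stmt_iii).
Proof.
move=> stmt_i stmt_ii stmt_iii.
have norm2 (xi : R) (f : ell2n R n) : (hnorm ipell2n (oproj ipell2n (J xi) f) ^+ 2)%:E =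
    (sqnorm (@ipell2n R n) (oproj ipell2n (J xi) f))%:E.
  by rewrite (sqr_hnorm ipell2n_inner).
have iiE : stmt_ii <-> forall f, {ae lebesgue_measure, forall xi,
    fsum theta Phi xi f = (sqnorm (@ipell2n R n) (oproj ipell2n (J xi) f))%:E}.
  split=> h f; apply: filterS (h f) => xi e.
  - exact: (etrans e (norm2 xi f)).
  - exact: (etrans e (esym (norm2 xi f))).
have i_ii : stmt_i -> stmt_ii.
  by move=> [PhiV ntf]; apply/iiE; exact: (tight_of_generator hz hJ hPhi PhiV ntf).
have ii_iii : stmt_ii -> stmt_iii.
  move=> /iiE h k l j alpha _ _.
  apply: filterS2 (h (delta 0 l + alpha *: delta k j))
    (fsum_deltas_ae theta hPhi k l j alpha) => xi e1 e2.
  exact: (etrans (esym e2) (etrans e1 (esym (norm2 xi _)))).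
have iii_tight : stmt_iii -> {ae lebesgue_measure, forall xi, forall f,
    fsum theta Phi xi f = (sqnorm (@ipell2n R n) (oproj ipell2n (J xi) f))%:E}.
  move=> h; apply: (tight_ae_of_deltas hJ) => k l j alpha ne ha.
  apply: filterS2 (h k l j alpha ne ha) (fsum_deltas_ae theta hPhi k l j alpha) => xi e1 e2.
  exact: (etrans e2 (etrans e1 (norm2 xi _))).
have iii_i : stmt_iii -> stmt_i.
  by move=> /iii_tight; exact: (generator_of_tight hz hV hJ hPhi).
by split; split => // h; [exact/iii_i/ii_iii|exact/i_ii/iii_i].
Qed.
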